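(* Let $f(z)=z+a_2z^2+a_3z^3+\cdots$ be analytic in the unit disk $\mathbb{D}=\{z:|z|<1\}$ with $a_2=0$, and let $f^{-1}(w)=w+A_2w^2+A_3w^3+A_4w^4+A_5w^5+\cdots$ be the expansion of its inverse function near $w=0$. Set $H_2(3)(f^{-1})=A_3A_5-A_4^2$. Then: (a) if $\operatorname{Re} f'(z)>0$ for all $z\in\mathbb{D}$, then $|H_2(3)(f^{-1})|\le \frac{28}{45}$; (b) if $\operatorname{Re}\left[1+\frac{zf''(z)}{f'(z)}\right]>0$ for all $z\in\mathbb{D}$, then $|H_2(3)(f^{-1})|\le \frac{2}{45}$; (c) if $\operatorname{Re}\frac{zf'(z)}{f(z)}>0$ for all $z\in\mathbb{D}$, then $|H_2(3)(f^{-1})|\le 2$; (d) if $\operatorname{Re}\frac{2zf'(z)}{f(z)-f(-z)}>0$ for all $z\in\mathbb{D}$, then $|H_2(3)(f^{-1})|\le 2$. All these bounds are sharp, i.e., in each case the bound is attained by some function $f$ in the respective class with $a_2=0$.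
   Context: The four conditions define, respectively, the classes of functions of bounded turning, convex functions, starlike functions, and functions starlike with respect to symmetric points (all normalized by $f(0)=0$, $f'(0)=1$); such functions are univalent in $\mathbb{D}$, so $f^{-1}$ exists and is analytic in a neighbourhood of $0$. *)

(* Defs.v *)
From Stdlib Require Import Reals.
From Coquelicot Require Import Coquelicot.
Open Scope C_scope.

Definition in_disk (z : C) : Prop := (Cmod z < 1)%R.

Definition normalized_analytic (f : C -> C) (a : nat -> C) : Prop :=
  a 0%nat = 0 /\ a 1%nat = 1 /\
  forall z, in_disk z -> is_series (fun n => a n * z ^ n) (f z).

Definition inverse_coeffs (f : C -> C) (A : nat -> C) : Prop :=
  exists r : R, (0 < r)%R /\ exists g : C -> C,
    forall w, (Cmod w < r)%R ->
      is_series (fun n => A n * w ^ n) (g w) /\ in_disk (g w) /\ f (g w) = w.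

Definition hankel23 (A : nat -> C) : C := A 3%nat * A 5%nat - A 4%nat * A 4%nat.

Definition bounded_turning (f : C -> C) : Prop :=
  exists f1 : C -> C,
    (forall z, in_disk z -> is_derive f z (f1 z)) /\
    (forall z, in_disk z -> (0 < Re (f1 z))%R).

Definition convex_fn (f : C -> C) : Prop :=
  exists f1 f2 : C -> C,
    (forall z, in_disk z -> is_derive f z (f1 z)) /\
    (forall z, in_disk z -> is_derive f1 z (f2 z)) /\
    (forall z, in_disk z -> f1 z <> 0 /\ (0 < Re ((1 + z * f2 z / f1 z)%C))%R).

(* (c) starlike: Re (z f'(z)/f(z)) > 0 in D; the quotient is defined at z <> 0
   (f(z) <> 0 there), and at z = 0 its value is 1 by continuity. *)
Definition starlike_fn (f : C -> C) : Prop :=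
  exists f1 : C -> C,
    (forall z, in_disk z -> is_derive f z (f1 z)) /\
    (forall z, in_disk z -> z <> 0 -> f z <> 0 /\ (0 < Re ((z * f1 z / f z)%C))%R).

(* (d) starlike w.r.t. symmetric points: Re (2 z f'(z)/(f(z) - f(-z))) > 0 in D;
   at z = 0 the quotient equals 1 by continuity. *)
Definition sym_starlike_fn (f : C -> C) : Prop :=
  exists f1 : C -> C,
    (forall z, in_disk z -> is_derive f z (f1 z)) /\
    (forall z, in_disk z -> z <> 0 ->
       f z - f (- z) <> 0 /\ (0 < Re ((2 * z * f1 z / (f z - f (- z)))%C))%R).

Definition sharp_H23_bound (P : (C -> C) -> Prop) (c : R) : Prop :=
  (forall (f : C -> C) (a A : nat -> C),
      normalized_analytic f a -> a 2%nat = 0 -> P f -> inverse_coeffs f A ->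
      (Cmod (hankel23 A) <= c)%R) /\
  (exists (f : C -> C) (a A : nat -> C),
      normalized_analytic f a /\ a 2%nat = 0 /\ P f /\ inverse_coeffs f A /\
      Cmod (hankel23 A) = c).

(* Main.v *)
Require Import Defs.
From Stdlib Require Import Reals Lra Lia ClassicalEpsilon.
From Coquelicot Require Import Coquelicot.

(** Comparing coefficients in [f (g w) = w] with [a_2 = 0] gives
    [H_2(3)(f^-1) = a_3 a_5 - 3 a_3^3 - a_4^2].  In each class the [a_n] are
    polynomials in the coefficients of a function [p] of positive real part, and
    since [p = 1 + 2 x z^2 + 2 y z^3 + 2 (v + x^2) z^4 + ...] the functional becomes
    [alpha x v - B x^3 - gamma y^2] with [B] the claimed bound.  Testing positivity
    of [Re p] on the circle against squares [|q|^2] of polynomials yields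
    [|y|, |v| <= 1 - |x|^2], and an inequality in the single variable [|x|] remains.

    The function [p] is only known as a quotient of power series, so instead of
    Fourier coefficients the test uses the minimum principle: on the circle
    [Re p |q|^2] is the real part of a holomorphic function whose value at [0] is the
    Toeplitz form.  The minimum principle itself is the second-derivative test for
    [Re h - eps |z|^2].

    The inverse series starts at a zero of [f]; that [f] has no zero but [0] is
    proved in the convex and the symmetric case by looking at the point of least
    modulus where the real part of [f / (z f')], respectively of [f / G] with
    [G] convex, vanishes.  Equality holds for [p = (1 + z^2) / (1 - z^2)], whose [f]
    is inverted by solving [g = w - sum_(k >= 2) a_k g^k] coefficientwise. *)

Open Scope C_scope.

(** * Complex derivatives and power series *)

(** Sharpness is visible in the normal form: at [|x| = 1] the two estimates force [y = v = 0] and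
    leave [|B x^3| = B]. So [B] is dictated by the coefficient of [x^3], and the inequality in [|x|]
    only says that no smaller [|x|] does better. In all four classes [p] is a quotient [N / M] of
    normalized power series, with [M] equal to [1], [f'], [f(z)/z] and [(f(z) - f(-z))/(2z)]
    respectively; one lemma about such quotients serves them all once the coefficients up to degree
    4 are matched. Positivity is known inside the open disk only, while the test takes place on the
    circle; hence the passage to [p(r z)] and the limit [r -> 1] at the end. Of univalence just one
    consequence is used: the single zero of [f], which gives [A 0 = 0]. In the upper bounds the
    inverse series is given; it has to be constructed only for the extremal functions, whose
    coefficients have modulus at most [1], so that explicit radii suffice. *)

Lemma is_C_derive_eps (f : C -> C) (z l : C) :
  is_derive f z l <->
  forall eps : R, (0 < eps)%R -> exists d : R, (0 < d)%R /\
    forall w, (Cmod (w - z) < d)%R ->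
      (Cmod (f w - f z - (w - z) * l) <= eps * Cmod (w - z))%R.
Proof.
  split.
  - intros [_ H] eps Heps.
    destruct (H z (fun P HP => HP) (mkposreal eps Heps)) as [d Hd].
    exists d; split; [apply cond_pos|].
    intros w Hw; exact (Hd w Hw).
  - intros H; split; [apply is_linear_scal_l|].
    intros x Hx.
    assert (E : z = x).
    { exact (@is_filter_lim_locally_unique C_AbsRing (AbsRing_NormedModule C_AbsRing) z x Hx). }
    subst x.
    intros [eps Heps]. destruct (H eps Heps) as [d [Hd1 Hd]].
    exists (mkposreal d Hd1). intros w Hw. exact (Hd w Hw).
Qed.

Lemma is_C_derive_eq (f : C -> C) (z l l' : C) :
  is_derive f z l -> is_derive f z l' -> l = l'.
Proof.
  intros H H'.
  rewrite <- (is_C_derive_unique f z l H). now apply is_C_derive_unique.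
Qed.

Lemma is_C_derive_plus (f g : C -> C) (z df dg : C) :
  is_derive f z df -> is_derive g z dg ->
  is_derive (fun w => f w + g w) z (df + dg).
Proof. intros; now apply (is_derive_plus f g). Qed.

(** [C_NormedModule] has the product uniform structure, whereas the general product and chain rules
    view [C] as a normed module over itself. The remainder condition in a derivative sees only the
    norm, which is [Cmod] in both. *)
Lemma is_derive_C_AbsRing (f : C -> C) (z l : C) :
  @is_derive C_AbsRing C_NormedModule f z l <->
  @is_derive C_AbsRing (AbsRing_NormedModule C_AbsRing) f z l.
Proof.
  split; intros [_ H]; (split; [apply is_linear_scal_l|]); intros x Hx eps;
    exact (H x Hx eps).
Qed.

Lemma is_C_derive_mult (f g : C -> C) (z df dg : C) :
  is_derive f z df -> is_derive g z dg ->
  is_derive (fun w => f w * g w) z (df * g z + f z * dg).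
Proof.
  intros Hf Hg. apply is_derive_C_AbsRing in Hf, Hg. apply is_derive_C_AbsRing.
  exact (is_derive_mult (K := C_AbsRing) f g z df dg Hf Hg Cmult_comm).
Qed.

Lemma is_C_derive_comp (f g : C -> C) (z df dg : C) :
  is_derive f (g z) df -> is_derive g z dg ->
  is_derive (fun w => f (g w)) z (dg * df).
Proof.
  intros Hf Hg. apply is_derive_C_AbsRing in Hg.
  exact (is_derive_comp f g z df dg Hf Hg).
Qed.

Lemma is_C_derive_const (c z : C) : is_derive (fun _ : C => c) z (RtoC 0).
Proof. exact (is_derive_const c z). Qed.

Lemma is_C_derive_id (z : C) : is_derive (fun w : C => w) z (RtoC 1).
Proof. apply is_derive_C_AbsRing. exact (is_derive_id z). Qed.

Lemma is_C_derive_continuous (f : C -> C) (z l : C) :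
  is_derive f z l -> forall eps : R, (0 < eps)%R ->
  exists d : R, (0 < d)%R /\
    forall w, (Cmod (w - z) < d)%R -> (Cmod (f w - f z) < eps)%R.
Proof.
  intros H eps Heps.
  destruct (proj1 (is_C_derive_eps f z l) H 1%R Rlt_0_1) as [d [Hd Hw]].
  set (K := (1 + Cmod l)%R).
  assert (HK : (0 < K)%R) by (unfold K; generalize (Cmod_ge_0 l); lra).
  exists (Rmin d (eps / K)); split.
  - apply Rmin_pos; trivial. now apply Rdiv_lt_0_compat.
  - intros w Hwz.
    assert (H1 := Hw w (Rlt_le_trans _ _ _ Hwz (Rmin_l _ _))).
    assert (H2 := Rlt_le_trans _ _ _ Hwz (Rmin_r _ _)).
    replace (f w - f z) with ((f w - f z - (w - z) * l) + (w - z) * l) by ring.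
    eapply Rle_lt_trans; [apply Cmod_triangle|]. rewrite Cmod_mult.
    apply Rle_lt_trans with (Cmod (w - z) * K)%R; [unfold K; lra|].
    apply Rmult_lt_compat_r with (r := K) in H2; trivial.
    replace (eps / K * K)%R with eps in H2 by (field; lra). exact H2.
Qed.

Lemma Cmod_sub_sym (z w : C) : Cmod (z - w) = Cmod (w - z).
Proof. rewrite <- Cmod_opp. f_equal. ring. Qed.

Lemma Cmod_triangle_inv (z w : C) : (Cmod z - Cmod w <= Cmod (z - w))%R.
Proof.
  generalize (Cmod_triangle (z - w) w). replace (z - w + w) with z by ring. lra.
Qed.

Lemma is_C_derive_inv_id (z : C) : z <> 0 ->
  is_derive (fun w : C => / w) z (- / (z * z)).
Proof.
  intros Hz. apply is_C_derive_eps. intros eps Heps.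
  assert (Hm : (0 < Cmod z)%R) by now apply Cmod_gt_0.
  set (m := Cmod z) in *.
  (* The remainder is [(w - z)^2 / (w z^2)]; [|w| > m / 2] bounds it by [2 |w - z|^2 / m^3]. *)
  exists (Rmin (m / 2) (eps * (m * m * m) / 2)); split.
  - apply Rmin_pos; [lra|]. apply Rdiv_lt_0_compat; [|lra].
    repeat apply Rmult_lt_0_compat; trivial.
  - intros w Hw.
    assert (H1 := Rlt_le_trans _ _ _ Hw (Rmin_l _ _)).
    assert (H2 := Rlt_le_trans _ _ _ Hw (Rmin_r _ _)).
    assert (Hwm : (m / 2 < Cmod w)%R).
    { generalize (Cmod_triangle_inv z w). rewrite Cmod_sub_sym. fold m. lra. }
    assert (Hw0 : w <> 0) by (apply Cmod_gt_0; lra).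
    replace (/ w - / z - (w - z) * - / (z * z))
      with ((w - z) * (w - z) * / (w * (z * z))) by (field; now split).
    assert (w * (z * z) <> 0).
    { repeat apply Cmult_neq_0; trivial. }
    rewrite Cmod_mult, Cmod_inv, !Cmod_mult by trivial. fold m.
    set (h := Cmod (w - z)) in *. assert (0 <= h)%R by apply Cmod_ge_0.
    rewrite Rmult_assoc, Rmult_comm.
    apply Rmult_le_compat_r; trivial.
    assert (Hp : (0 < Cmod w * (m * m))%R) by (repeat apply Rmult_lt_0_compat; lra).
    apply Rmult_le_reg_r with (1 := Hp).
    rewrite Rmult_assoc, Rinv_l, Rmult_1_r by lra.
    apply Rle_trans with (eps * (m * m * m) / 2)%R; [lra|].
    assert (0 < eps * (m * m))%R by (repeat apply Rmult_lt_0_compat; lra).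
    nra.
Qed.

Lemma is_C_derive_inv (f : C -> C) (z l : C) : f z <> 0 ->
  is_derive f z l -> is_derive (fun w => / f w) z (l * - / (f z * f z)).
Proof.
  intros Hz Hf. apply (is_C_derive_comp (fun w => / w) f); trivial.
  now apply is_C_derive_inv_id.
Qed.

Lemma is_C_derive_eq_val (f : C -> C) (z l l' : C) :
  is_derive f z l -> l = l' -> is_derive f z l'.
Proof. now intros H <-. Qed.

Lemma is_C_derive_ext_ball (f g : C -> C) (z l : C) (d : R) : (0 < d)%R ->
  (forall w, (Cmod (w - z) < d)%R -> f w = g w) ->
  is_derive f z l -> is_derive g z l.
Proof.
  intros Hd H. apply is_derive_ext_loc. now exists (mkposreal d Hd).
Qed.

(** * Complex series through real and imaginary parts *)

Lemma sum_n_Re (u : nat -> C) n : Re (sum_n u n) = sum_n (fun k => Re (u k)) n.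
Proof.
  induction n as [|n IH]; [now rewrite !sum_O|].
  rewrite !sum_Sn, <- IH. reflexivity.
Qed.

Lemma sum_n_Im (u : nat -> C) n : Im (sum_n u n) = sum_n (fun k => Im (u k)) n.
Proof.
  induction n as [|n IH]; [now rewrite !sum_O|].
  rewrite !sum_Sn, <- IH. reflexivity.
Qed.

Lemma is_C_series_components (u : nat -> C) (l : C) :
  is_series u l <->
  is_series (fun n => Re (u n)) (Re l) /\ is_series (fun n => Im (u n)) (Im l).
Proof.
  split.
  - intros H; split; intros P [eps HP].
    + destruct (H (fun w => ball (Re l) eps (Re w))) as [N HN].
      { exists eps. intros w [Hw _]; exact Hw. }
      exists N. intros n Hn. apply HP. rewrite <- sum_n_Re. now apply HN.
    + destruct (H (fun w => ball (Im l) eps (Im w))) as [N HN].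
      { exists eps. intros w [_ Hw]; exact Hw. }
      exists N. intros n Hn. apply HP. rewrite <- sum_n_Im. now apply HN.
  - intros [H1 H2] P [eps HP].
    destruct (H1 (ball (Re l) eps)) as [N1 HN1]; [now exists eps|].
    destruct (H2 (ball (Im l) eps)) as [N2 HN2]; [now exists eps|].
    exists (N1 + N2)%nat. intros n Hn. apply HP. split.
    + generalize (HN1 n ltac:(lia)). rewrite <- sum_n_Re. trivial.
    + generalize (HN2 n ltac:(lia)). rewrite <- sum_n_Im. trivial.
Qed.

(** A total function, like the real [Series]; the value means something only for convergent
    series. *)
Definition CSeries (u : nat -> C) : C :=
  (Series (fun n => Re (u n)), Series (fun n => Im (u n))).

Lemma is_C_series_unique (u : nat -> C) (l : C) : is_series u l -> CSeries u = l.
Proof.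
  intros H. apply is_C_series_components in H. destruct H as [H1 H2].
  unfold CSeries. rewrite (is_series_unique _ _ H1), (is_series_unique _ _ H2).
  now destruct l.
Qed.

Lemma im_le_Cmod (c : C) : (Rabs (Im c) <= Cmod c)%R.
Proof. eapply Rle_trans; [apply Rmax_r|apply Rmax_Cmod]. Qed.

Lemma CSeries_correct (u : nat -> C) :
  ex_series (fun n => Cmod (u n)) -> is_series u (CSeries u).
Proof.
  intros H. apply is_C_series_components. split; simpl.
  - apply Series_correct. exact (ex_series_le (V := R_CompleteNormedModule) (fun n => Re (u n)) _
             (fun n => re_le_Cmod (u n)) H).
  - apply Series_correct. exact (ex_series_le (V := R_CompleteNormedModule) (fun n => Im (u n)) _
             (fun n => im_le_Cmod (u n)) H).
Qed.

Lemma Cmod_sum_n_le (u : nat -> C) n :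
  (Cmod (sum_n u n) <= sum_n (fun k => Cmod (u k)) n)%R.
Proof.
  induction n as [|n IH]; [rewrite !sum_O; lra|].
  rewrite !sum_Sn. eapply Rle_trans; [exact (Cmod_triangle _ _)|].
  exact (Rplus_le_compat_r _ _ _ IH).
Qed.

Lemma Cmod_series_le_bound (u : nat -> C) (l : C) (B : R) :
  is_series u l -> (forall n, (Cmod (sum_n u n) <= B)%R) -> (Cmod l <= B)%R.
Proof.
  intros H HB.
  assert (HL : is_lim_seq (fun n => Cmod (sum_n u n)) (Cmod l)).
  { unfold is_lim_seq.
    apply filterlim_comp with (1 := H).
    exact (filterlim_norm l). }
  apply (is_lim_seq_le _ (fun _ => B) (Cmod l) B HB HL (is_lim_seq_const B)).
Qed.

Lemma Cmod_series_le (u : nat -> C) (v : nat -> R) (l : C) (L : R) :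
  is_series u l -> is_series v L -> (forall n, (Cmod (u n) <= v n)%R) ->
  (Cmod l <= L)%R.
Proof.
  intros Hu Hv H.
  assert (HL : is_lim_seq (fun n => Cmod (sum_n u n)) (Cmod l)).
  { unfold is_lim_seq.
    apply filterlim_comp with (1 := Hu). exact (filterlim_norm l). }
  apply (is_lim_seq_le _ (sum_n v) (Cmod l) L) with (2 := HL); [|exact Hv].
  intros n. eapply Rle_trans; [apply Cmod_sum_n_le|].
  now apply sum_n_m_le.
Qed.

(* By the Cauchy-Hadamard formula this says that the power series with coefficients [a] has
   radius of convergence at least [rad]. *)
Definition tame (rad : R) (a : nat -> C) : Prop :=
  forall rho : R, (0 < rho < rad)%R ->
    exists B : R, forall n, (Cmod (a n) * rho ^ n <= B)%R.

Definition CPS (a : nat -> C) (z : C) : C := CSeries (fun n => a n * z ^ n).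

(** Convergence at the one positive point [rho] already bounds the terms [a n * rho ^ n]. This turns
    a hypothesis about sums into a property of the coefficients, from which absolute convergence and
    differentiability follow. *)
Lemma tame_of_series (rad : R) (a : nat -> C) (f : C -> C) :
  (forall z, (Cmod z < rad)%R -> is_series (fun n => a n * z ^ n) (f z)) ->
  tame rad a.
Proof.
  intros H rho Hrho.
  assert (Hm : Cmod (RtoC rho) = rho) by (rewrite Cmod_R, Rabs_pos_eq; lra).
  specialize (H (RtoC rho)). rewrite Hm in H. specialize (H (proj2 Hrho)).
  apply is_C_series_components in H. destruct H as [H1 H2].
  assert (Hb : forall v : nat -> R, ex_series v ->
             exists M, forall n, (Rabs (v n) <= M)%R).
  { intros v Hv. apply ex_series_lim_0 in Hv.
    destruct (filterlim_bounded v) as [M HM].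
    - exists 0%R. exact Hv.
    - exists M. exact HM. }
  destruct (Hb _ (ex_intro _ _ H1)) as [M1 HM1].
  destruct (Hb _ (ex_intro _ _ H2)) as [M2 HM2].
  exists (sqrt 2 * Rmax M1 M2)%R. intros n.
  rewrite <- Hm at 1. rewrite <- Cmod_pow, <- Cmod_mult.
  eapply Rle_trans; [apply Cmod_2Rmax|].
  apply Rmult_le_compat_l; [apply sqrt_pos|].
  apply Rmax_lub; eapply Rle_trans;
    [apply HM1|apply Rmax_l|apply HM2|apply Rmax_r].
Qed.

(** A bound at the midpoint [s] between [rho] and [rad] becomes the geometric majorant
    [B * (rho / s) ^ n] at [rho]. *)
Lemma tame_ex_series (rad : R) (a : nat -> C) (rho : R) :
  tame rad a -> (0 <= rho < rad)%R -> ex_series (fun n => Cmod (a n) * rho ^ n)%R.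
Proof.
  intros H Hrho. set (s := ((rho + rad) / 2)%R).
  assert (Hs : (0 < s < rad)%R) by (unfold s; lra).
  destruct (H s Hs) as [B HB].
  apply (ex_series_le (V := R_CompleteNormedModule) _ (fun n => B * (rho / s) ^ n)%R).
  - intros n. change (norm ?x) with (Rabs x).
    assert (0 <= rho / s)%R by (apply Rdiv_le_0_compat; lra).
    rewrite Rabs_pos_eq.
    + replace rho with (s * (rho / s))%R at 1 by (field; lra).
      rewrite Rpow_mult_distr, <- Rmult_assoc.
      apply Rmult_le_compat_r; [now apply pow_le|apply HB].
    + apply Rmult_le_pos; [apply Cmod_ge_0|apply pow_le; lra].
  - apply (ex_series_scal_l B (fun n => (rho / s) ^ n)%R), ex_series_geom.
    rewrite Rabs_pos_eq by (apply Rdiv_le_0_compat; lra).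
    apply Rmult_lt_reg_r with s; [lra|]. unfold Rdiv.
    rewrite Rmult_assoc, Rinv_l by lra. unfold s. lra.
Qed.

Lemma CPS_correct (rad : R) (a : nat -> C) (z : C) :
  tame rad a -> (Cmod z < rad)%R -> is_series (fun n => a n * z ^ n) (CPS a z).
Proof.
  intros H Hz. apply CSeries_correct.
  apply ex_series_ext with (fun n => Cmod (a n) * Cmod z ^ n)%R.
  - intros n. now rewrite Cmod_mult, Cmod_pow.
  - apply tame_ex_series with rad; trivial. split; trivial. apply Cmod_ge_0.
Qed.

Lemma CPS_unique (a : nat -> C) (z l : C) :
  is_series (fun n => a n * z ^ n) l -> CPS a z = l.
Proof. apply is_C_series_unique. Qed.

Lemma tame_le (rad : R) (a b : nat -> C) :
  (forall n, (Cmod (a n) <= Cmod (b n))%R) -> tame rad b -> tame rad a.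
Proof.
  intros H Hb rho Hr. destruct (Hb rho Hr) as [B HB]. exists B. intros n.
  eapply Rle_trans; [|apply (HB n)]. apply Rmult_le_compat_r; [|apply H].
  apply pow_le; lra.
Qed.

Lemma tame_scal (rad : R) (c : C) (a : nat -> C) :
  tame rad a -> tame rad (fun n => c * a n).
Proof.
  intros Ha rho Hr. destruct (Ha rho Hr) as [A HA].
  exists (Cmod c * A)%R. intros n. rewrite Cmod_mult, Rmult_assoc.
  apply Rmult_le_compat_l; [apply Cmod_ge_0|apply HA].
Qed.

Lemma tame_shift (rad : R) (a : nat -> C) :
  tame rad a -> tame rad (fun n => a (S n)).
Proof.
  intros Ha rho Hr. destruct (Ha rho Hr) as [A HA].
  exists (A / rho)%R. intros n. specialize (HA (S n)). simpl in HA.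
  apply Rmult_le_reg_r with rho; [lra|].
  unfold Rdiv. rewrite (Rmult_assoc A), Rinv_l by lra. lra.
Qed.

(** Bernoulli's inequality [1 + n t <= (1 + t)^n], here [poly], with [1 + t = / q]. *)
Lemma succ_mul_geom_bounded (q : R) : (0 < q < 1)%R ->
  exists B : R, forall n, (INR (S n) * q ^ n <= B)%R.
Proof.
  intros Hq. set (t := (/ q - 1)%R).
  assert (Ht : (0 < t)%R).
  { unfold t. assert (1 < / q)%R; [|lra]. rewrite <- Rinv_1.
    apply Rinv_lt_contravar; lra. }
  exists (1 + / t)%R. intros n.
  assert (Hp := poly n t Ht).
  assert (E : ((1 + t) ^ n * q ^ n = 1)%R).
  { rewrite <- Rpow_mult_distr. replace ((1 + t) * q)%R with 1%R.
    apply pow1. unfold t. field; lra. }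
  assert (Hqn : (0 < q ^ n)%R) by (apply pow_lt; lra).
  assert (Hti : (0 < / t)%R) by now apply Rinv_0_lt_compat.
  assert (Hit : (t * / t = 1)%R) by (apply Rinv_r; lra).
  assert (Hn : (0 <= INR n)%R) by apply pos_INR.
  rewrite S_INR.
  assert (H1 : (INR n + 1 <= (1 + / t) * (1 + INR n * t))%R).
  { replace ((1 + / t) * (1 + INR n * t))%R
      with (1 + INR n * t + / t + INR n * (t * / t))%R by ring.
    rewrite Hit. nra. }
  apply Rle_trans with ((1 + / t) * (1 + INR n * t) * q ^ n)%R.
  - apply Rmult_le_compat_r; lra.
  - replace (1 + / t)%R with ((1 + / t) * ((1 + t) ^ n * q ^ n))%R at 2
      by (rewrite E; ring).
    rewrite Rmult_assoc. apply Rmult_le_compat_l; [lra|].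
    apply Rmult_le_compat_r; lra.
Qed.

Lemma tame_mul_succ (rad : R) (a : nat -> C) :
  tame rad a -> tame rad (fun n => RtoC (INR (S n)) * a n).
Proof.
  intros Ha rho Hr. set (s := ((rho + rad) / 2)%R).
  assert (Hs : (0 < s < rad)%R) by (unfold s; lra).
  destruct (Ha s Hs) as [A HA].
  assert (Hq : (0 < rho / s < 1)%R).
  { split; [apply Rdiv_lt_0_compat; lra|].
    apply Rmult_lt_reg_r with s; [lra|]. unfold Rdiv.
    rewrite Rmult_assoc, Rinv_l by lra. unfold s; lra. }
  destruct (succ_mul_geom_bounded _ Hq) as [B HB].
  exists (A * B)%R. intros n.
  rewrite Cmod_mult, Cmod_R, Rabs_pos_eq by apply pos_INR.
  replace (rho ^ n)%R with (s ^ n * (rho / s) ^ n)%R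
    by (rewrite <- Rpow_mult_distr; f_equal; field; lra).
  replace (INR (S n) * Cmod (a n) * (s ^ n * (rho / s) ^ n))%R
    with ((Cmod (a n) * s ^ n) * (INR (S n) * (rho / s) ^ n))%R by ring.
  apply Rmult_le_compat; trivial.
  - apply Rmult_le_pos; [apply Cmod_ge_0|apply pow_le; lra].
  - apply Rmult_le_pos; [apply pos_INR|apply pow_le; lra].
Qed.

Definition dcoef (a : nat -> C) (n : nat) : C := RtoC (INR (S n)) * a (S n).

Lemma tame_dcoef (rad : R) (a : nat -> C) : tame rad a -> tame rad (dcoef a).
Proof. intros H. apply (tame_mul_succ rad (fun n => a (S n))), tame_shift, H. Qed.

(** * Linear operations on power series and termwise differentiation *)

Lemma is_C_series_ext (u v : nat -> C) (l : C) :
  (forall n, u n = v n) -> is_series u l -> is_series v l.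
Proof. exact (is_series_ext u v l). Qed.

Lemma is_C_series_plus (u v : nat -> C) (l m : C) :
  is_series u l -> is_series v m -> is_series (fun n => u n + v n) (l + m).
Proof. intros; now apply (is_series_plus u v). Qed.

Lemma is_C_series_scal (c : C) (u : nat -> C) (l : C) :
  is_series u l -> is_series (fun n => c * u n) (c * l).
Proof. intros H. exact (is_series_scal c u l H). Qed.

Lemma is_C_series_tail (u : nat -> C) (l : C) :
  is_series u l -> is_series (fun n => u (S n)) (l - u 0%nat).
Proof.
  intros H. apply is_series_incr_1.
  replace (plus _ _) with l; trivial.
  change (l = l - u 0%nat + u 0%nat). ring.
Qed.

Lemma CPS_shift (rad : R) (a : nat -> C) (z : C) : tame rad a -> (Cmod z < rad)%R ->
  CPS a z = a 0%nat + z * CPS (fun n => a (S n)) z.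
Proof.
  intros Ha Hz.
  assert (H := is_C_series_scal z _ _ (CPS_correct rad _ z (tame_shift rad a Ha) Hz)).
  assert (H' := is_C_series_tail _ _ (CPS_correct rad a z Ha Hz)).
  apply is_C_series_unique in H. apply is_C_series_unique in H'.
  rewrite <- H. replace (CSeries _) with (CPS a z - a 0%nat).
  - ring.
  - replace (a 0%nat) with (a 0%nat * z ^ 0) by (simpl; ring).
    rewrite <- H'. unfold CSeries. f_equal; apply Series_ext; intros n; f_equal;
      simpl; ring.
Qed.

Lemma CPS_0 (rad : R) (a : nat -> C) : tame rad a -> (0 < rad)%R -> CPS a 0 = a 0%nat.
Proof.
  intros Ha HR. rewrite (CPS_shift rad); trivial; [ring|]. now rewrite Cmod_0.
Qed.

Lemma CPS_ext (a b : nat -> C) (z : C) : (forall n, a n = b n) -> CPS a z = CPS b z.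
Proof.
  intros H. unfold CPS, CSeries. f_equal; apply Series_ext; intros n; now rewrite H.
Qed.

Lemma CPS_plus (rad : R) (a b : nat -> C) (z : C) :
  tame rad a -> tame rad b -> (Cmod z < rad)%R ->
  CPS (fun n => a n + b n) z = CPS a z + CPS b z.
Proof.
  intros Ha Hb Hz. apply CPS_unique.
  apply is_C_series_ext with (fun n => a n * z ^ n + b n * z ^ n).
  - intros n. ring.
  - apply is_C_series_plus; now apply CPS_correct with rad.
Qed.

Lemma CPS_scal (rad : R) (c : C) (a : nat -> C) (z : C) :
  tame rad a -> (Cmod z < rad)%R -> CPS (fun n => c * a n) z = c * CPS a z.
Proof.
  intros Ha Hz. apply CPS_unique.
  apply is_C_series_ext with (fun n => c * (a n * z ^ n)).
  - intros n. ring.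
  - apply is_C_series_scal; now apply CPS_correct with rad.
Qed.

(** The factor [rho] on the left avoids the exponent [n - 1] on the right. The remainders obey
    [E_(n+1) = w E_n + (n+1) z^n (w - z)^2], and with [N = n + 1] the constants close because
    [N^2 + N <= (N + 1)^2]. *)
Lemma pow_taylor_remainder (rho : R) (z w : C) (n : nat) :
  (0 < rho)%R -> (Cmod z <= rho)%R -> (Cmod w <= rho)%R ->
  (rho * Cmod (w ^ S n - z ^ S n - RtoC (INR (S n)) * z ^ n * (w - z))
   <= INR (S n) * INR (S n) * rho ^ n * (Cmod (w - z) * Cmod (w - z)))%R.
Proof.
  intros Hr Hz Hw. set (h := Cmod (w - z)).
  assert (Hh : (0 <= h)%R) by apply Cmod_ge_0.
  induction n as [|n IH].
  - replace (w ^ 1 - z ^ 1 - RtoC (INR 1) * z ^ 0 * (w - z)) with (RtoC 0)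
      by (simpl; ring).
    rewrite Cmod_0. simpl. nra.
  - set (E := w ^ S n - z ^ S n - RtoC (INR (S n)) * z ^ n * (w - z)) in *.
    replace (w ^ S (S n) - z ^ S (S n) - RtoC (INR (S (S n))) * z ^ S n * (w - z))
      with (w * E + RtoC (INR (S n)) * z ^ n * ((w - z) * (w - z))).
    2:{ unfold E. rewrite (S_INR (S n)), RtoC_plus. simpl Cpow. ring. }
    eapply Rle_trans.
    { apply Rmult_le_compat_l; [lra|apply Cmod_triangle]. }
    rewrite !Cmod_mult, Cmod_R, Cmod_pow, Rabs_pos_eq by apply pos_INR. fold h.
    assert (Hzn : (0 <= Cmod z ^ n <= rho ^ n)%R).
    { split; [apply pow_le, Cmod_ge_0|]. apply pow_incr. split; [apply Cmod_ge_0|trivial]. }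
    assert (Hn : (1 <= INR (S n))%R).
    { rewrite S_INR. generalize (pos_INR n). lra. }
    rewrite (S_INR (S n)). set (N := INR (S n)) in *.
    change (rho ^ S n)%R with (rho * rho ^ n)%R.
    assert (HE : (Cmod w * (rho * Cmod E) <= rho * (N * N * rho ^ n * (h * h)))%R).
    { apply Rmult_le_compat; trivial; try apply Cmod_ge_0.
      apply Rmult_le_pos; [lra|apply Cmod_ge_0]. }
    set (p := (rho ^ n)%R) in *.
    assert (Hhh : (0 <= h * h)%R) by nra.
    assert (H2 : (rho * (N * Cmod z ^ n * (h * h)) <= rho * (N * p * (h * h)))%R).
    { apply Rmult_le_compat_l; [lra|]. apply Rmult_le_compat_r; trivial.
      apply Rmult_le_compat_l; lra. }
    assert (H3 : (0 <= rho * p * (h * h))%R).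
    { repeat apply Rmult_le_pos; lra. }
    nra.
Qed.

Lemma CPS_derive (rad : R) (a : nat -> C) (z : C) : tame rad a -> (Cmod z < rad)%R ->
  is_derive (CPS a) z (CPS (dcoef a) z).
Proof.
  intros Ha Hz. apply is_C_derive_eps. intros eps Heps.
  set (rho := ((Cmod z + rad) / 2)%R).
  assert (Hz0 := Cmod_ge_0 z).
  assert (Hrho : (0 < rho < rad)%R) by (unfold rho; lra).
  assert (Hzr : (Cmod z < rho)%R) by (unfold rho; lra).
  (* The factor [(n + 1)^2] of the quadratic remainder of [w ^ S n]: one factor [n + 1] is in
     [dcoef], the other is added here. Summability of [v] at [rho] makes the total remainder
     quadratic in [w - z]. *)
  set (v := fun n => RtoC (INR (S n)) * dcoef a n).
  assert (Hv : tame rad v) by apply tame_mul_succ, tame_dcoef, Ha.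
  destruct (tame_ex_series rad v rho Hv ltac:(lra)) as [L HL].
  set (K := (Rabs L / rho + 1)%R).
  assert (HK : (0 < K)%R).
  { unfold K. assert (0 <= Rabs L / rho)%R; [|lra].
    apply Rdiv_le_0_compat; [apply Rabs_pos|lra]. }
  exists (Rmin (rho - Cmod z) (eps / K)). split.
  { apply Rmin_pos; [lra|]. now apply Rdiv_lt_0_compat. }
  intros w Hw.
  assert (H1 := Rlt_le_trans _ _ _ Hw (Rmin_l _ _)).
  assert (H2 := Rlt_le_trans _ _ _ Hw (Rmin_r _ _)).
  assert (Hwr : (Cmod w < rho)%R) by (generalize (Cmod_triangle_inv w z); lra).
  set (h := Cmod (w - z)) in *. assert (Hh : (0 <= h)%R) by apply Cmod_ge_0.
  assert (S1 := is_C_series_tail _ _ (CPS_correct rad a w Ha ltac:(lra))).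
  assert (S2 := is_C_series_tail _ _ (CPS_correct rad a z Ha Hz)).
  assert (S3 := CPS_correct rad _ z (tame_dcoef rad a Ha) Hz).
  assert (S4 := is_C_series_plus _ _ _ _ S1 (is_C_series_scal (-(1)) _ _ S2)).
  assert (S5 := is_C_series_plus _ _ _ _ S4 (is_C_series_scal (-(w - z)) _ _ S3)).
  clear S1 S2 S3 S4.
  apply (Cmod_series_le _ (fun n => (h * h / rho) * (Cmod (v n) * rho ^ n))%R
           _ ((h * h / rho) * L)%R) in S5.
  - replace (CPS a w - CPS a z - (w - z) * CPS (dcoef a) z)
      with (CPS a w - a 0%nat * w ^ 0 + - (1) * (CPS a z - a 0%nat * z ^ 0)
            + - (w - z) * CPS (dcoef a) z) by (simpl; ring).
    eapply Rle_trans; [exact S5|].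
    replace (h * h / rho * L)%R with (h * (L / rho) * h)%R by (field; lra).
    apply Rmult_le_compat_r; trivial.
    apply Rle_trans with (h * K)%R.
    + apply Rmult_le_compat_l; trivial. unfold K.
      apply Rle_trans with (Rabs L / rho)%R; [|lra].
      apply Rmult_le_compat_r; [left; apply Rinv_0_lt_compat; lra|apply Rle_abs].
    + apply Rmult_lt_compat_r with (r := K) in H2; trivial.
      replace (eps / K * K)%R with eps in H2 by (field; lra). lra.
  - apply (is_series_scal_l (h * h / rho)%R (fun n => (Cmod (v n) * rho ^ n)%R)).
    exact HL.
  - intros n.
    replace (a (S n) * w ^ S n + - (1) * (a (S n) * z ^ S n)
             + - (w - z) * (dcoef a n * z ^ n))
      with (a (S n) * (w ^ S n - z ^ S n - RtoC (INR (S n)) * z ^ n * (w - z)))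
      by (unfold dcoef; ring).
    rewrite Cmod_mult. unfold v, dcoef.
    rewrite !Cmod_mult, Cmod_R, Rabs_pos_eq by apply pos_INR.
    generalize (pow_taylor_remainder rho z w n (proj1 Hrho) ltac:(lra) ltac:(lra)).
    fold h. set (E := Cmod (_ - _ - _)). intros HE.
    assert (Hb := Cmod_ge_0 (a (S n))).
    apply Rmult_le_reg_l with rho; [lra|].
    apply Rmult_le_compat_l with (r := Cmod (a (S n))) in HE; trivial.
    replace (rho * (h * h / rho * (INR (S n) * (INR (S n) * Cmod (a (S n))) * rho ^ n)))%R
      with (Cmod (a (S n)) * (INR (S n) * INR (S n) * rho ^ n * (h * h)))%R
      by (field; lra).
    lra.
Qed.

(** * Minimum principle and first zeros of the real part *)

Lemma Cmod_le_Rabs_components (z : C) : (Cmod z <= Rabs (Re z) + Rabs (Im z))%R.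
Proof.
  destruct z as [x y]. simpl.
  replace (x, y) with (RtoC x + RtoC y * Ci) by (apply injective_projections; simpl; ring).
  eapply Rle_trans; [apply Cmod_triangle|].
  rewrite Cmod_mult, Cmod_Ci, !Cmod_R. lra.
Qed.

(** * Minimum of a lower semicontinuous function on a compact subset of the plane *)

Section CompactMin.

Variables (K : C -> Prop) (F : C -> R) (b : R).
Hypothesis K_bounded : forall z, K z -> (Cmod z <= b)%R.
Hypothesis K_closed : forall z, ~ K z ->
  exists d : R, (0 < d)%R /\ forall w, (Cmod (w - z) < d)%R -> ~ K w.
Hypothesis F_lsc : forall z, K z -> forall eps : R, (0 < eps)%R ->
  exists d : R, (0 < d)%R /\
    forall w, K w -> (Cmod (w - z) < d)%R -> (F z - eps < F w)%R.

(** Replaces the finite subcover. Every point gets a gauge from semicontinuity, capped by its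
    tolerance [e]; [compactness_value_2d] returns one [d] below the gauges that are actually used. A
    point outside [K] gets a gauge avoiding [K], so the point found near [z] lies in [K]. The factor
    [2 * d] pays for the two coordinates. *)
Lemma compact_uniform_lower_bound (e : C -> R) : (forall z, K z -> (0 < e z)%R) ->
  exists d : R, (0 < d)%R /\
    forall z, K z -> exists u, K u /\ (F u - e u < F z)%R /\ (d <= e u)%R.
Proof.
  intros He.
  assert (Hdelta : forall u v : R, exists d : posreal,
    (K (u, v) -> (d <= e (u, v))%R /\
       forall w, K w -> (Cmod (w - (u, v)) < 2 * d)%R -> (F (u, v) - e (u, v) < F w)%R) /\
    (~ K (u, v) -> forall w, (Cmod (w - (u, v)) < 2 * d)%R -> ~ K w)).
  { intros u v. destruct (classic (K (u, v))) as [HK|HK].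
    - destruct (F_lsc _ HK _ (He _ HK)) as [d [Hd Hw]].
      assert (Hp : (0 < Rmin (d / 2) (e (u, v)))%R).
      { apply Rmin_pos; [lra|now apply He]. }
      exists (mkposreal _ Hp). split; [|contradiction]. intros _. simpl. split.
      + apply Rmin_r.
      + intros w HKw H. apply Hw; trivial.
        generalize (Rmin_l (d / 2) (e (u, v))). lra.
    - destruct (K_closed _ HK) as [d [Hd Hw]].
      assert (Hp : (0 < d / 2)%R) by lra.
      exists (mkposreal _ Hp). split; [contradiction|]. intros _ w. simpl.
      intros H. apply Hw. lra. }
  set (delta := fun u v => proj1_sig (constructive_indefinite_description _ (Hdelta u v))).
  destruct (compactness_value_2d (-b) b (-b) b delta) as [d Hd].
  exists d. split; [apply cond_pos|]. intros [x y] HK.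
  assert (Hb := K_bounded _ HK).
  assert (Hx := re_le_Cmod (x, y)). assert (Hy := im_le_Cmod (x, y)). simpl in Hx, Hy.
  apply NNPP. intros Habs.
  apply (Hd x y); [apply Rabs_le_between; lra|apply Rabs_le_between; lra|].
  intros (u & v & _ & _ & H1 & H2 & H3). apply Habs.
  unfold delta in H1, H2, H3.
  destruct (constructive_indefinite_description _ (Hdelta u v)) as [d' [Hin Hout]].
  simpl in H1, H2, H3.
  assert (Hdist : (Cmod ((x, y) - (u, v)) < 2 * d')%R).
  { eapply Rle_lt_trans; [apply Cmod_le_Rabs_components|]. simpl.
    unfold Rminus in H1, H2. lra. }
  destruct (classic (K (u, v))) as [HKu|HKu].
  - destruct (Hin HKu) as [Hde HF]. exists (u, v). repeat split; trivial.
    + now apply HF.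
    + lra.
  - now destruct (Hout HKu (x, y) Hdist).
Qed.

Lemma compact_min : (exists z, K z) ->
  exists z0, K z0 /\ forall z, K z -> (F z0 <= F z)%R.
Proof.
  intros [z0 Hz0].
  (* With this tolerance [d <= e u] bounds [|F u|] by [/ d - 1], so [F] is bounded below on [K]. *)
  destruct (compact_uniform_lower_bound (fun u => / (1 + Rabs (F u)))%R) as [d [Hd Hlow]].
  { intros z _. apply Rinv_0_lt_compat. generalize (Rabs_pos (F z)); lra. }
  set (E := fun x => exists z, K z /\ x = (- F z)%R).
  destruct (completeness E) as [m [Hub Hlub]].
  - exists (/ d + 1)%R. intros x [z [HK ->]].
    destruct (Hlow z HK) as [u [HKu [H1 H2]]].
    assert (Hpos := Rabs_pos (F u)).
    assert (H3 : (/ (1 + Rabs (F u)) <= 1)%R).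
    { rewrite <- Rinv_1. apply Rinv_le_contravar; lra. }
    assert (H4 : (1 + Rabs (F u) <= / d)%R).
    { rewrite <- (Rinv_inv (1 + Rabs (F u))). apply Rinv_le_contravar; trivial. }
    generalize (Rle_abs (- F u)). rewrite Rabs_Ropp. lra.
  - exists (- F z0)%R. now exists z0.
  - apply NNPP. intros Habs.
    assert (Hlt : forall z, K z -> (- m < F z)%R).
    { intros z HK. assert (Hz : (- F z <= m)%R) by (apply Hub; now exists z).
      destruct (Req_dec (F z) (- m)) as [Heq|Hne]; [|lra].
      destruct Habs. exists z. split; trivial. intros w Hw.
      assert (- F w <= m)%R by (apply Hub; now exists w). lra. }
    (* The infimum is [- m]. If it is not attained, half of the excess [F u + m] is an admissible
       tolerance, and it yields [F >= - m + c] on [K], which is absurd. *)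
    destruct (compact_uniform_lower_bound (fun u => (F u + m) / 2)%R) as [c [Hc Hl]].
    { intros z HK. specialize (Hlt z HK). lra. }
    assert (Hm : (m <= m - c)%R).
    { apply Hlub. intros x [z [HK ->]].
      destruct (Hl z HK) as [u [HKu [H1 H2]]]. lra. }
    lra.
Qed.

End CompactMin.

Lemma is_derive_eps (f : R -> R) (x l : R) :
  (forall eps : R, (0 < eps)%R -> exists d : R, (0 < d)%R /\ forall h : R,
     (Rabs h < d -> Rabs (f (x + h) - f x - l * h) <= eps * Rabs h)%R) ->
  is_derive f x l.
Proof.
  intros H. apply is_derive_Reals. intros eps Heps.
  destruct (H (eps / 2)%R ltac:(lra)) as [d [Hd Hh]].
  exists (mkposreal d Hd). intros h Hh0 Hhd. simpl in Hhd.
  specialize (Hh h Hhd).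
  replace ((f (x + h) - f x) / h - l)%R with ((f (x + h) - f x - l * h) / h)%R
    by (field; trivial).
  assert (Hp : (0 < Rabs h)%R) by now apply Rabs_pos_lt.
  unfold Rdiv. rewrite Rabs_mult, Rabs_inv.
  apply Rmult_lt_reg_r with (1 := Hp).
  rewrite Rmult_assoc, Rinv_l by lra. nra.
Qed.

Lemma is_derive_Re_line (f : C -> C) (z v l : C) (t : R) :
  is_derive f (z + RtoC t * v) l ->
  is_derive (fun s : R => Re (f (z + RtoC s * v))) t (Re (v * l)).
Proof.
  intros H. apply is_derive_eps. intros eps Heps.
  set (N := (Cmod v + 1)%R).
  assert (HN : (0 < N)%R) by (unfold N; generalize (Cmod_ge_0 v); lra).
  destruct (proj1 (is_C_derive_eps _ _ _) H (eps / N)%R) as [d [Hd Hw]].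
  { now apply Rdiv_lt_0_compat. }
  exists (d / N)%R. split; [now apply Rdiv_lt_0_compat|]. intros h Hh.
  specialize (Hw (z + RtoC (t + h) * v)).
  replace (z + RtoC (t + h) * v - (z + RtoC t * v)) with (RtoC h * v) in Hw
    by (rewrite RtoC_plus; ring).
  rewrite !Cmod_mult, Cmod_R in Hw.
  assert (Hha := Rabs_pos h).
  assert (HhN : (Rabs h * Cmod v <= Rabs h * N)%R).
  { apply Rmult_le_compat_l; trivial. unfold N; lra. }
  assert (Hsmall : (Rabs h * N < d)%R).
  { apply Rmult_lt_compat_r with (r := N) in Hh; trivial.
    replace (d / N * N)%R with d in Hh by (field; lra). exact Hh. }
  specialize (Hw ltac:(lra)).
  eapply Rle_trans.
  2:{ eapply Rle_trans; [exact Hw|].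
      replace (eps * Rabs h)%R with (eps / N * (Rabs h * N))%R by (field; lra).
      apply Rmult_le_compat_l; trivial. left. now apply Rdiv_lt_0_compat. }
  eapply Rle_trans; [|apply re_le_Cmod].
  right. f_equal.
  generalize (f (z + RtoC (t + h) * v)) (f (z + RtoC t * v)). intros p q.
  unfold Re; simpl. ring.
Qed.

(** By the mean value theorem, minimality at [0] produces points arbitrarily close to [0] with
    [psi >= 0] on the right and [psi <= 0] on the left. They force [psi 0 = 0], and then the points
    on the right exclude [c < 0]. *)
Lemma second_derivative_at_min (phi psi : R -> R) (c d : R) : (0 < d)%R ->
  (forall t, (Rabs t < d)%R -> is_derive phi t (psi t)) ->
  is_derive psi 0 c ->
  (forall t, (Rabs t < d)%R -> (phi 0 <= phi t)%R) -> (0 <= c)%R.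
Proof.
  intros Hd Hphi Hpsi Hmin.
  assert (Hexp : forall eps : R, (0 < eps)%R -> exists d', (0 < d' <= d)%R /\
     forall s, (Rabs s < d')%R -> (Rabs (psi s - psi 0 - c * s) <= eps * Rabs s)%R).
  { intros eps Heps. apply is_derive_Reals in Hpsi.
    destruct (Hpsi eps Heps) as [e He].
    exists (Rmin e d). split; [split; [apply Rmin_pos; [apply cond_pos|trivial]|apply Rmin_r]|].
    intros s Hs. destruct (Req_dec s 0) as [->|Hs0].
    { rewrite Rabs_R0. replace (_ - _ - _)%R with 0%R by ring. rewrite Rabs_R0. lra. }
    specialize (He s Hs0 (Rlt_le_trans _ _ _ Hs (Rmin_l _ _))).
    rewrite Rplus_0_l in He.
    replace (psi s - psi 0 - c * s)%R with (((psi s - psi 0) / s - c) * s)%R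
      by (field; trivial).
    rewrite Rabs_mult. apply Rmult_le_compat_r; [apply Rabs_pos|lra]. }
  assert (Hmv : forall t, (0 < t < d)%R ->
     (exists s, (0 < s < t)%R /\ (0 <= psi s)%R) /\
     (exists s, (- t < s < 0)%R /\ (psi s <= 0)%R)).
  { intros t Ht. split.
    - destruct (MVT_cor2 phi psi 0 t) as [s [Hs1 Hs2]]; [lra| |].
      + intros s Hs. apply is_derive_Reals, Hphi. apply Rabs_def1; lra.
      + exists s. split; trivial.
        assert (Hm := Hmin t ltac:(apply Rabs_def1; lra)).
        apply Rmult_le_reg_r with t; lra.
    - destruct (MVT_cor2 phi psi (-t) 0) as [s [Hs1 Hs2]]; [lra| |].
      + intros s Hs. apply is_derive_Reals, Hphi. apply Rabs_def1; lra.
      + exists s. split; trivial.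
        assert (Hm := Hmin (-t)%R ltac:(apply Rabs_def1; lra)).
        apply Rmult_le_reg_r with t; [lra|]. lra. }
  assert (Hlin : forall eta : R, (0 < eta)%R -> (- eta <= psi 0 <= eta)%R).
  { intros eta Heta. destruct (Hexp 1%R Rlt_0_1) as [e [He Hs]].
    set (t := Rmin (e / 2) (eta / (Rabs c + 1))).
    assert (Hc := Rabs_pos c).
    assert (Ht0 : (0 < t)%R).
    { apply Rmin_pos; [lra|]. apply Rdiv_lt_0_compat; lra. }
    assert (Ht1 : (t < e)%R) by (unfold t; generalize (Rmin_l (e / 2) (eta / (Rabs c + 1))); lra).
    assert (Ht2 : (t * (Rabs c + 1) <= eta)%R).
    { assert (Ht : (t <= eta / (Rabs c + 1))%R) by apply Rmin_r.
      apply Rmult_le_compat_r with (r := (Rabs c + 1)%R) in Ht; [|lra].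
      replace (eta / (Rabs c + 1) * (Rabs c + 1))%R with eta in Ht by (field; lra).
      exact Ht. }
    assert (Hest : forall s, (Rabs s <= t)%R -> (Rabs (psi s - psi 0) <= eta)%R).
    { intros s Hst. specialize (Hs s ltac:(lra)).
      replace (psi s - psi 0)%R with ((psi s - psi 0 - c * s) + c * s)%R by ring.
      eapply Rle_trans; [apply Rabs_triang|]. rewrite Rabs_mult.
      assert (Hs0 := Rabs_pos s). nra. }
    destruct (Hmv t ltac:(lra)) as [[s [Hs1 Hs2]] [s' [Hs3 Hs4]]].
    assert (E1 := Hest s ltac:(apply Rabs_le; lra)).
    assert (E2 := Hest s' ltac:(apply Rabs_le; lra)).
    apply Rabs_le_between in E1. apply Rabs_le_between in E2. lra. }
  assert (Hpsi0 : psi 0 = 0%R).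
  { apply Rle_antisym; apply Rnot_lt_le; intros Hlt.
    - specialize (Hlin (psi 0 / 2)%R ltac:(lra)). lra.
    - specialize (Hlin (- psi 0 / 2)%R ltac:(lra)). lra. }
  apply Rnot_lt_le. intros Hc.
  destruct (Hexp (- c / 2)%R ltac:(lra)) as [e [He Hs]].
  destruct (Hmv (e / 2)%R ltac:(lra)) as [[s [Hs1 Hs2]] _].
  specialize (Hs s ltac:(apply Rabs_def1; lra)).
  rewrite Hpsi0, (Rabs_pos_eq s) in Hs by lra.
  apply Rabs_le_between in Hs. nra.
Qed.

(** Two complex derivatives are what the second-derivative test consumes, and the class is closed
    under sums, products, dilations and reciprocals of nonvanishing functions. *)
Definition hol2 (rad : R) (f : C -> C) : Prop :=
  exists f1 f2 : C -> C, forall z, (Cmod z < rad)%R ->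
    is_derive f z (f1 z) /\ is_derive f1 z (f2 z).

Lemma Re_min_principle (rad : R) (H : C -> C) : (1 < rad)%R -> hol2 rad H ->
  (forall z, Cmod z = 1%R -> (0 <= Re (H z))%R) -> (0 <= Re (H 0))%R.
Proof.
  intros HR (H1 & H2 & HH) Hpos. apply Rnot_lt_le. intros Hneg.
  (* With this choice [F 0 = - 2 eps], while [F >= - eps] on the circle, so the minimum is
     interior. *)
  set (eps := (- Re (H 0) / 2)%R). assert (Heps : (0 < eps)%R) by (unfold eps; lra).
  set (F := fun z : C => (Re (H z) - eps * (Re z ^ 2 + Im z ^ 2))%R).
  destruct (compact_min (fun z => (Cmod z <= 1)%R) F 1) as [z0 [Hz0 Hmin]].
  - trivial.
  - intros z Hz. exists (Cmod z - 1)%R. split; [lra|]. intros w Hw Hw1.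
    generalize (Cmod_triangle_inv z w). rewrite Cmod_sub_sym. lra.
  - intros z Hz e He.
    destruct (is_C_derive_continuous H z (H1 z) (proj1 (HH z ltac:(lra))) (e / 2)%R)
      as [d [Hd Hw]]; [lra|].
    exists (Rmin d (e / (8 * eps))). split.
    { apply Rmin_pos; trivial. apply Rdiv_lt_0_compat; lra. }
    intros w Hw1 Hwz.
    specialize (Hw w (Rlt_le_trans _ _ _ Hwz (Rmin_l _ _))).
    assert (Hsmall := Rlt_le_trans _ _ _ Hwz (Rmin_r _ _)).
    apply (Rmult_lt_compat_r (8 * eps)) in Hsmall; [|lra].
    replace (e / (8 * eps) * (8 * eps))%R with e in Hsmall by (field; lra).
    assert (E := re_le_Cmod (H w - H z)). apply Rabs_le_between in E.
    replace (Re (H w - H z)) with (Re (H w) - Re (H z))%R in E by (unfold Re, Im; simpl; ring).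
    unfold F. rewrite <- !Cmod2_alt.
    assert (Hd2 : (Cmod w ^ 2 - Cmod z ^ 2 <= 2 * Cmod (w - z))%R).
    { generalize (Cmod_triangle_inv w z) (Cmod_ge_0 w) (Cmod_ge_0 z) (Cmod_ge_0 (w - z)).
      intros. replace (Cmod w ^ 2 - Cmod z ^ 2)%R
        with ((Cmod w - Cmod z) * (Cmod w + Cmod z))%R by ring. nra. }
    assert (eps * (Cmod w ^ 2 - Cmod z ^ 2) <= eps * (2 * Cmod (w - z)))%R
      by (apply Rmult_le_compat_l; lra).
    lra.
  - exists 0. rewrite Cmod_0. lra.
  - assert (Hint : (Cmod z0 < 1)%R).
    { destruct Hz0 as [Hlt|Heq]; trivial. exfalso.
      assert (Hm := Hmin 0 ltac:(rewrite Cmod_0; lra)).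
      unfold F in Hm. rewrite <- !Cmod2_alt, Heq, Cmod_0 in Hm.
      specialize (Hpos z0 Heq). unfold eps in *. lra. }
    assert (Hdir : forall v : C, Cmod v = 1%R -> (0 <= Re (v * (v * H2 z0)) - 2 * eps)%R).
    { intros v Hv.
      assert (Hline : forall t : R, (Rabs t < 1 - Cmod z0)%R -> (Cmod (z0 + RtoC t * v) < 1)%R).
      { intros t Ht. eapply Rle_lt_trans; [apply Cmod_triangle|].
        rewrite Cmod_mult, Cmod_R, Hv. lra. }
      assert (Hv2 : (Re v ^ 2 + Im v ^ 2 = 1)%R) by (rewrite <- Cmod2_alt, Hv; ring).
      set (B := (Re z0 * Re v + Im z0 * Im v)%R).
      apply (second_derivative_at_min
        (fun t => Re (H (z0 + RtoC t * v)%C)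
                  - eps * (Re z0 ^ 2 + Im z0 ^ 2 + 2 * B * t + t ^ 2))%R
        (fun t => Re (v * H1 (z0 + RtoC t * v))%C - eps * (2 * B + 2 * t))%R
        _ (1 - Cmod z0)); [lra| | |].
      - intros t Ht.
        apply (is_derive_minus (K := R_AbsRing) (V := R_NormedModule)).
        + apply is_derive_Re_line. apply HH. specialize (Hline t Ht). lra.
        + auto_derive; trivial. ring.
      - apply (is_derive_minus (K := R_AbsRing) (V := R_NormedModule)).
        + apply (is_derive_Re_line (fun z => v * H1 z) z0 v (v * H2 z0) 0).
          eapply is_C_derive_eq_val.
          * apply (is_C_derive_mult (fun _ => v) H1); [apply is_C_derive_const|].
            apply HH. replace (z0 + RtoC 0 * v) with z0 by ring. lra.
          * replace (z0 + RtoC 0 * v) with z0 by ring. ring.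
        + auto_derive; trivial. ring.
      - intros t Ht.
        assert (Hm := Hmin (z0 + RtoC t * v) ltac:(left; now apply Hline)).
        unfold F in Hm.
        replace (Re (z0 + RtoC t * v)) with (Re z0 + t * Re v)%R in Hm
          by (unfold Re, Im; simpl; ring).
        replace (Im (z0 + RtoC t * v)) with (Im z0 + t * Im v)%R in Hm
          by (unfold Re, Im; simpl; ring).
        replace ((Re z0 + t * Re v) ^ 2 + (Im z0 + t * Im v) ^ 2)%R
          with (Re z0 ^ 2 + Im z0 ^ 2 + 2 * B * t + t ^ 2 * (Re v ^ 2 + Im v ^ 2))%R in Hm
          by (unfold B; ring).
        rewrite Hv2 in Hm. replace (z0 + RtoC 0 * v) with z0 by ring. lra. }
    (* The directions [1] and [i] see [H''] with opposite signs, so adding the two inequalities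
       leaves [- 4 eps >= 0]. *)
    assert (D1 := Hdir 1 Cmod_1). assert (D2 := Hdir Ci Cmod_Ci).
    replace (1 * (1 * H2 z0)) with (H2 z0) in D1 by ring.
    replace (Ci * (Ci * H2 z0)) with (- H2 z0) in D2
      by (apply injective_projections; simpl; ring).
    simpl in D1, D2. unfold Re in *. lra.
Qed.

Lemma hol2_const (rad : R) (c : C) : hol2 rad (fun _ => c).
Proof.
  exists (fun _ => 0), (fun _ => 0). intros z _. split; apply is_C_derive_const.
Qed.

Lemma hol2_id (rad : R) : hol2 rad (fun z => z).
Proof.
  exists (fun _ => 1), (fun _ => 0). intros z _.
  split; [apply is_C_derive_id|apply is_C_derive_const].
Qed.

Lemma hol2_plus (rad : R) (f g : C -> C) :
  hol2 rad f -> hol2 rad g -> hol2 rad (fun z => f z + g z).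
Proof.
  intros (f1 & f2 & Hf) (g1 & g2 & Hg).
  exists (fun z => f1 z + g1 z), (fun z => f2 z + g2 z). intros z Hz.
  destruct (Hf z Hz), (Hg z Hz). split; now apply is_C_derive_plus.
Qed.

Lemma hol2_mult (rad : R) (f g : C -> C) :
  hol2 rad f -> hol2 rad g -> hol2 rad (fun z => f z * g z).
Proof.
  intros (f1 & f2 & Hf) (g1 & g2 & Hg).
  exists (fun z => f1 z * g z + f z * g1 z),
    (fun z => (f2 z * g z + f1 z * g1 z) + (f1 z * g1 z + f z * g2 z)).
  intros z Hz. destruct (Hf z Hz), (Hg z Hz).
  split; [now apply is_C_derive_mult|].
  apply is_C_derive_plus; now apply is_C_derive_mult.
Qed.

Lemma hol2_inv (rad : R) (f : C -> C) : (forall z, (Cmod z < rad)%R -> f z <> 0) ->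
  hol2 rad f -> hol2 rad (fun z => / f z).
Proof.
  intros H0 (f1 & f2 & Hf).
  exists (fun z => f1 z * (-(1) * (/ f z * / f z))).
  exists (fun z => f2 z * (-(1) * (/ f z * / f z)) +
    f1 z * (0 * (/ f z * / f z) + -(1) * (f1 z * - / (f z * f z) * / f z
            + / f z * (f1 z * - / (f z * f z))))).
  intros z Hz. destruct (Hf z Hz) as [D1 D2]. split.
  - eapply is_C_derive_eq_val; [apply is_C_derive_inv; [now apply H0|exact D1]|].
    field. now apply H0.
  - apply (is_C_derive_mult f1 (fun w => - (1) * (/ f w * / f w))); [exact D2|].
    apply (is_C_derive_mult (fun _ => - (1)) (fun w => / f w * / f w));
      [apply is_C_derive_const|].
    apply (is_C_derive_mult (fun w => / f w) (fun w => / f w));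
      (apply is_C_derive_inv; [now apply H0|exact D1]).
Qed.

Lemma hol2_scal_arg (rad : R) (r : R) (f : C -> C) :
  (0 < r)%R -> hol2 rad f -> hol2 (rad / r) (fun z => f (RtoC r * z)).
Proof.
  intros Hr (f1 & f2 & Hf).
  exists (fun z => r * f1 (RtoC r * z)), (fun z => r * (r * f2 (RtoC r * z))).
  intros z Hz.
  assert (Hrz : (Cmod (RtoC r * z) < rad)%R).
  { rewrite Cmod_mult, Cmod_R, Rabs_pos_eq by lra.
    apply Rmult_lt_compat_l with (r := r) in Hz; trivial.
    replace (r * (rad / r))%R with rad in Hz by (field; lra). exact Hz. }
  assert (Hl : is_derive (fun w : C => RtoC r * w) z (RtoC r)).
  { eapply is_C_derive_eq_val.
    - apply (is_C_derive_mult (fun _ => RtoC r) (fun w => w));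
        [apply is_C_derive_const|apply is_C_derive_id].
    - ring. }
  destruct (Hf _ Hrz) as [D1 D2]. split.
  - now apply (is_C_derive_comp f (fun w => RtoC r * w)).
  - eapply is_C_derive_eq_val.
    + apply (is_C_derive_mult (fun _ => RtoC r) (fun w => f1 (RtoC r * w)));
        [apply is_C_derive_const|].
      apply (is_C_derive_comp f1 (fun w => RtoC r * w)); [exact D2|exact Hl].
    + ring.
Qed.

Lemma hol2_CPS (rad : R) (a : nat -> C) : tame rad a -> hol2 rad (CPS a).
Proof.
  intros Ha. exists (CPS (dcoef a)), (CPS (dcoef (dcoef a))). intros z Hz.
  split; apply CPS_derive with rad; trivial. now apply tame_dcoef.
Qed.

(* At a point [z] of least modulus with [Re (P z) <= 0], the real part does not
   decrease in any direction pointing into the smaller disk. *)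
Lemma first_touch (P P1 : C -> C) :
  (forall z, (Cmod z < 1)%R -> forall eps : R, (0 < eps)%R ->
     exists d : R, (0 < d)%R /\
       forall w, (Cmod (w - z) < d)%R -> (Cmod (P w - P z) < eps)%R) ->
  (forall z, (Cmod z < 1)%R -> z <> 0 -> is_derive P z (P1 z)) ->
  (0 < Re (P 0))%R ->
  (exists z, (Cmod z < 1)%R /\ (Re (P z) <= 0)%R) ->
  exists z, (Cmod z < 1)%R /\ z <> 0 /\ Re (P z) = 0%R /\
    Im (z * P1 z) = 0%R /\ (Re (z * P1 z) <= 0)%R.
Proof.
  intros Hcont Hder HP0 [b [Hb HPb]].
  destruct (compact_min (fun z => (Cmod z <= Cmod b)%R /\ (Re (P z) <= 0)%R) Cmod (Cmod b))
    as [z1 [[Hz1 HPz1] Hmin]].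
  - now intros z [Hz _].
  - intros z Hz. destruct (Rle_or_lt (Cmod z) (Cmod b)) as [Hzb|Hzb].
    + assert (HPz : (0 < Re (P z))%R).
      { apply Rnot_le_lt. intros H. now apply Hz. }
      destruct (Hcont z ltac:(lra) _ HPz) as [d [Hd Hw]].
      exists d. split; trivial. intros w Hwz [_ HPw].
      assert (E := re_le_Cmod (P w - P z)). apply Rabs_le_between in E.
      replace (Re (P w - P z)) with (Re (P w) - Re (P z))%R in E by (unfold Re, Im; simpl; ring).
      specialize (Hw w Hwz). lra.
    + exists (Cmod z - Cmod b)%R. split; [lra|]. intros w Hw [Hw1 _].
      generalize (Cmod_triangle_inv z w). rewrite Cmod_sub_sym. lra.
  - intros z _ eps Heps. exists eps. split; trivial. intros w _ Hw.
    generalize (Cmod_triangle_inv z w). rewrite Cmod_sub_sym. lra.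
  - exists b. split; [lra|trivial].
  - assert (Hz0 : z1 <> 0) by (intros ->; lra).
    assert (Hm : (0 < Cmod z1)%R) by now apply Cmod_gt_0.
    assert (Hin : forall z, (Cmod z < Cmod z1)%R -> (0 < Re (P z))%R).
    { intros z Hz. apply Rnot_le_lt. intros H.
      assert (Hc := Hmin z ltac:(split; [lra|trivial])). lra. }
    set (q := z1 * P1 z1).
    assert (D : forall u : C,
      is_derive (fun t : R => Re (P (z1 + RtoC t * (z1 * u)))) 0 (Re (u * q))).
    { intros u. replace (u * q) with ((z1 * u) * P1 z1) by (unfold q; ring).
      apply is_derive_Re_line. replace (z1 + RtoC 0 * (z1 * u)) with z1 by ring.
      apply Hder; [lra|trivial]. }
    (* From [|1 + t u|^2 = 1 + 2 t Re u + t^2 |u|^2] the point moves into the smaller disk while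
       [t |u|^2 < - 2 Re u]. *)
    assert (Hshrink : forall u : C, (Re u < 0)%R -> exists d : R, (0 < d)%R /\
       forall t, (0 < t < d)%R -> (0 < Re (P (z1 + RtoC t * (z1 * u))%C))%R).
    { intros u Hu.
      assert (Hs : (0 < Cmod u ^ 2 + 1)%R) by (generalize (pow2_ge_0 (Cmod u)); lra).
      exists (- 2 * Re u / (Cmod u ^ 2 + 1))%R. split.
      { apply Rdiv_lt_0_compat; lra. }
      intros t [Ht1 Ht2]. apply Hin.
      replace (z1 + RtoC t * (z1 * u)) with (z1 * (1 + RtoC t * u)) by ring.
      rewrite Cmod_mult. rewrite <- (Rmult_1_r (Cmod z1)) at 2.
      apply Rmult_lt_compat_l; trivial.
      apply Rmult_lt_compat_r with (r := (Cmod u ^ 2 + 1)%R) in Ht2; trivial.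
      replace (- 2 * Re u / (Cmod u ^ 2 + 1) * (Cmod u ^ 2 + 1))%R with (- 2 * Re u)%R in Ht2
        by (field; lra).
      apply Rsqr_incrst_0; [|apply Cmod_ge_0|lra].
      rewrite !Rsqr_pow2, Cmod2_alt.
      replace (Re (1 + RtoC t * u)) with (1 + t * Re u)%R by (unfold Re, Im; simpl; ring).
      replace (Im (1 + RtoC t * u)) with (t * Im u)%R by (unfold Re, Im; simpl; ring).
      rewrite Cmod2_alt in Ht2. nra. }
    assert (HPz0 : Re (P z1) = 0%R).
    { apply Rle_antisym; trivial. apply Rnot_lt_le. intros Hneg.
      destruct (Hcont z1 ltac:(lra) (- Re (P z1))%R ltac:(lra)) as [d [Hd Hw]].
      destruct (Hshrink (-(1)) ltac:(simpl; lra)) as [e [He Ht]].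
      set (t := Rmin (e / 2) (d / (2 * Cmod z1))).
      assert (Ht0 : (0 < t)%R).
      { apply Rmin_pos; [lra|]. apply Rdiv_lt_0_compat; lra. }
      assert (Ht1 : (t <= e / 2)%R) by apply Rmin_l.
      assert (Ht2 : (t <= d / (2 * Cmod z1))%R) by apply Rmin_r.
      apply Rmult_le_compat_r with (r := (2 * Cmod z1)%R) in Ht2; [|lra].
      replace (d / (2 * Cmod z1) * (2 * Cmod z1))%R with d in Ht2 by (field; lra).
      specialize (Ht t ltac:(lra)).
      specialize (Hw (z1 + RtoC t * (z1 * - (1)))).
      replace (z1 + RtoC t * (z1 * - (1)) - z1) with (RtoC t * - z1) in Hw by ring.
      rewrite Cmod_mult, Cmod_R, Cmod_opp, Rabs_pos_eq in Hw by lra.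
      specialize (Hw ltac:(nra)).
      set (p := P (z1 + RtoC t * (z1 * - (1)))) in *.
      assert (E := re_le_Cmod (p - P z1)). apply Rabs_le_between in E.
      replace (Re (p - P z1)) with (Re p - Re (P z1))%R in E by (unfold Re, Im; simpl; ring). lra. }
    assert (Hq : forall u : C, (Re u < 0)%R -> (0 <= Re (u * q))%R).
    { intros u Hu. apply Rnot_lt_le. intros Hneg.
      destruct (Hshrink u Hu) as [d [Hd Ht]].
      specialize (D u). apply is_derive_Reals in D.
      destruct (D (- Re (u * q))%R ltac:(lra)) as [e He].
      set (t := (Rmin d e / 2)%R).
      assert (Hde : (0 < Rmin d e)%R) by (apply Rmin_pos; [trivial|apply cond_pos]).
      assert (Ht1 := Rmin_l d e). assert (Ht2 := Rmin_r d e).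
      specialize (He t ltac:(unfold t; lra) ltac:(apply Rabs_def1; unfold t; lra)).
      specialize (Ht t ltac:(unfold t; lra)).
      rewrite Rplus_0_l in He.
      replace (z1 + RtoC 0 * (z1 * u)) with z1 in He by ring.
      rewrite HPz0, Rminus_0_r in He. apply Rabs_def2 in He.
      set (p := Re (P (z1 + RtoC t * (z1 * u)))) in *.
      assert (0 < p / t)%R by (apply Rdiv_lt_0_compat; [trivial|unfold t; lra]).
      lra. }
    exists z1. fold q. repeat split; trivial; [lra| |].
    + assert (Hq1 := Hq (-(1)) ltac:(simpl; lra)).
      replace (Re (- (1) * q)) with (- Re q)%R in Hq1 by (unfold Re, Im; simpl; ring).
      (* Directions [u = - eta + i s] become tangential as [eta] tends to [0]; both signs of [s]
         then force [Im q = 0]. *)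
      assert (Hu : forall s eta : R, (0 < eta)%R -> (0 <= - eta * Re q - s * Im q)%R).
      { intros s eta Heta. specialize (Hq (-eta, s)%R ltac:(simpl; lra)).
        replace (Re (((- eta)%R, s) * q)) with (- eta * Re q - s * Im q)%R in Hq
          by (unfold Re, Im; simpl; ring).
        exact Hq. }
      assert (Hsmall : forall s, (s * Im q <= 0)%R).
      { intros s. apply Rnot_lt_le. intros Hs.
        specialize (Hu s (s * Im q / (2 * (1 - Re q)))%R).
        assert (Hp : (0 < s * Im q / (2 * (1 - Re q)))%R) by (apply Rdiv_lt_0_compat; lra).
        specialize (Hu Hp). set (k := (s * Im q / (2 * (1 - Re q)))%R) in *.
        assert (Hk : (k * (2 * (1 - Re q)) = s * Im q)%R) by (unfold k; field; lra).
        nra. }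
      generalize (Hsmall 1%R) (Hsmall (-1)%R). lra.
    + assert (Hq1 := Hq (-(1)) ltac:(simpl; lra)).
      replace (Re (- (1) * q)) with (- Re q)%R in Hq1 by (unfold Re, Im; simpl; ring). lra.
Qed.

(** * Coefficients of functions with positive real part *)

Ltac hol2_tac := repeat match goal with
  | |- hol2 _ (fun z => z) => apply hol2_id
  | |- hol2 _ (fun _ => ?c) => apply (hol2_const _ c)
  | |- hol2 _ (fun z => @?f z + @?g z) => apply (hol2_plus _ f g)
  | |- hol2 _ (fun z => @?f z * @?g z) => apply (hol2_mult _ f g)
  | |- hol2 _ (fun z => CPS ?a z) => apply (hol2_CPS _ a)
  | |- _ => eassumption
  end.

Lemma Cconj_unit (u : C) : Cmod u = 1%R -> u <> 0 /\ Cconj u = / u.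
Proof.
  intros Hu. assert (Hu0 : u <> 0) by (apply Cmod_gt_0; lra).
  split; trivial.
  assert (E := Cmod2_conj u). rewrite Hu in E.
  replace (RtoC (1 ^ 2)) with (RtoC 1) in E by (f_equal; ring).
  replace (Cconj u) with (/ u * (u * Cconj u)) by (field; trivial).
  rewrite <- E. ring.
Qed.

Lemma Cconj_RtoC (r : R) : Cconj (RtoC r) = RtoC r.
Proof. apply injective_projections; simpl; ring. Qed.

Lemma Re_conj_sub (X : C) : Re (Cconj X - X) = 0%R.
Proof. unfold Re; simpl. ring. Qed.

(* [H] is holomorphic, and on the unit circle it has the same real part as [p]
   times the trigonometric polynomial [w0 + 2 Re (sum w_k conj(u)^k)]: replace each
   [s conj(u)^j] by its conjugate. *)
Lemma trig_poly_positivity (rad : R) (P4 : C -> C) (c2 c3 w1 w2 w3 w4 : C) (w0 : R) :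
  (1 < rad)%R -> hol2 rad P4 ->
  (forall u, Cmod u = 1%R ->
     (0 <= Re (1 + u * u * (c2 + u * (c3 + u * P4 u))))%R) ->
  (forall u, Cmod u = 1%R -> exists W : R, (0 <= W)%R /\
     RtoC W = RtoC w0 + (Cconj w1 * u + w1 * / u) + (Cconj w2 * (u * u) + w2 * (/ u * / u))
       + (Cconj w3 * (u * u * u) + w3 * (/ u * / u * / u))
       + (Cconj w4 * (u * u * u * u) + w4 * (/ u * / u * / u * / u))) ->
  (0 <= w0 + Re (w2 * c2 + w3 * c3 + w4 * P4 0))%R.
Proof.
  intros Hrad HP4 Hp HW.
  set (P3 := fun u => c3 + u * P4 u).
  set (P2 := fun u => c2 + u * P3 u).
  set (p := fun u => 1 + u * u * P2 u).
  set (H := fun u =>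
    p u * (RtoC w0 + Cconj w1 * u + Cconj w2 * (u * u) + Cconj w3 * (u * u * u)
           + Cconj w4 * (u * u * u * u))
    + (Cconj w1 * u + w1 * u * P2 u)
    + (Cconj w2 * (u * u) + w2 * P2 u)
    + (Cconj w3 * (u * u * u) + Cconj (w3 * c2) * u + w3 * P3 u)
    + (Cconj w4 * (u * u * u * u) + Cconj (w4 * c2) * (u * u) + Cconj (w4 * c3) * u
       + w4 * P4 u)).
  assert (h3 : hol2 rad P3).
  { unfold P3. hol2_tac. }
  assert (h2 : hol2 rad P2).
  { unfold P2. hol2_tac. }
  assert (h1 : hol2 rad p).
  { unfold p. hol2_tac. }
  assert (hH : hol2 rad H).
  { unfold H. hol2_tac. }
  assert (Hpos := Re_min_principle rad H Hrad hH).
  replace (w0 + Re (w2 * c2 + w3 * c3 + w4 * P4 0))%R with (Re (H 0)).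
  2:{ replace (H 0) with (RtoC w0 + (w2 * c2 + w3 * c3 + w4 * P4 0))
        by (unfold H, p, P2, P3; ring).
      reflexivity. }
  apply Hpos. intros u Hu.
  destruct (Cconj_unit u Hu) as [Hu0 Hc].
  destruct (HW u Hu) as [W [HW0 HWu]].
  assert (Hconj : forall s : C,
    Cconj s * u = Cconj (s * / u) /\
    Cconj s * (u * u) = Cconj (s * (/ u * / u)) /\
    Cconj s * (u * u * u) = Cconj (s * (/ u * / u * / u)) /\
    Cconj s * (u * u * u * u) = Cconj (s * (/ u * / u * / u * / u))).
  { intros s. rewrite <- Hc. repeat rewrite Cmult_conj. rewrite !Cconj_conj.
    repeat split. }
  replace (H u) with (p u * RtoC W
    + (Cconj w1 * u - w1 * / u) + (Cconj w2 * (u * u) - w2 * (/ u * / u))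
    + (Cconj w3 * (u * u * u) - w3 * (/ u * / u * / u))
    + (Cconj (w3 * c2) * u - w3 * c2 * / u)
    + (Cconj w4 * (u * u * u * u) - w4 * (/ u * / u * / u * / u))
    + (Cconj (w4 * c2) * (u * u) - w4 * c2 * (/ u * / u))
    + (Cconj (w4 * c3) * u - w4 * c3 * / u)).
  2:{ rewrite HWu. unfold H, p, P2, P3. field. exact Hu0. }
  destruct (Hconj w1) as [-> _]. destruct (Hconj w2) as [_ [-> _]].
  destruct (Hconj w3) as [_ [_ [-> _]]]. destruct (Hconj (w3 * c2)) as [-> _].
  destruct (Hconj w4) as [_ [_ [_ ->]]]. destruct (Hconj (w4 * c2)) as [_ [-> _]].
  destruct (Hconj (w4 * c3)) as [-> _].
  assert (Rplus : forall a b : C, Re (a + b) = (Re a + Re b)%R) by reflexivity.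
  rewrite !Rplus, !Re_conj_sub, !Rplus_0_r.
  replace (Re (p u * RtoC W)) with (Re (p u) * W)%R by (unfold Re; simpl; ring).
  apply Rmult_le_pos; trivial. now apply Hp.
Qed.

(** The test polynomial is [|q|^2] with [q = b0 + b1 u + ... + b4 u^4], whose Fourier coefficients
    are the correlations [sum_j b_j conj(b_(j+k))]. The correlation of neighbours is absent from the
    conclusion because [p] has no linear term. *)
Lemma toeplitz_positivity (rad : R) (P4 : C -> C) (c2 c3 b0 b1 b2 b3 b4 : C) :
  (1 < rad)%R -> hol2 rad P4 ->
  (forall u, Cmod u = 1%R ->
     (0 <= Re (1 + u * u * (c2 + u * (c3 + u * P4 u))))%R) ->
  (0 <= Cmod b0 ^ 2 + Cmod b1 ^ 2 + Cmod b2 ^ 2 + Cmod b3 ^ 2 + Cmod b4 ^ 2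
     + Re ((b0 * Cconj b2 + b1 * Cconj b3 + b2 * Cconj b4) * c2
           + (b0 * Cconj b3 + b1 * Cconj b4) * c3 + (b0 * Cconj b4) * P4 0))%R.
Proof.
  intros Hrad HP4 Hp.
  apply (trig_poly_positivity rad P4 c2 c3
    (b0 * Cconj b1 + b1 * Cconj b2 + b2 * Cconj b3 + b3 * Cconj b4)); trivial.
  intros u Hu. destruct (Cconj_unit u Hu) as [Hu0 Hc].
  set (q := b0 + b1 * u + b2 * (u * u) + b3 * (u * u * u) + b4 * (u * u * u * u)).
  exists (Cmod q ^ 2)%R. split; [apply pow2_ge_0|].
  rewrite !RtoC_plus, !Cmod2_conj. unfold q.
  repeat rewrite ?Cplus_conj, ?Cmult_conj, ?Cconj_conj.
  rewrite Hc. field. exact Hu0.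
Qed.

(** Turns a family of Toeplitz inequalities with a free unit parameter into a bound on a modulus;
    the extremal parameter is [- y / |y|]. *)
Lemma Cmod_le_of_unit_test (y : C) (B : R) :
  (forall e, Cmod e = 1%R -> (0 <= B + Re (Cconj e * y))%R) -> (Cmod y <= B)%R.
Proof.
  intros H. destruct (Ceq_dec y 0) as [->|Hy].
  - specialize (H 1 Cmod_1). rewrite Cmod_0.
    replace (Re (Cconj 1 * 0)) with 0%R in H by (unfold Re; simpl; ring). lra.
  - assert (Hm : (0 < Cmod y)%R) by now apply Cmod_gt_0.
    assert (Hm0 : RtoC (Cmod y) <> 0) by (intros E; apply RtoC_inj in E; lra).
    specialize (H (- y / RtoC (Cmod y))).
    rewrite Cmod_div, Cmod_opp, Cmod_R, Rabs_pos_eq in H by (trivial; lra).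
    specialize (H ltac:(field; lra)).
    replace (Cconj (- y / RtoC (Cmod y)) * y) with (RtoC (- Cmod y)) in H.
    + simpl in H. lra.
    + unfold Cdiv. rewrite Cmult_conj, Copp_conj, Cinv_conj, Cconj_RtoC by trivial.
      replace (- Cconj y * / RtoC (Cmod y) * y) with (- (y * Cconj y) / RtoC (Cmod y))
        by (unfold Cdiv; ring).
      rewrite <- Cmod2_conj. rewrite RtoC_pow, RtoC_opp. simpl. field. trivial.
Qed.

Lemma caratheodory_bounds_closed (rad : R) (P4 : C -> C) (x y : C) :
  (1 < rad)%R -> hol2 rad P4 ->
  (forall u, Cmod u = 1%R ->
     (0 <= Re (1 + u * u * (2 * x + u * (2 * y + u * P4 u))))%R) ->
  (Cmod y <= 1 - Cmod x ^ 2)%R /\ (Cmod (P4 0 / 2 - x * x) <= 1 - Cmod x ^ 2)%R.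
Proof.
  intros Hrad HP4 Hp. split; apply Cmod_le_of_unit_test; intros e He.
  (* With [b0 = 1], [b3 = e] and [b4 = 0] fixed, these [b1] and [b2] minimize the form, whose value
     is then [2 (1 - |x|^2 + Re (conj(e) y))]. *)
  - assert (T := toeplitz_positivity rad P4 (2 * x) (2 * y) 1 (- (Cconj x * e)) (- x) e 0
                   Hrad HP4 Hp).
    rewrite !Cmod_opp, !Cmod_mult, Cmod_conj, He, Cmod_1, Cmod_0 in T.
    assert (E : RtoC (Cmod x ^ 2) = x * Cconj x) by apply Cmod2_conj.
    assert (E2 : e * Cconj e = 1).
    { rewrite <- Cmod2_conj, He. f_equal. ring. }
    rewrite Cconj_RtoC in T. rewrite Copp_conj in T.
    match type of T with (0 <= _ + Re ?X)%R =>
      replace X with (RtoC (- (4 * Cmod x ^ 2)) + 2 * (Cconj e * y)) in T end.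
    2:{ rewrite RtoC_opp, RtoC_mult, E.
        transitivity (-(2) * (x * Cconj x) - 2 * (x * Cconj x) * (e * Cconj e)
                      + 2 * (Cconj e * y)); [rewrite E2|]; ring. }
    set (k := Cconj e * y) in *.
    replace (Re (RtoC (- (4 * Cmod x ^ 2)) + 2 * k)) with (- (4 * Cmod x ^ 2) + 2 * Re k)%R in T
      by (unfold Re; simpl; ring).
    lra.
  (* Again [b2] minimizes the form, now for [b0 = 1], [b4 = e] and [b1 = b3 = 0]. The cross term of
     [|x + conj(x) e|^2] is twice the real part of [s = x^2 conj(e)]; this is where the [- x * x] in
     the bound comes from. *)
  - assert (T := toeplitz_positivity rad P4 (2 * x) (2 * y) 1 0 (- (x + Cconj x * e)) 0 e
                   Hrad HP4 Hp).
    rewrite !Cmod_opp, He, Cmod_1, Cmod_0 in T.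
    rewrite Cconj_RtoC, Copp_conj, Cplus_conj, Cmult_conj, Cconj_conj in T.
    assert (E : RtoC (Cmod x ^ 2) = x * Cconj x) by apply Cmod2_conj.
    assert (E2 : e * Cconj e = 1).
    { rewrite <- Cmod2_conj, He. f_equal. ring. }
    assert (E3 : RtoC (Cmod (x + Cconj x * e) ^ 2)
      = 2 * RtoC (Cmod x ^ 2) + (x * x * Cconj e + Cconj (x * x * Cconj e))).
    { rewrite Cmod2_conj, E. rewrite ?Cplus_conj, ?Cmult_conj, ?Cconj_conj.
      transitivity (x * Cconj x + x * Cconj x * (e * Cconj e) + x * x * Cconj e
                    + Cconj x * Cconj x * e); [|rewrite E2]; ring. }
    set (s := x * x * Cconj e) in *.
    match type of T with (0 <= _ + Re ?X)%R =>
      replace X with (- (4) * RtoC (Cmod x ^ 2) - 2 * s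
                      + 2 * (Cconj e * (P4 0 / 2 - x * x))) in T end.
    2:{ rewrite E. unfold s.
        transitivity (- (2) * (x * Cconj x) - 2 * (x * Cconj x) * (e * Cconj e)
           - 4 * (x * x) * Cconj e + Cconj e * P4 0); [rewrite E2; field|ring]. }
    assert (E4 : (Cmod (x + Cconj x * e) ^ 2 = 2 * Cmod x ^ 2 + 2 * Re s)%R).
    { apply (f_equal Re) in E3. unfold Re in *. simpl in E3. simpl. lra. }
    set (k := Cconj e * (P4 0 / 2 - x * x)) in *.
    set (m := (Cmod (x + Cconj x * e) ^ 2)%R) in *.
    replace (Re (- (4) * RtoC (Cmod x ^ 2) - 2 * s + 2 * k))
      with (- 4 * Cmod x ^ 2 - 2 * Re s + 2 * Re k)%R in T
      by (unfold Re; simpl; ring).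
    lra.
Qed.

Lemma nonneg_at_1_of_left (F : R -> R) : continuity_pt F 1 ->
  (forall r, (0 < r < 1)%R -> (0 <= F r)%R) -> (0 <= F 1)%R.
Proof.
  intros Hc H. apply Rnot_lt_le. intros Hneg.
  destruct (Hc (- F 1)%R ltac:(lra)) as [d [Hd Hx]].
  set (r := (1 - Rmin (d / 2) (1 / 2))%R).
  assert (H1 := Rmin_l (d / 2) (1 / 2)). assert (H2 := Rmin_r (d / 2) (1 / 2)).
  assert (H3 : (0 < Rmin (d / 2) (1 / 2))%R) by (apply Rmin_pos; lra).
  specialize (Hx r). simpl in Hx. unfold R_dist, D_x, no_cond in Hx.
  assert (Hr : (Rabs (F r - F 1) < - F 1)%R).
  { apply Hx. split; [split; [trivial|unfold r; lra]|]. apply Rabs_def1; unfold r; lra. }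
  specialize (H r ltac:(unfold r; lra)). apply Rabs_def2 in Hr. lra.
Qed.

(** The dilation [u -> p(r u)] is holomorphic on the radius [1 / r > 1] and multiplies the
    coefficient of degree [k] by [r^k]; the bounds for [r < 1] pass to [r = 1] by continuity. *)
Lemma caratheodory_bounds (P4 : C -> C) (x y : C) : hol2 1 P4 ->
  (forall z, (Cmod z < 1)%R -> z <> 0 ->
     (0 <= Re (1 + z * z * (2 * x + z * (2 * y + z * P4 z))))%R) ->
  (Cmod y <= 1 - Cmod x ^ 2)%R /\ (Cmod (P4 0 / 2 - x * x) <= 1 - Cmod x ^ 2)%R.
Proof.
  intros HP4 Hp.
  assert (Hr : forall r : R, (0 < r < 1)%R ->
     (0 <= 1 - Cmod x ^ 2 * r ^ 4 - Cmod y * r ^ 3)%R /\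
     (0 <= 1 - Cmod x ^ 2 * r ^ 4 - Cmod (P4 0 / 2 - x * x) * r ^ 4)%R).
  { intros r Hr.
    assert (Hmr : Cmod (RtoC r) = r) by (rewrite Cmod_R, Rabs_pos_eq; lra).
    destruct (caratheodory_bounds_closed (1 / r)
      (fun u => RtoC (r ^ 4) * P4 (RtoC r * u)) (RtoC (r ^ 2) * x) (RtoC (r ^ 3) * y)) as [B1 B2].
    - apply Rmult_lt_reg_r with r; [lra|]. unfold Rdiv.
      rewrite Rmult_assoc, Rinv_l by lra. lra.
    - apply (hol2_mult _ (fun _ => RtoC (r ^ 4)) (fun u => P4 (RtoC r * u)));
        [apply hol2_const|]. apply hol2_scal_arg; [lra|trivial].
    - intros u Hu.
      replace (1 + u * u * (2 * (RtoC (r ^ 2) * x) + u * (2 * (RtoC (r ^ 3) * y)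
                 + u * (RtoC (r ^ 4) * P4 (RtoC r * u)))))
        with (1 + (RtoC r * u) * (RtoC r * u) * (2 * x + (RtoC r * u) * (2 * y
                 + (RtoC r * u) * P4 (RtoC r * u)))).
      + apply Hp.
        * rewrite Cmod_mult, Hmr, Hu. lra.
        * apply Cmod_gt_0. rewrite Cmod_mult, Hmr, Hu. lra.
      + rewrite !RtoC_pow. simpl Cpow. ring.
    - rewrite Cmult_0_r in B2.
      assert (Hpow : forall n, Cmod (RtoC (r ^ n)) = (r ^ n)%R).
      { intros n. rewrite RtoC_pow, Cmod_pow, Hmr. reflexivity. }
      replace (RtoC (r ^ 4) * P4 0 / 2 - RtoC (r ^ 2) * x * (RtoC (r ^ 2) * x))
        with (RtoC (r ^ 4) * (P4 0 / 2 - x * x)) in B2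
        by (rewrite !RtoC_pow; simpl Cpow; field).
      rewrite !Cmod_mult, !Hpow in B1. rewrite !Cmod_mult, !Hpow in B2.
      replace ((r ^ 2 * Cmod x) ^ 2)%R with (Cmod x ^ 2 * r ^ 4)%R in B1, B2 by ring.
      split; lra. }
  split.
  - assert (H := nonneg_at_1_of_left (fun r => 1 - Cmod x ^ 2 * r ^ 4 - Cmod y * r ^ 3)%R).
    cut (0 <= 1 - Cmod x ^ 2 * 1 ^ 4 - Cmod y * 1 ^ 3)%R; [lra|].
    apply H; [reg|]. intros r Hr01. now apply Hr.
  - assert (H := nonneg_at_1_of_left
      (fun r => 1 - Cmod x ^ 2 * r ^ 4 - Cmod (P4 0 / 2 - x * x) * r ^ 4)%R).
    cut (0 <= 1 - Cmod x ^ 2 * 1 ^ 4 - Cmod (P4 0 / 2 - x * x) * 1 ^ 4)%R; [lra|].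
    apply H; [reg|]. intros r Hr01. now apply Hr.
Qed.

(** * Quotients of power series with positive real part *)

Definition shift (k : nat) (a : nat -> C) (n : nat) : C := a (k + n)%nat.

Lemma tame_shift_k (rad : R) (k : nat) (a : nat -> C) :
  tame rad a -> tame rad (shift k a).
Proof.
  intros Ha. induction k as [|k IH]; [exact Ha|].
  apply tame_le with (fun n => shift k a (S n)); [|now apply tame_shift].
  intros n. unfold shift. rewrite Nat.add_succ_r. apply Rle_refl.
Qed.

Lemma CPS_shift_k (rad : R) (k : nat) (a : nat -> C) (z : C) :
  tame rad a -> (Cmod z < rad)%R ->
  CPS (shift k a) z = a k + z * CPS (shift (S k) a) z.
Proof.
  intros Ha Hz. rewrite (CPS_shift rad) by (trivial; now apply tame_shift_k).
  unfold shift at 1. rewrite Nat.add_0_r. do 2 f_equal.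
  apply CPS_ext. intros n. unfold shift. f_equal. lia.
Qed.

(** The conditions on [N 2], [N 3], [N 4] match coefficients in [N = M (1 + 2 x z^2 + 2 y z^3 + 2 w
    z^4 + ...)]. Instead of expanding [N / M], the proof writes
    [N - M (1 + 2 x z^2 + 2 y z^3) = z^4 K] with [K] built from tails of the two series; then
    [K / M] plays the role of [P4] and [K 0 = 2 w]. *)
Lemma caratheodory_quotient_bounds (M N : nat -> C) (x y w : C) :
  tame 1 M -> tame 1 N ->
  M 0%nat = 1 -> N 0%nat = 1 -> M 1%nat = 0 -> N 1%nat = 0 ->
  N 2%nat = M 2%nat + 2 * x -> N 3%nat = M 3%nat + 2 * y ->
  N 4%nat = M 4%nat + 2 * x * M 2%nat + 2 * w ->
  (forall z, (Cmod z < 1)%R -> CPS M z <> 0) ->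
  (forall z, (Cmod z < 1)%R -> z <> 0 -> (0 < Re (CPS N z / CPS M z))%R) ->
  (Cmod y <= 1 - Cmod x ^ 2)%R /\ (Cmod (w - x * x) <= 1 - Cmod x ^ 2)%R.
Proof.
  intros HM HN M0 N0 M1 N1 N2 N3 N4 HM0 Hp.
  set (K := fun z => CPS (shift 4 N) z + - (1) * CPS (shift 4 M) z
     + - (2 * x) * CPS (shift 2 M) z + - (2 * y) * CPS (shift 1 M) z).
  assert (HK0 : K 0 = 2 * w).
  { unfold K. rewrite !(CPS_0 1) by (try lra; now apply tame_shift_k).
    unfold shift; simpl Nat.add. rewrite N4, M1. ring. }
  destruct (caratheodory_bounds (fun z => K z * / CPS M z) x y) as [B1 B2].
  - apply (hol2_mult _ K (fun z => / CPS M z)).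
    + unfold K. hol2_tac; now apply tame_shift_k.
    + apply hol2_inv; [trivial|now apply hol2_CPS].
  - intros z Hz Hz0. specialize (HM0 z Hz).
    replace (1 + z * z * (2 * x + z * (2 * y + z * (K z * / CPS M z))))
      with (CPS N z / CPS M z); [left; now apply Hp|].
    assert (EM : CPS M z = 1 + z * CPS (shift 1 M) z).
    { change (CPS M z) with (CPS (shift 0 M) z).
      rewrite (CPS_shift_k 1 0), M0 by trivial. reflexivity. }
    assert (EM2 : CPS (shift 1 M) z = z * CPS (shift 2 M) z).
    { rewrite (CPS_shift_k 1 1), M1 by trivial. ring. }
    assert (EM4 : CPS (shift 2 M) z
      = M 2%nat + z * (M 3%nat + z * CPS (shift 4 M) z)).
    { now rewrite !(CPS_shift_k 1 2), !(CPS_shift_k 1 3) by trivial. }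
    assert (EN : CPS N z
      = 1 + z * z * (N 2%nat + z * (N 3%nat + z * CPS (shift 4 N) z))).
    { change (CPS N z) with (CPS (shift 0 N) z).
      rewrite (CPS_shift_k 1 0), (CPS_shift_k 1 1), (CPS_shift_k 1 2),
        (CPS_shift_k 1 3), N0, N1 by trivial. ring. }
    transitivity ((CPS M z * (1 + z * z * (2 * x + z * (2 * y))) + z * z * z * z * K z)
                  / CPS M z).
    + f_equal. unfold K. rewrite EN, N2, N3.
      transitivity (CPS M z + 2 * x * (z * z) * CPS M z + 2 * y * (z * z * z) * CPS M z
        + z * z * z * z * (CPS (shift 4 N) z - CPS (shift 4 M) z
          - 2 * x * CPS (shift 2 M) z - 2 * y * CPS (shift 1 M) z)); [|ring].
      rewrite EM, EM2.
      transitivity (1 + z * z * CPS (shift 2 M) z + 2 * x * (z * z) + 2 * y * (z * z * z)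
        + z * z * z * z * (CPS (shift 4 N) z - CPS (shift 4 M) z)); [|ring].
      rewrite EM4. ring.
    + field. trivial.
  - split; trivial.
    replace (w - x * x) with (K 0 * / CPS M 0 / 2 - x * x); trivial.
    rewrite HK0, (CPS_0 1), M0 by (trivial; lra). field.
Qed.

(** * Coefficients of the inverse function *)

(** Stands in for continuity at [0], with closure rules already at hand. *)
Definition diff0 (F : C -> C) : Prop := exists l : C, is_derive F (RtoC 0) l.

Lemma diff0_const (c : C) : diff0 (fun _ => c).
Proof. exists 0. apply is_C_derive_const. Qed.

Lemma diff0_id : diff0 (fun w => w).
Proof. exists 1. apply is_C_derive_id. Qed.

Lemma diff0_plus (F G : C -> C) : diff0 F -> diff0 G -> diff0 (fun w => F w + G w).
Proof. intros [l Hl] [m Hm]. exists (l + m). now apply is_C_derive_plus. Qed.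

Lemma diff0_mult (F G : C -> C) : diff0 F -> diff0 G -> diff0 (fun w => F w * G w).
Proof. intros [l Hl] [m Hm]. eexists. now apply is_C_derive_mult; [exact Hl|exact Hm]. Qed.

Lemma diff0_CPS (rad : R) (a : nat -> C) : (0 < rad)%R -> tame rad a -> diff0 (CPS a).
Proof.
  intros Hr Ha. eexists. apply CPS_derive with rad; trivial. now rewrite Cmod_0.
Qed.

Lemma diff0_CPS_comp (rad : R) (a : nat -> C) (G : C -> C) : (0 < rad)%R -> tame rad a ->
  G 0 = 0 -> diff0 G -> diff0 (fun w => CPS a (G w)).
Proof.
  intros Hr Ha HG [m Hm]. eexists.
  apply (is_C_derive_comp (CPS a) G); [|exact Hm].
  apply CPS_derive with rad; trivial. now rewrite HG, Cmod_0.
Qed.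

Ltac diff0_tac := repeat match goal with
  | |- diff0 (fun z => z) => apply diff0_id
  | |- diff0 (fun _ => ?c) => apply (diff0_const c)
  | |- diff0 (fun z => @?f z + @?g z) => apply (diff0_plus f g)
  | |- diff0 (fun z => @?f z * @?g z) => apply (diff0_mult f g)
  | |- _ => solve [auto]
  end.

(** The step of coefficient comparison that cancels a factor [w]: [F] vanishes off [0], and
    continuity carries this over to [0]. *)
Lemma diff0_zero (rad : R) (F : C -> C) : (0 < rad)%R -> diff0 F ->
  (forall w, (Cmod w < rad)%R -> w <> 0 -> w * F w = 0) -> F 0 = 0.
Proof.
  intros Hr [l Hl] H. apply Cmod_eq_0. apply Rle_antisym; [|apply Cmod_ge_0].
  apply Rnot_lt_le. intros Hpos.
  destruct (is_C_derive_continuous F 0 l Hl _ Hpos) as [d [Hd Hw]].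
  set (t := (Rmin d rad / 2)%R).
  assert (Hm : (0 < Rmin d rad)%R) by now apply Rmin_pos.
  assert (H1 := Rmin_l d rad). assert (H2 := Rmin_r d rad).
  assert (Ht : Cmod (RtoC t) = t) by (rewrite Cmod_R; apply Rabs_pos_eq; unfold t; lra).
  assert (Ht0 : RtoC t <> 0) by (apply Cmod_gt_0; rewrite Ht; unfold t; lra).
  specialize (Hw (RtoC t)). replace (RtoC t - 0) with (RtoC t) in Hw by ring.
  specialize (Hw ltac:(rewrite Ht; unfold t; lra)).
  specialize (H (RtoC t) ltac:(rewrite Ht; unfold t; lra) Ht0).
  replace (F (RtoC t)) with (RtoC 0) in Hw.
  - replace (0 - F 0) with (- F 0) in Hw by ring. rewrite Cmod_opp in Hw. lra.
  - symmetry. transitivity (/ RtoC t * (RtoC t * F (RtoC t))); [field; trivial|].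
    rewrite H. ring.
Qed.

(** No power series are composed. With the tails [S k] of [A] and [U k] of [a], the identity
    [f (g w) = w] reads [G (1 + G^2 U_3(G)) = w] for [G = w S_1]. Each round cancels one [w],
    evaluates at [0] to get the next [A k], and substitutes [S_k = A_k + w S_(k+1)]. *)
Lemma hankel23_inverse (f : C -> C) (a A : nat -> C) :
  normalized_analytic f a -> a 2%nat = 0 -> inverse_coeffs f A -> A 0%nat = 0 ->
  hankel23 A = a 3%nat * a 5%nat - 3 * (a 3%nat * a 3%nat * a 3%nat) - a 4%nat * a 4%nat.
Proof.
  intros (a0 & a1 & Hf) a2 (r & Hr & g & Hg) A0.
  assert (Ha : tame 1 a) by (apply (tame_of_series 1 a f); exact Hf).
  assert (HA : tame r A) by (apply (tame_of_series r A g); intros w Hw; apply Hg, Hw).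
  set (S := fun k => CPS (shift k A)). set (U := fun k => CPS (shift k a)).
  set (G := fun w => w * S 1%nat w).
  assert (HS : forall k w, (Cmod w < r)%R -> S k w = A k + w * S (Datatypes.S k) w).
  { intros k w Hw. now apply (CPS_shift_k r). }
  assert (HU : forall k z, (Cmod z < 1)%R -> U k z = a k + z * U (Datatypes.S k) z).
  { intros k w Hw. now apply (CPS_shift_k 1). }
  assert (HS0 : forall k, S k 0 = A k).
  { intros k. rewrite HS; [ring|now rewrite Cmod_0]. }
  assert (HU0 : forall k, U k 0 = a k).
  { intros k. rewrite HU; [ring|rewrite Cmod_0; lra]. }
  assert (HG0 : G 0 = 0) by (unfold G; ring).
  assert (HGg : forall w, (Cmod w < r)%R -> (Cmod (G w) < 1)%R /\
            G w * (1 + G w * G w * U 3%nat (G w)) = w).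
  { intros w Hw. destruct (Hg w Hw) as [Hs [Hd Hfg]].
    assert (E : G w = g w).
    { rewrite <- (CPS_unique _ _ _ Hs). change (CPS A w) with (S 0%nat w).
      rewrite (HS 0%nat w Hw), A0. unfold G. ring. }
    rewrite E. split; [exact Hd|]. transitivity (f (g w)); [|exact Hfg].
    rewrite <- (CPS_unique _ _ _ (Hf _ Hd)). change (CPS a (g w)) with (U 0%nat (g w)).
    rewrite (HU 0%nat), (HU 1%nat), (HU 2%nat), a0, a1, a2 by exact Hd. ring. }
  assert (dS : forall k, diff0 (fun w => S k w)).
  { intros k. apply (diff0_CPS r); trivial. now apply tame_shift_k. }
  assert (dG : diff0 G) by (unfold G; diff0_tac).
  assert (dU : forall k, diff0 (fun w => U k (G w))).
  { intros k. apply (diff0_CPS_comp 1 (shift k a)); trivial; [lra|]. now apply tame_shift_k. }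
  assert (dS' : forall k, diff0 (S k)) by exact dS.
  assert (E1 : forall w, (Cmod w < r)%R ->
     w * (S 1%nat w * (1 + w * S 1%nat w * (w * S 1%nat w) * U 3%nat (G w)) + -(1)) = 0).
  { intros w Hw. destruct (HGg w Hw) as [_ E].
    transitivity (G w * (1 + G w * G w * U 3%nat (G w)) - w); [unfold G; ring|].
    rewrite E. ring. }
  assert (A1 : A 1%nat = 1).
  { assert (Z := diff0_zero r
      (fun w => S 1%nat w * (1 + w * S 1%nat w * (w * S 1%nat w) * U 3%nat (G w)) + -(1))
      Hr ltac:(diff0_tac) (fun w Hw _ => E1 w Hw)).
    cbv beta in Z. rewrite HG0, HS0, HU0 in Z.
    transitivity (A 1%nat * (1 + 0 * A 1%nat * (0 * A 1%nat) * a 3%nat) + - (1) + 1); [ring|].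
    rewrite Z. ring. }
  assert (Cancel : forall w X : C, w <> 0 -> w * X = 0 -> X = 0).
  { intros w X Hw HX. transitivity (/ w * (w * X)); [field; trivial|]. rewrite HX. ring. }
  assert (E2 : forall w, (Cmod w < r)%R -> w <> 0 ->
     w * (S 2%nat w + w * (S 1%nat w * S 1%nat w * S 1%nat w * U 3%nat (G w))) = 0).
  { intros w Hw Hw0. assert (Z := Cancel _ _ Hw0 (E1 w Hw)).
    rewrite <- Z. rewrite (HS 1%nat w Hw), A1. ring. }
  assert (A2 : A 2%nat = 0).
  { assert (Z := diff0_zero r
      (fun w => S 2%nat w + w * (S 1%nat w * S 1%nat w * S 1%nat w * U 3%nat (G w)))
      Hr ltac:(diff0_tac) E2).
    cbv beta in Z. rewrite HS0 in Z. rewrite <- Z. ring. }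
  assert (E3 : forall w, (Cmod w < r)%R -> w <> 0 ->
     w * (S 3%nat w + S 1%nat w * S 1%nat w * S 1%nat w * U 3%nat (G w)) = 0).
  { intros w Hw Hw0. assert (Z := Cancel _ _ Hw0 (E2 w Hw Hw0)).
    rewrite <- Z, (HS 2%nat w Hw), A2. ring. }
  assert (A3 : A 3%nat = - a 3%nat).
  { assert (Z := diff0_zero r
      (fun w => S 3%nat w + S 1%nat w * S 1%nat w * S 1%nat w * U 3%nat (G w))
      Hr ltac:(diff0_tac) E3).
    cbv beta in Z. rewrite !HS0, HG0, HU0, A1 in Z.
    transitivity (A 3%nat + 1 * 1 * 1 * a 3%nat - a 3%nat); [ring|]. rewrite Z. ring. }
  assert (HS1 : forall w, (Cmod w < r)%R -> S 1%nat w = 1 + w * w * S 3%nat w).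
  { intros w Hw. rewrite (HS 1%nat), (HS 2%nat), A1, A2 by trivial. ring. }
  (* Defined by [S_1^3 = 1 + w^2 E], where [S_1 = 1 + w^2 S_3]. Its value [3 A_3] at [0] is the
     source of the term [3 a_3^2] in [A 5]. *)
  set (E := fun w => S 3%nat w * (3 + 3 * (w * w) * S 3%nat w
                      + w * w * w * w * (S 3%nat w * S 3%nat w))).
  assert (dE : diff0 (fun w => E w)) by (unfold E; diff0_tac).
  assert (E4 : forall w, (Cmod w < r)%R -> w <> 0 ->
     w * (S 4%nat w + w * (E w * U 3%nat (G w)) + S 1%nat w * U 4%nat (G w)) = 0).
  { intros w Hw Hw0. assert (Z := Cancel _ _ Hw0 (E3 w Hw Hw0)).
    rewrite <- Z. destruct (HGg w Hw) as [Hd _].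
    transitivity (A 3%nat + w * S 4%nat w + a 3%nat + G w * U 4%nat (G w)
                  + w * w * E w * U 3%nat (G w)); [rewrite A3; unfold G at 3; ring|].
    rewrite <- (HS 3%nat w Hw).
    transitivity (S 3%nat w + (a 3%nat + G w * U 4%nat (G w)) + w * w * E w * U 3%nat (G w));
      [ring|].
    rewrite <- (HU 3%nat _ Hd), (HS1 w Hw). unfold E. ring. }
  assert (A4 : A 4%nat = - a 4%nat).
  { assert (Z := diff0_zero r
      (fun w => S 4%nat w + w * (E w * U 3%nat (G w)) + S 1%nat w * U 4%nat (G w))
      Hr ltac:(diff0_tac) E4).
    cbv beta in Z. rewrite !HS0, HG0, !HU0, A1 in Z.
    transitivity (A 4%nat + 0 * (E 0 * a 3%nat) + 1 * a 4%nat - a 4%nat); [ring|].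
    rewrite Z. ring. }
  assert (E5 : forall w, (Cmod w < r)%R -> w <> 0 ->
     w * (S 5%nat w + E w * U 3%nat (G w) + S 1%nat w * S 1%nat w * U 5%nat (G w)
          + w * S 3%nat w * a 4%nat) = 0).
  { intros w Hw Hw0. assert (Z := Cancel _ _ Hw0 (E4 w Hw Hw0)).
    rewrite <- Z. destruct (HGg w Hw) as [Hd _].
    rewrite (HS 4%nat w Hw), (HU 4%nat _ Hd), A4.
    transitivity (- a 4%nat + (1 + w * w * S 3%nat w) * a 4%nat + w * S 5%nat w
      + w * E w * U 3%nat (G w) + w * S 1%nat w * S 1%nat w * U 5%nat (G w)); [ring|].
    rewrite <- (HS1 w Hw). unfold G at 4. ring. }
  assert (A5 : A 5%nat = 3 * (a 3%nat * a 3%nat) - a 5%nat).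
  { assert (Z := diff0_zero r
      (fun w => S 5%nat w + E w * U 3%nat (G w) + S 1%nat w * S 1%nat w * U 5%nat (G w)
          + w * S 3%nat w * a 4%nat) Hr ltac:(diff0_tac) E5).
    cbv beta in Z. unfold E in Z. rewrite !HS0, HG0, !HU0, A1, A3 in Z.
    match type of Z with ?X = _ =>
      transitivity (X + 3 * (a 3%nat * a 3%nat) - a 5%nat) end; [ring|].
    rewrite Z. ring. }
  unfold hankel23. rewrite A3, A4, A5. ring.
Qed.

(** * Existence of the inverse power series *)

Ltac Cring := match goal with |- @eq _ ?x ?y => change (@eq C x y); ring end.

Definition conv (u v : nat -> C) (n : nat) : C :=
  sum_n (fun k => u k * v (n - k)%nat) n.

Definition delta0 (n : nat) : C := match n with O => 1 | S _ => 0 end.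

Fixpoint cpow (u : nat -> C) (k : nat) : nat -> C :=
  match k with
  | O => delta0
  | S k => conv u (cpow u k)
  end.

(** Partial sums of the weighted l1 norm. Truncation makes every estimate a finite one, and bounds
    uniform in [N] give absolute convergence afterwards. *)
Definition wnorm (r : R) (u : nat -> C) (N : nat) : R :=
  sum_n (fun n => Cmod (u n) * r ^ n)%R N.

Lemma sum_n_R_Sn (u : nat -> R) n : sum_n u (S n) = (sum_n u n + u (S n))%R.
Proof. exact (sum_Sn u n). Qed.

Lemma sum_n_C_Sn (u : nat -> C) n : sum_n u (S n) = sum_n u n + u (S n).
Proof. exact (sum_Sn u n). Qed.

Lemma sum_n_R_nonneg (u : nat -> R) n :
  (forall k, (k <= n)%nat -> (0 <= u k)%R) -> (0 <= sum_n u n)%R.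
Proof.
  induction n as [|n IH]; intros H.
  - rewrite sum_O. now apply H.
  - rewrite sum_n_R_Sn. assert (0 <= u (S n))%R by (apply H; lia).
    assert (0 <= sum_n u n)%R by (apply IH; intros; apply H; lia). lra.
Qed.

Lemma sum_n_R_le (u v : nat -> R) n :
  (forall k, (k <= n)%nat -> (u k <= v k)%R) -> (sum_n u n <= sum_n v n)%R.
Proof.
  induction n as [|n IH]; intros H.
  - rewrite !sum_O. now apply H.
  - rewrite !sum_n_R_Sn. assert (u (S n) <= v (S n))%R by (apply H; lia).
    assert (sum_n u n <= sum_n v n)%R by (apply IH; intros; apply H; lia). lra.
Qed.

Lemma sum_n_R_plus (u v : nat -> R) n :
  sum_n (fun k => u k + v k)%R n = (sum_n u n + sum_n v n)%R.
Proof. exact (sum_n_plus u v n). Qed.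

Lemma sum_n_R_mult_l (c : R) (u : nat -> R) n :
  sum_n (fun k => c * u k)%R n = (c * sum_n u n)%R.
Proof. exact (sum_n_mult_l (K := R_Ring) c u n). Qed.

Lemma sum_n_R_mult_r (c : R) (u : nat -> R) n :
  sum_n (fun k => u k * c)%R n = (sum_n u n * c)%R.
Proof. exact (sum_n_mult_r (K := R_Ring) c u n). Qed.

Lemma sum_n_R_mono (u : nat -> R) n N : (forall k, (0 <= u k)%R) -> (n <= N)%nat ->
  (sum_n u n <= sum_n u N)%R.
Proof.
  intros Hu H. induction H as [|N H IH]; [lra|].
  rewrite sum_n_R_Sn. specialize (Hu (S N)). lra.
Qed.

Lemma sum_n_C_zero (u : nat -> C) n : (forall k, (k <= n)%nat -> u k = 0) ->
  sum_n u n = RtoC 0.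
Proof.
  induction n as [|n IH]; intros H.
  - rewrite sum_O. now apply H.
  - rewrite sum_n_C_Sn, IH, (H (S n)) by (intros; auto). Cring.
Qed.

Lemma sum_n_C_ext (u v : nat -> C) n : (forall k, (k <= n)%nat -> u k = v k) ->
  sum_n u n = sum_n v n.
Proof. exact (sum_n_ext_loc u v n). Qed.

Lemma triangular_sum (p q : nat -> R) N :
  sum_n (fun n => sum_n (fun k => p k * q (n - k)%nat)%R n) N
  = sum_n (fun k => p k * sum_n q (N - k))%R N.
Proof.
  induction N as [|N IH].
  - now rewrite !sum_O.
  - rewrite sum_n_R_Sn, IH, !(sum_n_R_Sn _ N).
    rewrite Nat.sub_diag, sum_O.
    rewrite <- Rplus_assoc, <- sum_n_R_plus. f_equal.
    apply sum_n_ext_loc. intros k Hk.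
    rewrite Nat.sub_succ_l, sum_n_R_Sn by trivial.
    symmetry. apply Rmult_plus_distr_l.
Qed.

Lemma wnorm_nonneg (r : R) (u : nat -> C) N : (0 <= r)%R -> (0 <= wnorm r u N)%R.
Proof.
  intros Hr. apply sum_n_R_nonneg. intros k _.
  apply Rmult_le_pos; [apply Cmod_ge_0|now apply pow_le].
Qed.

(** Index pairs with sum at most [N] form a triangle inside the square that the product on the right
    sums over. *)
Lemma wnorm_conv (r : R) (u v : nat -> C) N : (0 <= r)%R ->
  (wnorm r (conv u v) N <= wnorm r u N * wnorm r v N)%R.
Proof.
  intros Hr. unfold wnorm at 1.
  set (p := fun n => (Cmod (u n) * r ^ n)%R). set (q := fun n => (Cmod (v n) * r ^ n)%R).
  assert (Hp : forall n, (0 <= p n)%R).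
  { intros n. apply Rmult_le_pos; [apply Cmod_ge_0|now apply pow_le]. }
  assert (Hq : forall n, (0 <= q n)%R).
  { intros n. apply Rmult_le_pos; [apply Cmod_ge_0|now apply pow_le]. }
  apply Rle_trans with (sum_n (fun n => sum_n (fun k => p k * q (n - k)%nat)%R n) N).
  - apply sum_n_R_le. intros n _. unfold conv.
    eapply Rle_trans.
    { apply Rmult_le_compat_r; [now apply pow_le|apply Cmod_sum_n_le]. }
    rewrite <- sum_n_R_mult_r. apply sum_n_R_le. intros k Hk.
    rewrite Cmod_mult. unfold p, q. replace (r ^ n)%R with (r ^ k * r ^ (n - k))%R.
    + right; ring.
    + rewrite <- pow_add. f_equal. lia.
  - rewrite triangular_sum. unfold wnorm. fold p. fold q. rewrite <- sum_n_R_mult_r.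
    apply sum_n_R_le. intros k Hk. apply Rmult_le_compat_l; trivial.
    apply sum_n_R_mono; trivial. lia.
Qed.

Lemma wnorm_cpow (r s : R) (u : nat -> C) k N : (0 <= r)%R ->
  (wnorm r u N <= s)%R -> (wnorm r (cpow u k) N <= s ^ k)%R.
Proof.
  intros Hr Hs. induction k as [|k IH].
  - simpl. induction N as [|N IHN].
    + unfold wnorm. rewrite sum_O. simpl. rewrite Cmod_1. lra.
    + unfold wnorm. rewrite sum_n_R_Sn. simpl delta0 at 2.
      rewrite Cmod_0, Rmult_0_l, Rplus_0_r. apply IHN.
      eapply Rle_trans; [|exact Hs]. unfold wnorm. rewrite sum_n_R_Sn.
      assert (0 <= Cmod (u (S N)) * r ^ S N)%R; [|lra].
      apply Rmult_le_pos; [apply Cmod_ge_0|now apply pow_le].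
  - simpl cpow. eapply Rle_trans; [now apply wnorm_conv|].
    apply Rmult_le_compat; trivial; now apply wnorm_nonneg.
Qed.

Lemma cpow_low (u : nat -> C) k n : u 0%nat = 0 -> (n < k)%nat -> cpow u k n = 0.
Proof.
  intros H0. revert n. induction k as [|k IH]; intros n Hn; [lia|].
  simpl. unfold conv. apply sum_n_C_zero. intros [|j] Hj.
  - rewrite H0. Cring.
  - rewrite IH by lia. Cring.
Qed.

Lemma cpow_agree (u v : nat -> C) n k :
  (forall j, (j <= n)%nat -> u j = v j) ->
  forall m, (m <= n)%nat -> cpow u k m = cpow v k m.
Proof.
  intros H. induction k as [|k IH]; intros m Hm; [reflexivity|].
  simpl. apply sum_n_C_ext. intros j Hj. rewrite H, IH by lia. reflexivity.
Qed.

(** Without constant term and with at least two factors, no factor can contribute an index above [n]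
    to degree [n + 1]. This gain of one degree is what makes the iteration below stabilize. *)
Lemma cpow_agree_succ (u v : nat -> C) n k :
  u 0%nat = 0 -> v 0%nat = 0 -> (2 <= k)%nat ->
  (forall j, (j <= n)%nat -> u j = v j) -> cpow u k (S n) = cpow v k (S n).
Proof.
  intros Hu Hv Hk H. destruct k as [|k]; [lia|]. simpl.
  apply sum_n_C_ext. intros [|j] Hj; [rewrite Hu, Hv; Cring|].
  destruct (Nat.eq_dec j n) as [->|Hjn].
  - rewrite Nat.sub_diag, !cpow_low by (trivial; lia). Cring.
  - rewrite H, (cpow_agree u v n k H) by lia. reflexivity.
Qed.

Definition high (a : nat -> C) (k : nat) : C :=
  match k with S (S _) => a k | _ => 0 end.

Definition delta1 (n : nat) : C := match n with 1%nat => 1 | _ => 0 end.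

(* The inverse series satisfies [g = w - sum_(k >= 2) a_k g^k]; [reversion_step]
   is the right-hand side on coefficients. *)
Definition reversion_step (a X : nat -> C) (n : nat) : C :=
  delta1 n - sum_n (fun k => high a k * cpow X k n) n.

Definition reversion_iter (a : nat -> C) (m : nat) : nat -> C :=
  Nat.iter m (reversion_step a) (fun _ => 0).

(** Degree [n] is stationary from iteration [n + 1] on, so the diagonal is the limit of the
    iteration. *)
Definition reversion (a : nat -> C) (n : nat) : C := reversion_iter a (S n) n.

Lemma reversion_iter_0 (a : nat -> C) m : reversion_iter a m 0%nat = 0.
Proof.
  destruct m as [|m]; [reflexivity|]. simpl. unfold reversion_step.
  rewrite sum_O. simpl. Cring.
Qed.

Lemma reversion_step_agree (a X Y : nat -> C) n : X 0%nat = 0 -> Y 0%nat = 0 ->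
  (forall j, (j < n)%nat -> X j = Y j) -> reversion_step a X n = reversion_step a Y n.
Proof.
  intros HX HY H. unfold reversion_step. f_equal.
  apply sum_n_C_ext. intros [|[|k]] Hk; simpl high; try Cring.
  f_equal. destruct n as [|n]; [lia|].
  apply cpow_agree_succ; trivial; [lia|]. intros j Hj. apply H. lia.
Qed.

Lemma reversion_iter_agree (a : nat -> C) m : forall j n, (n < m)%nat ->
  reversion_iter a m n = reversion_iter a (m + j) n.
Proof.
  induction m as [|m IH]; intros j n Hn; [lia|].
  apply (reversion_step_agree a (reversion_iter a m) (reversion_iter a (m + j)));
    try apply reversion_iter_0.
  intros i Hi. apply IH. lia.
Qed.

Lemma reversion_eq_iter (a : nat -> C) m n : (n < m)%nat ->
  reversion a n = reversion_iter a m n.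
Proof.
  intros H. unfold reversion. replace m with (S n + (m - S n))%nat by lia.
  apply reversion_iter_agree. lia.
Qed.

Lemma reversion_0 (a : nat -> C) : reversion a 0%nat = 0.
Proof. apply reversion_iter_0. Qed.

Lemma reversion_fixpoint (a : nat -> C) n :
  reversion a n = reversion_step a (reversion a) n.
Proof.
  unfold reversion at 1.
  apply (reversion_step_agree a (reversion_iter a n) (reversion a)).
  - apply reversion_iter_0.
  - apply reversion_0.
  - intros j Hj. symmetry. now apply reversion_eq_iter.
Qed.

Lemma geometric_tail_sum (a : nat -> C) K : (forall k, (Cmod (a k) <= 1)%R) ->
  (sum_n (fun k => Cmod (high a k) * (1 / 8) ^ k)%R K <= 1 / 56)%R.
Proof.
  intros Ha.
  (* The induction needs the missing tail of the geometric series: beyond degree [n] it equals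
     [(1/8)^n / 7], and the total from degree 2 on is [1/56]. *)
  assert (H : (sum_n (fun k => Cmod (high a k) * (1 / 8) ^ k)%R (S K)
             <= 1 / 56 - (1 / 8) ^ S K / 7)%R).
  { induction K as [|K IH].
    - rewrite sum_n_R_Sn, sum_O. simpl high. rewrite Cmod_0. lra.
    - rewrite sum_n_R_Sn. simpl high. specialize (Ha (S (S K))).
      assert (Hp : (0 <= (1 / 8) ^ S (S K))%R) by (apply pow_le; lra).
      assert (E : ((1 / 8) ^ S (S K) = (1 / 8) * (1 / 8) ^ S K)%R) by reflexivity.
      assert (Cmod (a (S (S K))) * (1 / 8) ^ S (S K) <= 1 * (1 / 8) ^ S (S K))%R
        by (apply Rmult_le_compat_r; trivial).
      lra. }
  rewrite sum_n_R_Sn in H.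
  assert (0 <= Cmod (high a (S K)) * (1 / 8) ^ S K)%R.
  { apply Rmult_le_pos; [apply Cmod_ge_0|apply pow_le; lra]. }
  assert (0 <= (1 / 8) ^ S K)%R by (apply pow_le; lra). lra.
Qed.

Lemma wnorm_high_cpow (a X : nat -> C) K N : (forall k, (Cmod (a k) <= 1)%R) ->
  (wnorm (1 / 16) X N <= 1 / 8)%R ->
  (sum_n (fun n => sum_n (fun k => Cmod (high a k) * Cmod (cpow X k n)) K
             * (1 / 16) ^ n)%R N <= 1 / 56)%R.
Proof.
  intros Ha HX.
  apply Rle_trans with
    (sum_n (fun n => sum_n (fun k => Cmod (high a k) * (Cmod (cpow X k n) * (1 / 16) ^ n))%R K) N).
  { apply sum_n_R_le. intros n _. rewrite <- sum_n_R_mult_r.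
    apply sum_n_R_le. intros k _. right. ring. }
  rewrite sum_n_switch.
  eapply Rle_trans; [|apply (geometric_tail_sum a K Ha)].
  apply sum_n_R_le. intros k _. rewrite sum_n_R_mult_l.
  apply Rmult_le_compat_l; [apply Cmod_ge_0|].
  apply wnorm_cpow; [lra|trivial].
Qed.

Lemma wnorm_delta1 N : (wnorm (1 / 16) delta1 N <= 1 / 16)%R.
Proof.
  assert (H : wnorm (1 / 16) delta1 (S N) = (1 / 16)%R).
  { induction N as [|N IH].
    - unfold wnorm. rewrite sum_n_R_Sn, sum_O. simpl. rewrite Cmod_0, Cmod_1. lra.
    - unfold wnorm in *. rewrite sum_n_R_Sn, IH. simpl delta1. rewrite Cmod_0. lra. }
  unfold wnorm in *. rewrite sum_n_R_Sn in H.
  assert (0 <= Cmod (delta1 (S N)) * (1 / 16) ^ S N)%R.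
  { apply Rmult_le_pos; [apply Cmod_ge_0|apply pow_le; lra]. }
  lra.
Qed.

(* [1/16 + sum_(k >= 2) (1/8)^k <= 1/8]. *)
Lemma wnorm_reversion_iter (a : nat -> C) m N : (forall k, (Cmod (a k) <= 1)%R) ->
  (wnorm (1 / 16) (reversion_iter a m) N <= 1 / 8)%R.
Proof.
  intros Ha. induction m as [|m IH].
  - replace (wnorm (1 / 16) (reversion_iter a 0) N) with 0%R; [lra|].
    unfold wnorm. induction N as [|N IHN]; [rewrite sum_O; simpl; rewrite Cmod_0; ring|].
    rewrite sum_n_R_Sn, <- IHN. simpl reversion_iter. rewrite Cmod_0. ring.
  - set (X := reversion_iter a m) in *.
    change (reversion_iter a (S m)) with (reversion_step a X).
    apply Rle_trans with (wnorm (1 / 16) delta1 N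
      + sum_n (fun n => sum_n (fun k => Cmod (high a k) * Cmod (cpow X k n)) N
             * (1 / 16) ^ n)%R N)%R.
    + unfold wnorm. rewrite <- sum_n_R_plus. apply sum_n_R_le. intros n Hn.
      rewrite <- Rmult_plus_distr_r. apply Rmult_le_compat_r; [apply pow_le; lra|].
      unfold reversion_step, Cminus. eapply Rle_trans; [apply Cmod_triangle|].
      apply Rplus_le_compat_l. rewrite Cmod_opp.
      eapply Rle_trans; [apply Cmod_sum_n_le|].
      eapply Rle_trans; [|apply sum_n_R_mono with (n := n); trivial].
      * apply sum_n_R_le. intros k _. rewrite Cmod_mult. lra.
      * intros k. apply Rmult_le_pos; apply Cmod_ge_0.
    + assert (H1 := wnorm_delta1 N). assert (H2 := wnorm_high_cpow a X N N Ha IH). lra.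
Qed.

Lemma wnorm_reversion (a : nat -> C) N : (forall k, (Cmod (a k) <= 1)%R) ->
  (wnorm (1 / 16) (reversion a) N <= 1 / 8)%R.
Proof.
  intros Ha. eapply Rle_trans; [|apply (wnorm_reversion_iter a (S N) N Ha)].
  apply sum_n_R_le. intros n Hn. rewrite (reversion_eq_iter a (S N)) by lia. lra.
Qed.

Lemma ex_series_bounded (u : nat -> R) (B : R) : (forall n, (0 <= u n)%R) ->
  (forall n, (sum_n u n <= B)%R) -> ex_series u.
Proof.
  intros Hu HB.
  destruct (ex_finite_lim_seq_incr (sum_n u) B) as [l Hl]; trivial.
  - intros n. rewrite sum_n_R_Sn. specialize (Hu (S n)). lra.
  - now exists l.
Qed.

(** Reduces to the real Cauchy product theorem for the four products of real and imaginary parts,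
    all absolutely convergent. *)
Lemma is_C_series_conv (u v : nat -> C) (l m : C) :
  is_series u l -> is_series v m ->
  ex_series (fun n => Cmod (u n)) -> ex_series (fun n => Cmod (v n)) ->
  is_series (conv u v) (l * m).
Proof.
  intros Hu Hv Au Av.
  apply is_C_series_components in Hu, Hv. destruct Hu as [u1 u2], Hv as [v1 v2].
  assert (Ab : forall w : nat -> C, ex_series (fun n => Cmod (w n)) ->
     ex_series (fun n => Rabs (Re (w n))) /\ ex_series (fun n => Rabs (Im (w n)))).
  { intros w Hw. split; apply (ex_series_le (V := R_CompleteNormedModule) _
      (fun n => Cmod (w n))); trivial; intros n; change (norm ?x) with (Rabs x);
      rewrite Rabs_Rabsolu; [apply re_le_Cmod|apply im_le_Cmod]. }
  destruct (Ab u Au) as [Au1 Au2], (Ab v Av) as [Av1 Av2].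
  assert (P11 := is_series_mult _ _ _ _ u1 v1 Au1 Av1).
  assert (P22 := is_series_mult _ _ _ _ u2 v2 Au2 Av2).
  assert (P12 := is_series_mult _ _ _ _ u1 v2 Au1 Av2).
  assert (P21 := is_series_mult _ _ _ _ u2 v1 Au2 Av1).
  apply is_C_series_components. split.
  - assert (P := is_series_minus _ _ _ _ P11 P22).
    refine (is_series_ext _ _ _ _ P). intros n.
    unfold conv. rewrite sum_n_Re, <- !sum_n_Reals.
    transitivity (sum_n (fun k => Re (u k) * Re (v (n - k)%nat))%R n
      + -1 * sum_n (fun k => Im (u k) * Im (v (n - k)%nat))%R n)%R.
    { set (s1 := sum_n (fun k => Re (u k) * Re (v (n - k)%nat))%R n).
      set (s2 := sum_n (fun k => Im (u k) * Im (v (n - k)%nat))%R n).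
      change (s1 - s2 = s1 + -1 * s2)%R. ring. }
    rewrite <- sum_n_R_mult_l, <- sum_n_R_plus. apply sum_n_ext. intros k.
    unfold Re, Im; simpl. ring.
  - assert (P := is_series_plus _ _ _ _ P12 P21).
    refine (is_series_ext _ _ _ _ P). intros n.
    unfold conv. rewrite sum_n_Im, <- !sum_n_Reals.
    transitivity (sum_n (fun k => Re (u k) * Im (v (n - k)%nat))%R n
      + sum_n (fun k => Im (u k) * Re (v (n - k)%nat))%R n)%R; [reflexivity|].
    rewrite <- sum_n_R_plus. apply sum_n_ext. intros k.
    unfold Re, Im; simpl. ring.
Qed.

Lemma conv_mul_pow (u v : nat -> C) (w : C) n :
  conv u v n * w ^ n = conv (fun k => u k * w ^ k) (fun k => v k * w ^ k) n.
Proof.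
  unfold conv.
  transitivity (sum_n (fun k => u k * v (n - k)%nat * w ^ n) n).
  - symmetry. exact (sum_n_mult_r (K := C_Ring) (w ^ n) (fun k => u k * v (n - k)%nat) n).
  - apply sum_n_C_ext. intros k Hk.
    replace (w ^ n) with (w ^ k * w ^ (n - k)).
    + ring.
    + rewrite <- Cpow_add_r. f_equal. lia.
Qed.

Lemma delta0_series (w : C) : is_series (fun n => delta0 n * w ^ n) (RtoC 1).
Proof.
  intros P HP. exists 0%nat. intros n _.
  cut (@eq C (RtoC 1) (sum_n (fun n => delta0 n * w ^ n) n)).
  { intros E. apply (eq_ind _ P (locally_singleton _ _ HP) _ E). }
  induction n as [|n IHn]; [rewrite sum_O; simpl; Cring|].
  rewrite sum_n_C_Sn, <- IHn. simpl. Cring.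
Qed.

Section Reversion.

Variable a : nat -> C.
Hypothesis Ha : forall k, (Cmod (a k) <= 1)%R.
Variable w : C.
Hypothesis Hw : (Cmod w < 1 / 16)%R.

Let A := reversion a.
Let g := CPS A w.

Lemma ex_series_of_wnorm (u : nat -> C) (B : R) :
  (forall N, (wnorm (1 / 16) u N <= B)%R) -> ex_series (fun n => Cmod (u n * w ^ n)).
Proof.
  intros HB. apply (ex_series_bounded _ B); [intros; apply Cmod_ge_0|].
  intros N. eapply Rle_trans; [|apply (HB N)]. apply sum_n_R_le. intros n _.
  rewrite Cmod_mult, Cmod_pow. apply Rmult_le_compat_l; [apply Cmod_ge_0|].
  apply pow_incr. split; [apply Cmod_ge_0|lra].
Qed.

Lemma reversion_series : is_series (fun n => A n * w ^ n) g.
Proof.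
  apply CSeries_correct, (ex_series_of_wnorm _ (1 / 8)).
  intros N. now apply wnorm_reversion.
Qed.

Lemma reversion_value_bound : (Cmod g <= 1 / 8)%R.
Proof.
  apply (Cmod_series_le_bound _ _ _ reversion_series). intros N.
  eapply Rle_trans; [apply Cmod_sum_n_le|].
  eapply Rle_trans; [|apply (wnorm_reversion a N Ha)].
  apply sum_n_R_le. intros n _. rewrite Cmod_mult, Cmod_pow.
  apply Rmult_le_compat_l; [apply Cmod_ge_0|].
  apply pow_incr. split; [apply Cmod_ge_0|lra].
Qed.

Lemma cpow_series k : is_series (fun n => cpow A k n * w ^ n) (g ^ k).
Proof.
  induction k as [|k IH].
  - exact (delta0_series w).
  - simpl. apply is_C_series_ext with
      (conv (fun n => A n * w ^ n) (fun n => cpow A k n * w ^ n)).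
    + intros n. symmetry. apply conv_mul_pow.
    + apply is_C_series_conv; trivial; [apply reversion_series| |].
      * apply (ex_series_of_wnorm _ (1 / 8)). intros N. now apply wnorm_reversion.
      * apply (ex_series_of_wnorm _ ((1 / 8) ^ k)). intros N.
        apply wnorm_cpow; [lra|now apply wnorm_reversion].
Qed.

(** With [K] finite, only finitely many series are added and no infinite double sum is exchanged. *)
Lemma high_cpow_series K :
  is_series (fun n => sum_n (fun k => high a k * cpow A k n) K * w ^ n)
            (sum_n (fun k => high a k * g ^ k) K).
Proof.
  induction K as [|K IH].
  - rewrite sum_O. apply is_C_series_ext with (fun n => high a 0 * (cpow A 0 n * w ^ n)).
    + intros n. rewrite sum_O. Cring.
    + apply is_C_series_scal, cpow_series.
  - rewrite sum_n_C_Sn. apply is_C_series_ext with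
      (fun n => sum_n (fun k => high a k * cpow A k n) K * w ^ n
                + high a (S K) * (cpow A (S K) n * w ^ n)).
    + intros n. rewrite sum_n_C_Sn. Cring.
    + apply is_C_series_plus; trivial. apply is_C_series_scal, cpow_series.
Qed.

Lemma delta1_series : is_series (fun n => delta1 n * w ^ n) w.
Proof.
  intros P HP. exists 1%nat. intros n Hn.
  cut (@eq C w (sum_n (fun n => delta1 n * w ^ n) n)).
  { intros E. apply (eq_ind _ P (locally_singleton _ _ HP) _ E). }
  induction Hn as [|n Hn IHn].
  - rewrite sum_n_C_Sn, sum_O. simpl. Cring.
  - rewrite sum_n_C_Sn, <- IHn. destruct n as [|n]; [lia|]. simpl. Cring.
Qed.

Hypothesis a0 : a 0%nat = 0.
Hypothesis a1 : a 1%nat = 1.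

(* Truncating [f] at degree [K], the composite with [g] agrees with [w] up to
   degree [K], so the error is a tail of size [(16 |w|)^K]. *)
Lemma truncated_composition_error K :
  (Cmod (sum_n (fun k => a k * g ^ k)%C (S K) - w) <= (16 * Cmod w) ^ S K)%R.
Proof.
  assert (E : sum_n (fun k => a k * g ^ k) (S K) =
              g + sum_n (fun k => high a k * g ^ k) (S K)).
  { induction K as [|K IH].
    - rewrite !sum_n_C_Sn, !sum_O, a0, a1. simpl. Cring.
    - rewrite sum_n_C_Sn, IH, (sum_n_C_Sn _ (S K)). simpl high. Cring. }
  rewrite E. clear E.
  set (M := S K).
  assert (T := is_C_series_plus _ _ _ _
    (is_C_series_plus _ _ _ _ reversion_series (high_cpow_series M))
    (is_C_series_scal (-(1)) _ _ delta1_series)).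
  replace (g + sum_n (fun k => high a k * g ^ k) M - w)
    with (g + sum_n (fun k => high a k * g ^ k) M + - (1) * w) by ring.
  apply (Cmod_series_le_bound _ _ _ T). intros N. clear T.
  eapply Rle_trans; [apply Cmod_sum_n_le|].
  set (q := (16 * Cmod w)%R).
  assert (Hq : (0 <= q < 1)%R) by (unfold q; generalize (Cmod_ge_0 w); lra).
  assert (HqM : (0 <= q ^ M)%R) by (apply pow_le; lra).
  apply Rle_trans with (q ^ M * (wnorm (1 / 16) A N
      + sum_n (fun n => sum_n (fun k => Cmod (high a k) * Cmod (cpow A k n)) M
             * (1 / 16) ^ n)%R N))%R.
  - unfold wnorm. rewrite <- sum_n_R_plus, <- sum_n_R_mult_l.
    apply sum_n_R_le. intros n _. rewrite <- Rmult_plus_distr_r.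
    replace (A n * w ^ n + sum_n (fun k => high a k * cpow A k n) M * w ^ n
             + - (1) * (delta1 n * w ^ n))
      with ((A n + sum_n (fun k => high a k * cpow A k n) M - delta1 n) * w ^ n) by ring.
    rewrite Cmod_mult, Cmod_pow.
    replace (Cmod w) with (q * (1 / 16))%R by (unfold q; field).
    rewrite Rpow_mult_distr.
    assert (Hs : (0 <= (1 / 16) ^ n)%R) by (apply pow_le; lra).
    assert (Hsum : (0 <= sum_n (fun k => Cmod (high a k) * Cmod (cpow A k n)) M)%R).
    { apply sum_n_R_nonneg. intros k _. apply Rmult_le_pos; apply Cmod_ge_0. }
    (* Up to degree [M] the fixed point equation makes the coefficient vanish, since
       [cpow A k n = 0] for [k > n] allows the sum to run up to [M]. Beyond [M],
       [|w|^n = q^n (1/16)^n] with [q^n <= q^M]. *)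
    destruct (Nat.le_gt_cases n M) as [Hn|Hn].
    + replace (A n + sum_n (fun k => high a k * cpow A k n) M - delta1 n) with (RtoC 0).
      { rewrite Cmod_0, Rmult_0_l. apply Rmult_le_pos; trivial.
        apply Rmult_le_pos; trivial. generalize (Cmod_ge_0 (A n)). lra. }
      unfold A at 1. rewrite reversion_fixpoint. unfold reversion_step. fold A.
      replace (sum_n (fun k => high a k * cpow A k n) M)
        with (sum_n (fun k => high a k * cpow A k n) n); [Cring|].
      clearbody M. clear HqM Hsum.
      induction Hn as [|m Hm IHm]; [reflexivity|].
      rewrite sum_n_C_Sn, <- IHm, (cpow_low A (S m) n), Cmult_0_r;
        [exact (eq_sym (Cplus_0_r _))|apply reversion_0|lia].
    + replace (delta1 n) with (RtoC 0).
      2:{ destruct n as [|[|n]]; [lia|unfold M in Hn; lia|reflexivity]. }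
      assert (Hqn : (q ^ n <= q ^ M)%R).
      { replace n with (M + (n - M))%nat by lia. rewrite pow_add.
        rewrite <- (Rmult_1_r (q ^ M)) at 2. apply Rmult_le_compat_l; trivial.
        rewrite <- (pow1 (n - M)). apply pow_incr. lra. }
      assert (Hqn0 : (0 <= q ^ n)%R) by (apply pow_le; lra).
      assert (HB : (Cmod (A n + sum_n (fun k => high a k * cpow A k n)%C M - 0)%C
               <= Cmod (A n) + sum_n (fun k => Cmod (high a k) * Cmod (cpow A k n)) M)%R).
      { replace (A n + sum_n (fun k => high a k * cpow A k n) M - 0)
          with (A n + sum_n (fun k => high a k * cpow A k n) M) by ring.
        eapply Rle_trans; [apply Cmod_triangle|]. apply Rplus_le_compat_l.
        eapply Rle_trans; [apply Cmod_sum_n_le|].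
        apply sum_n_R_le. intros k _. rewrite Cmod_mult. lra. }
      rewrite (Rmult_comm (q ^ n)), <- Rmult_assoc, (Rmult_comm (q ^ M)).
      apply Rmult_le_compat; trivial; [|].
      * apply Rmult_le_pos; [apply Cmod_ge_0|trivial].
      * apply Rmult_le_compat_r; trivial.
  - rewrite <- (Rmult_1_r (q ^ M)) at 2. apply Rmult_le_compat_l; trivial.
    assert (H1 := wnorm_reversion a N Ha). fold A in H1.
    assert (H2 := wnorm_high_cpow a A M N Ha H1). lra.
Qed.

Lemma reversion_right_inverse : is_series (fun k => a k * g ^ k) w.
Proof.
  intros P [eps HP].
  assert (Hq : (0 <= 16 * Cmod w < 1)%R) by (generalize (Cmod_ge_0 w); lra).
  destruct (pow_lt_1_zero (16 * Cmod w)%R ltac:(rewrite Rabs_pos_eq; lra) eps (cond_pos eps))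
    as [N HN].
  exists (S N). intros n Hn. apply HP, C_NormedModule_mixin_compat1.
  destruct n as [|n]; [lia|].
  eapply Rle_lt_trans; [exact (truncated_composition_error n)|].
  eapply Rle_lt_trans; [apply Rle_abs|]. apply HN. lia.
Qed.

End Reversion.

Lemma tame_bounded (a : nat -> C) : (forall k, (Cmod (a k) <= 1)%R) -> tame 1 a.
Proof.
  intros Ha rho Hrho. exists 1%R. intros n. rewrite <- (Rmult_1_l 1).
  apply Rmult_le_compat; [apply Cmod_ge_0|apply pow_le; lra|trivial|].
  rewrite <- (pow1 n). apply pow_incr. lra.
Qed.

(** Meant for the extremal functions; the witnesses are radius [1/16] for [w] and the bound [1/8]
    for [g w], which keeps [g w] in the disk. *)
Lemma inverse_coeffs_reversion (a : nat -> C) : (forall k, (Cmod (a k) <= 1)%R) ->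
  a 0%nat = 0 -> a 1%nat = 1 -> inverse_coeffs (CPS a) (reversion a).
Proof.
  intros Ha a0 a1. exists (1 / 16)%R. split; [lra|].
  exists (CPS (reversion a)). intros w Hw. split; [|split].
  - now apply reversion_series.
  - unfold in_disk. assert (H := reversion_value_bound a Ha w Hw). lra.
  - apply CPS_unique. now apply reversion_right_inverse.
Qed.

(** * The four classes *)

Lemma in_disk_0 : in_disk 0.
Proof. unfold in_disk. rewrite Cmod_0. lra. Qed.

Lemma disk_ball (z w : C) : in_disk z -> (Cmod (w - z) < 1 - Cmod z)%R -> in_disk w.
Proof. unfold in_disk. generalize (Cmod_triangle_inv w z). lra. Qed.

Lemma normalized_tame (f : C -> C) (a : nat -> C) : normalized_analytic f a -> tame 1 a.
Proof. intros (_ & _ & H). exact (tame_of_series 1 a f H). Qed.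

Lemma normalized_eq (f : C -> C) (a : nat -> C) (z : C) :
  normalized_analytic f a -> in_disk z -> f z = CPS a z.
Proof. intros (_ & _ & H) Hz. symmetry. apply CPS_unique, H, Hz. Qed.

Lemma normalized_derivative (f : C -> C) (a : nat -> C) (z l : C) :
  normalized_analytic f a -> in_disk z -> is_derive f z l -> l = CPS (dcoef a) z.
Proof.
  intros Hf Hz Hl. apply (is_C_derive_eq f z); trivial.
  apply (is_C_derive_ext_ball (CPS a) f z _ (1 - Cmod z)%R).
  - unfold in_disk in Hz. lra.
  - intros w Hw. symmetry. apply normalized_eq; trivial. now apply disk_ball with z.
  - apply CPS_derive with 1%R; trivial. now apply normalized_tame with f.
Qed.

Lemma normalized_second_derivative (f : C -> C) (a : nat -> C) (f1 f2 : C -> C) :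
  normalized_analytic f a ->
  (forall z, in_disk z -> is_derive f z (f1 z)) ->
  (forall z, in_disk z -> is_derive f1 z (f2 z)) ->
  forall z, in_disk z -> f2 z = CPS (dcoef (dcoef a)) z.
Proof.
  intros Hf Hd1 Hd2 z Hz. apply (is_C_derive_eq f1 z); [now apply Hd2|].
  apply (is_C_derive_ext_ball (CPS (dcoef a)) f1 z _ (1 - Cmod z)%R).
  - unfold in_disk in Hz. lra.
  - intros w Hw. assert (Hwd := disk_ball z w Hz Hw). symmetry.
    now apply (normalized_derivative f a); [| |apply Hd1].
  - apply CPS_derive with 1%R; trivial. now apply tame_dcoef, normalized_tame with f.
Qed.

Lemma CPS_factor (a : nat -> C) (z : C) : tame 1 a -> in_disk z ->
  CPS a z = a 0%nat + z * CPS (shift 1 a) z.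
Proof. intros Ha Hz. exact (CPS_shift_k 1 0 a z Ha Hz). Qed.

(** The product rule for [a_0 + z U(z)], combined with uniqueness of the derivative. *)
Lemma CPS_dcoef_factor (a : nat -> C) (z : C) : tame 1 a -> in_disk z ->
  CPS (dcoef a) z = CPS (shift 1 a) z + z * CPS (dcoef (shift 1 a)) z.
Proof.
  intros Ha Hz.
  assert (Hs : tame 1 (shift 1 a)) by now apply tame_shift_k.
  apply (is_C_derive_eq (CPS a) z); [now apply CPS_derive with 1%R|].
  apply (is_C_derive_ext_ball (fun w => a 0%nat + w * CPS (shift 1 a) w) _ z _ (1 - Cmod z)%R).
  - unfold in_disk in Hz. lra.
  - intros w Hw. symmetry. apply CPS_factor; trivial. now apply disk_ball with z.
  - eapply is_C_derive_eq_val.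
    + apply (is_C_derive_plus (fun _ => a 0%nat) (fun w => w * CPS (shift 1 a) w));
        [apply is_C_derive_const|].
      apply (is_C_derive_mult (fun w => w) (CPS (shift 1 a)));
        [apply is_C_derive_id|now apply CPS_derive with 1%R].
    + cbv beta. ring.
Qed.

(** The Noshiro-Warschawski argument on the segment from [0] to [z]: the function
    [Re (conj(z) f(t z))] of [t] has derivative [|z|^2 Re f'(t z) > 0], so it cannot vanish at both
    ends. *)
Lemma bounded_turning_nonzero (f : C -> C) (a : nat -> C) (z : C) :
  normalized_analytic f a -> bounded_turning f -> in_disk z -> f z = 0 -> z = 0.
Proof.
  intros Hf (f1 & Hd & Hpos) Hz Hfz.
  destruct (Ceq_dec z 0) as [|Hz0]; trivial. exfalso.
  assert (Hm : (0 < Cmod z)%R) by now apply Cmod_gt_0.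
  assert (Hline : forall t : R, (0 <= t <= 1)%R -> in_disk (0 + RtoC t * z)).
  { intros t Ht. unfold in_disk in *.
    replace (0 + RtoC t * z) with (RtoC t * z) by ring.
    rewrite Cmod_mult, Cmod_R, Rabs_pos_eq by lra. nra. }
  destruct (MVT_cor2 (fun t => Re (Cconj z * f (0 + RtoC t * z)%C)%C)
              (fun t => Re (z * (Cconj z * f1 (0 + RtoC t * z)))%C) 0 1) as [t [Ht1 Ht2]].
  - lra.
  - intros t Ht. apply is_derive_Reals.
    apply (is_derive_Re_line (fun w => Cconj z * f w) 0 z).
    eapply is_C_derive_eq_val.
    + apply (is_C_derive_mult (fun _ => Cconj z) f); [apply is_C_derive_const|].
      apply Hd. now apply Hline.
    + ring.
  - replace (0 + RtoC 1 * z) with z in Ht1 by ring.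
    replace (0 + RtoC 0 * z) with (RtoC 0) in Ht1 by ring.
    assert (Hf0 : f 0 = 0).
    { rewrite (normalized_eq f a) by (trivial; apply in_disk_0).
      rewrite (CPS_0 1) by (try lra; now apply normalized_tame with f). apply Hf. }
    rewrite Hfz, Hf0 in Ht1. rewrite Cmult_0_r in Ht1. simpl (Re 0) in Ht1.
    specialize (Hpos _ (Hline t ltac:(lra))).
    set (p := f1 (0 + RtoC t * z)) in *.
    replace (Re (z * (Cconj z * p))) with (Cmod z ^ 2 * Re p)%R in Ht1.
    + assert (0 < Cmod z ^ 2 * Re p)%R.
      { apply Rmult_lt_0_compat; trivial. now apply pow_lt. }
      lra.
    + rewrite Cmod2_alt. unfold Re, Im; simpl. ring.
Qed.

Lemma CPS_quotient_derive (u v : nat -> C) (z : C) : tame 1 u -> tame 1 v ->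
  in_disk z -> CPS v z <> 0 ->
  is_derive (fun w => CPS u w * / CPS v w) z
    (CPS (dcoef u) z * / CPS v z
     + CPS u z * (CPS (dcoef v) z * - / (CPS v z * CPS v z))).
Proof.
  intros Hu Hv Hz H0.
  apply (is_C_derive_mult (CPS u) (fun w => / CPS v w));
    [now apply CPS_derive with 1%R|].
  apply is_C_derive_inv; trivial. now apply CPS_derive with 1%R.
Qed.

(* With [Q = G / (z G')] one has [z Q' = 1 - Q (1 + z G'' / G')]; where [Re Q] first
   vanishes, [z Q'] is real and nonpositive while [Q] is imaginary. *)
Lemma convex_quotient_pos (b : nat -> C) : tame 1 b -> b 1%nat = 1 ->
  (forall z, in_disk z -> CPS (dcoef b) z <> 0 /\
     (0 < Re (1 + z * CPS (dcoef (dcoef b)) z / CPS (dcoef b) z))%R) ->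
  forall z, in_disk z -> (0 < Re (CPS (shift 1 b) z * / CPS (dcoef b) z))%R.
Proof.
  intros Hb b1 Hc z Hz. apply Rnot_le_lt. intros Hneg.
  assert (Hs : tame 1 (shift 1 b)) by now apply tame_shift_k.
  assert (Hd : tame 1 (dcoef b)) by now apply tame_dcoef.
  set (U := CPS (shift 1 b)) in *. set (D := CPS (dcoef b)) in *.
  set (Q := fun z => U z * / D z).
  set (Q1 := fun z => CPS (dcoef (shift 1 b)) z * / D z
     + U z * (CPS (dcoef (dcoef b)) z * - / (D z * D z))).
  assert (HQ : forall w, in_disk w -> is_derive Q w (Q1 w)).
  { intros w Hw. apply CPS_quotient_derive; trivial. now apply Hc. }
  destruct (first_touch Q Q1) as (w & Hw & Hw0 & HQw & Him & Hre).
  - intros w Hw. apply (is_C_derive_continuous _ _ _ (HQ w Hw)).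
  - intros w Hw _. now apply HQ.
  - unfold Q, U, D. rewrite !(CPS_0 1) by (trivial; lra).
    unfold shift, dcoef. simpl. rewrite b1.
    replace (1 * / (RtoC 1 * 1)) with (RtoC 1) by field. simpl. lra.
  - exists z. split; trivial.
  - destruct (Hc w Hw) as [HD0 Hcw].
    set (c := 1 + w * CPS (dcoef (dcoef b)) w / D w) in *.
    assert (E : w * Q1 w = 1 - Q w * c).
    { unfold Q1, Q, c. assert (ED := CPS_dcoef_factor b w Hb Hw). fold U in ED. fold D in ED.
      transitivity ((U w + w * CPS (dcoef (shift 1 b)) w - U w) * / D w
        + U w * (w * CPS (dcoef (dcoef b)) w * - / (D w * D w))); [ring|].
      rewrite <- ED. field. exact HD0. }
    rewrite E in Him, Hre. set (q := Q w) in *. clearbody q c.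
    destruct q as [q1 q2], c as [c1 c2]. simpl in *.
    subst q1.
    (* For [q = i q2] the imaginary part of [1 - q c] is [- q2 c1], and [c1 > 0]. So [q2 = 0], and
       [1 - q c = 1] contradicts the sign of its real part. *)
    assert (Hq2 : (q2 * c1 = 0)%R) by lra.
    apply Rmult_integral in Hq2. destruct Hq2 as [->|Hc1]; lra.
Qed.

Lemma convex_fn_nonzero (f : C -> C) (a : nat -> C) (z : C) :
  normalized_analytic f a -> convex_fn f -> in_disk z -> f z = 0 -> z = 0.
Proof.
  intros Hf (f1 & f2 & Hd1 & Hd2 & Hpos) Hz Hfz.
  assert (Ha := normalized_tame f a Hf).
  assert (E1 : forall w, in_disk w -> f1 w = CPS (dcoef a) w).
  { intros w Hw. now apply (normalized_derivative f a); [| |apply Hd1]. }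
  assert (E2 : forall w, in_disk w -> f2 w = CPS (dcoef (dcoef a)) w).
  { now apply (normalized_second_derivative f a f1 f2). }
  assert (HQ := convex_quotient_pos a Ha (proj1 (proj2 Hf))).
  assert (HQz := HQ ltac:(intros w Hw; rewrite <- E1, <- E2 by trivial; now apply Hpos) z Hz).
  destruct (Ceq_dec z 0) as [|Hz0]; trivial. exfalso.
  rewrite (normalized_eq f a), CPS_factor in Hfz by trivial.
  destruct Hf as [a0 _]. rewrite a0, Cplus_0_l in Hfz.
  replace (CPS (shift 1 a) z) with (RtoC 0) in HQz.
  - rewrite Cmult_0_l in HQz. simpl in HQz. lra.
  - symmetry. transitivity (/ z * (z * CPS (shift 1 a) z)); [field; trivial|].
    rewrite Hfz. ring.
Qed.

Lemma starlike_fn_nonzero (f : C -> C) (z : C) :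
  starlike_fn f -> in_disk z -> f z = 0 -> z = 0.
Proof.
  intros (f1 & _ & Hpos) Hz Hfz. destruct (Ceq_dec z 0) as [|Hz0]; trivial.
  now destruct (proj1 (Hpos z Hz Hz0)).
Qed.

(** * Odd parts and starlikeness with respect to symmetric points *)

Definition odd_part (a : nat -> C) (n : nat) : C := if Nat.odd n then a n else 0.

Lemma tame_odd_part (rad : R) (a : nat -> C) : tame rad a -> tame rad (odd_part a).
Proof.
  apply tame_le. intros n. unfold odd_part. destruct (Nat.odd n); [lra|].
  rewrite Cmod_0. apply Cmod_ge_0.
Qed.

Lemma Cpow_opp (z : C) (n : nat) : (- z) ^ n = (if Nat.odd n then -(1) else 1) * z ^ n.
Proof.
  induction n as [|n IH]; [simpl; ring|].
  rewrite Nat.odd_succ, <- Nat.negb_odd. simpl Cpow. rewrite IH.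
  destruct (Nat.odd n); simpl; ring.
Qed.

Lemma CPS_odd_part (a : nat -> C) (z : C) : tame 1 a -> in_disk z ->
  2 * CPS (odd_part a) z = CPS a z - CPS a (- z).
Proof.
  intros Ha Hz.
  rewrite <- (CPS_scal 1) by (trivial; now apply tame_odd_part).
  apply CPS_unique.
  apply is_C_series_ext with (fun n => a n * z ^ n + - (1) * (a n * (- z) ^ n)).
  - intros n. rewrite Cpow_opp. unfold odd_part. destruct (Nat.odd n); ring.
  - replace (CPS a z - CPS a (- z)) with (CPS a z + - (1) * CPS a (- z)) by ring.
    apply is_C_series_plus; [now apply CPS_correct with 1%R|].
    apply is_C_series_scal. apply CPS_correct with 1%R; trivial. now rewrite Cmod_opp.
Qed.

Lemma Copp_opp (z : C) : - - z = z.
Proof. ring. Qed.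

Lemma Copp_neq_0 (z : C) : z <> 0 -> - z <> 0.
Proof. intros Hz E. apply Hz. rewrite <- (Copp_opp z), E. ring. Qed.

Lemma in_disk_opp (z : C) : in_disk z -> in_disk (- z).
Proof. unfold in_disk. now rewrite Cmod_opp. Qed.

(** Here [D(z) = (f(z) - f(-z)) / (2z)], an even function. As [(z D)' = (f'(z) + f'(-z)) / 2], the
    third claim is the mean of the second at [z] and [-z]; it is the convexity condition for a
    primitive of [D]. *)
Lemma sym_starlike_series (f : C -> C) (a : nat -> C) :
  normalized_analytic f a -> sym_starlike_fn f ->
  let D := CPS (shift 1 (odd_part a)) in
  (forall z, in_disk z -> D z <> 0) /\
  (forall z, in_disk z -> z <> 0 -> (0 < Re (CPS (dcoef a) z / D z))%R) /\
  (forall z, in_disk z -> (0 < Re (1 + z * CPS (dcoef (shift 1 (odd_part a))) z / D z))%R).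
Proof.
  intros Hf (f1 & Hd & Hpos) D.
  assert (Ha := normalized_tame f a Hf).
  assert (Ho := tame_odd_part 1 a Ha).
  assert (Hso : tame 1 (shift 1 (odd_part a))) by now apply tame_shift_k.
  assert (E1 : forall w, in_disk w -> f1 w = CPS (dcoef a) w).
  { intros w Hw. now apply (normalized_derivative f a); [| |apply Hd]. }
  assert (EF : forall z, in_disk z -> f z - f (- z) = 2 * (z * D z)).
  { intros z Hz. rewrite !(normalized_eq f a) by (trivial; now apply in_disk_opp).
    rewrite <- CPS_odd_part, (CPS_factor (odd_part a)) by trivial.
    unfold odd_part at 1. simpl. fold D. ring. }
  assert (HD0 : D 0 = 1).
  { unfold D. rewrite (CPS_0 1) by (trivial; lra). apply Hf. }
  assert (HD : forall z, in_disk z -> D z <> 0).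
  { intros z Hz. destruct (Ceq_dec z 0) as [->|Hz0].
    - rewrite HD0. intros E. apply RtoC_inj in E. lra.
    - intros E. destruct (Hpos z Hz Hz0) as [Hn _]. apply Hn.
      rewrite EF, E by trivial. ring. }
  assert (Hp : forall z, in_disk z -> z <> 0 -> (0 < Re (CPS (dcoef a) z / D z))%R).
  { intros z Hz Hz0. destruct (Hpos z Hz Hz0) as [_ Hp].
    rewrite EF, E1 in Hp by trivial.
    replace (2 * z * CPS (dcoef a) z / (2 * (z * D z))) with (CPS (dcoef a) z / D z) in Hp;
      trivial.
    field. split; [now apply HD|trivial]. }
  split; [exact HD|]. split; [exact Hp|].
  intros z Hz. destruct (Ceq_dec z 0) as [->|Hz0].
  - replace (1 + 0 * CPS (dcoef (shift 1 (odd_part a))) 0 / D 0) with (RtoC 1).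
    + simpl. lra.
    + unfold Cdiv. ring.
  - assert (Hm0 := Copp_neq_0 z Hz0).
    assert (HDm : D (- z) = D z).
    { assert (X := EF (- z) (in_disk_opp z Hz)). rewrite Copp_opp in X.
      assert (Y := EF z Hz).
      transitivity ((f (- z) - f z) * / (2 * - z)).
      - rewrite X. field. trivial.
      - transitivity (- (f z - f (- z)) * / (2 * - z)); [ring|]. rewrite Y. field. trivial. }
    assert (P1 := Hp z Hz Hz0). assert (P2 := Hp (- z) (in_disk_opp z Hz) Hm0).
    rewrite HDm in P2.
    replace (1 + z * CPS (dcoef (shift 1 (odd_part a))) z / D z)
      with (RtoC (/ 2) * (CPS (dcoef a) z / D z + CPS (dcoef a) (- z) / D z)).
    + set (p := CPS (dcoef a) z / D z) in *. set (q := CPS (dcoef a) (- z) / D z) in *.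
      replace (Re (RtoC (/ 2) * (p + q))) with (/ 2 * (Re p + Re q))%R
        by (unfold Re, Im; simpl; ring). lra.
    + assert (Eo : CPS (dcoef (odd_part a)) z
               = RtoC (/ 2) * (CPS (dcoef a) z + CPS (dcoef a) (- z))).
      { assert (Hda := tame_dcoef 1 a Ha). apply CPS_unique.
        apply is_C_series_ext with
          (fun n => RtoC (/ 2) * (dcoef a n * z ^ n + dcoef a n * (- z) ^ n)).
        - intros n. rewrite Cpow_opp. unfold dcoef, odd_part.
          rewrite Nat.odd_succ, <- Nat.negb_odd.
          destruct (Nat.odd n); simpl negb; cbv iota; [ring|].
          rewrite RtoC_inv by lra. field.
        - apply is_C_series_scal, is_C_series_plus; apply CPS_correct with 1%R; trivial.
          now apply in_disk_opp. }
      rewrite (CPS_dcoef_factor _ z Ho Hz) in Eo. fold D in Eo.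
      transitivity (RtoC (/ 2) * (CPS (dcoef a) z + CPS (dcoef a) (- z)) / D z);
        [field; now apply HD|].
      rewrite <- Eo. field. now apply HD.
Qed.

(* [G] with [z G' = (f(z) - f(-z)) / 2] is convex and [Re (f' / G') > 0], so [f] is
   close-to-convex; [P = f / G] satisfies [P + z P' G / (z G') = f' / G']. *)
Lemma sym_starlike_fn_nonzero (f : C -> C) (a : nat -> C) (z : C) :
  normalized_analytic f a -> sym_starlike_fn f -> in_disk z -> f z = 0 -> z = 0.
Proof.
  intros Hf Hsym Hz Hfz.
  assert (Ha := normalized_tame f a Hf).
  destruct (sym_starlike_series f a Hf Hsym) as (HD & Hp & Hc).
  (* Coefficients of the primitive [G]. At [n = 0] both factors are [0], the inverse by the
     convention [/ 0 = 0]. *)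
  set (b := fun n => odd_part a n * RtoC (/ INR n)).
  assert (Hb : tame 1 b).
  { apply tame_le with (odd_part a); [|now apply tame_odd_part].
    intros n. unfold b. rewrite Cmod_mult, Cmod_R.
    rewrite <- (Rmult_1_r (Cmod (odd_part a n))) at 2.
    apply Rmult_le_compat_l; [apply Cmod_ge_0|].
    destruct n as [|n]; [simpl; rewrite Rinv_0, Rabs_R0; lra|].
    assert (1 <= INR (S n))%R by (rewrite S_INR; generalize (pos_INR n); lra).
    rewrite Rabs_pos_eq by (left; apply Rinv_0_lt_compat; lra).
    rewrite <- Rinv_1. apply Rinv_le_contravar; lra. }
  assert (Edb : forall n, dcoef b n = shift 1 (odd_part a) n).
  { intros n. unfold dcoef, b, shift. change (1 + n)%nat with (S n).
    assert (INR (S n) <> 0)%R by (apply not_0_INR; lia).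
    transitivity (RtoC (INR (S n) * / INR (S n)) * odd_part a (S n)).
    - rewrite RtoC_mult. ring.
    - rewrite Rinv_r by trivial. ring. }
  assert (ED : forall w, CPS (dcoef b) w = CPS (shift 1 (odd_part a)) w).
  { intros w. now apply CPS_ext. }
  assert (EDD : forall w, CPS (dcoef (dcoef b)) w = CPS (dcoef (shift 1 (odd_part a))) w).
  { intros w. apply CPS_ext. intros n. unfold dcoef at 1 3. now rewrite Edb. }
  assert (b1 : b 1%nat = 1).
  { unfold b, odd_part. simpl. rewrite (proj1 (proj2 Hf)), Rinv_1. ring. }
  assert (HQ := convex_quotient_pos b Hb b1).
  specialize (HQ ltac:(intros w Hw; rewrite EDD, ED; split; [now apply HD|now apply Hc])).
  set (U := CPS (shift 1 b)) in *. set (V := CPS (shift 1 a)).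
  set (D := CPS (dcoef b)) in *.
  assert (HD' : forall w, in_disk w -> D w <> 0).
  { intros w Hw. unfold D. rewrite ED. now apply HD. }
  assert (HsU : tame 1 (shift 1 b)) by now apply tame_shift_k.
  assert (HsV : tame 1 (shift 1 a)) by now apply tame_shift_k.
  assert (HU : forall w, in_disk w -> U w <> 0).
  { intros w Hw E. specialize (HQ w Hw). rewrite E, Cmult_0_l in HQ. simpl in HQ. lra. }
  set (P := fun w => V w * / U w).
  set (P1 := fun w => CPS (dcoef (shift 1 a)) w * / U w
     + V w * (CPS (dcoef (shift 1 b)) w * - / (U w * U w))).
  assert (HP : forall w, in_disk w -> is_derive P w (P1 w)).
  { intros w Hw. apply CPS_quotient_derive; trivial. now apply HU. }
  assert (HPpos : (0 < Re (P z))%R).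
  { apply Rnot_le_lt. intros Hneg.
    destruct (first_touch P P1) as (w & Hw & Hw0 & HPw & Him & Hre).
    - intros w Hw. apply (is_C_derive_continuous _ _ _ (HP w Hw)).
    - intros w Hw _. now apply HP.
    - unfold P, U, V. rewrite !(CPS_0 1) by (trivial; lra).
      unfold shift. simpl Nat.add. rewrite b1, (proj1 (proj2 Hf)).
      replace (1 * / 1) with (RtoC 1) by field. simpl. lra.
    - exists z. now split.
    - specialize (Hp w Hw Hw0). rewrite <- ED in Hp. fold D in Hp.
      replace (CPS (dcoef a) w / D w) with (P w + w * P1 w * (U w * / D w)) in Hp.
      + specialize (HQ w Hw). fold D in HQ.
        set (Q := U w * / D w) in *. set (q := w * P1 w) in *.
        assert (E : Re (P w + q * Q) = (Re (P w) + Re q * Re Q - Im q * Im Q)%R).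
        { unfold Re, Im; simpl. ring. }
        (* At the touching point the real part is [Re q * Re Q] with [Re q <= 0] and [Re Q > 0], so
           it is not positive. *)
        rewrite E, HPw, Him in Hp. nra.
      + unfold P, P1. rewrite (CPS_dcoef_factor a w Ha Hw).
        assert (Eb := CPS_dcoef_factor b w Hb Hw).
        fold V. fold U in Eb. fold D in Eb.
        assert (H1 := HD' w Hw). assert (H2 := HU w Hw).
        transitivity ((V w * D w * U w + w * CPS (dcoef (shift 1 a)) w * U w * U w
          - V w * U w * (w * CPS (dcoef (shift 1 b)) w)) / (U w * U w * D w));
          [field; now split|].
        replace (w * CPS (dcoef (shift 1 b)) w) with (D w - U w) by (rewrite Eb; ring).
        field. now split. }
  destruct (Ceq_dec z 0) as [|Hz0]; trivial. exfalso.
  rewrite (normalized_eq f a), CPS_factor, (proj1 Hf), Cplus_0_l in Hfz by trivial.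
  fold V in Hfz. unfold P in HPpos.
  replace (V z) with (RtoC 0) in HPpos.
  - rewrite Cmult_0_l in HPpos. simpl in HPpos. lra.
  - symmetry. transitivity (/ z * (z * V z)); [field; trivial|]. rewrite Hfz. ring.
Qed.

Lemma inverse_coeffs_0 (f : C -> C) (A : nat -> C) :
  (forall z, in_disk z -> f z = 0 -> z = 0) -> inverse_coeffs f A -> A 0%nat = 0.
Proof.
  intros H (r & Hr & g & Hg).
  assert (HA : tame r A) by (apply (tame_of_series r A g); intros w Hw; apply Hg, Hw).
  destruct (Hg 0) as [Hs [Hd Hf]]; [now rewrite Cmod_0|].
  rewrite <- (CPS_0 r A HA Hr), (CPS_unique _ _ _ Hs). now apply H.
Qed.

(* The hypothesis on [alpha], [gamma], [B] is the estimate
   [alpha X (1 - X^2) + B X^3 + gamma (1 - X^2)^2 <= B] divided by [1 - X]. *)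
Lemma hankel_estimate (alpha gamma B : R) (x y v : C) :
  (0 <= alpha)%R -> (0 <= gamma)%R -> (0 <= B)%R ->
  (forall X, (0 <= X <= 1)%R ->
     (alpha * X * (1 + X) + gamma * ((1 - X) * (1 + X) ^ 2) <= B * (1 + X + X ^ 2))%R) ->
  (Cmod y <= 1 - Cmod x ^ 2)%R -> (Cmod v <= 1 - Cmod x ^ 2)%R ->
  (Cmod (RtoC alpha * (x * v) - RtoC B * (x * x * x) - RtoC gamma * (y * y)) <= B)%R.
Proof.
  intros Ha Hg HB H Hy Hv. set (X := Cmod x) in *.
  assert (HX0 : (0 <= X)%R) by apply Cmod_ge_0.
  assert (Hy0 := Cmod_ge_0 y). assert (Hv0 := Cmod_ge_0 v).
  assert (HX1 : (X <= 1)%R) by nra.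
  unfold Cminus.
  eapply Rle_trans; [apply Cmod_triangle|].
  eapply Rle_trans; [apply Rplus_le_compat_r, Cmod_triangle|].
  rewrite !Cmod_opp, !Cmod_mult, !Cmod_R, !Rabs_pos_eq by trivial. fold X.
  assert (H1 : (alpha * (X * Cmod v) <= alpha * (X * (1 - X ^ 2)))%R).
  { apply Rmult_le_compat_l; trivial. apply Rmult_le_compat_l; trivial. }
  assert (H2 : (gamma * (Cmod y * Cmod y) <= gamma * ((1 - X ^ 2) * (1 - X ^ 2)))%R).
  { apply Rmult_le_compat_l; trivial. apply Rmult_le_compat; trivial. }
  specialize (H X (conj HX0 HX1)).
  apply Rmult_le_compat_l with (r := (1 - X)%R) in H; [|lra].
  replace ((1 - X) * (alpha * X * (1 + X) + gamma * ((1 - X) * (1 + X) ^ 2)))%R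
    with (alpha * (X * (1 - X ^ 2)) + gamma * ((1 - X ^ 2) * (1 - X ^ 2)))%R in H by ring.
  replace ((1 - X) * (B * (1 + X + X ^ 2)))%R with (B - B * (X * X * X))%R in H by ring.
  lra.
Qed.

(** The frame shared by the four classes: a class supplies [p = N / M], the dictionary between
    [a_3, a_4, a_5] and [x, y, w], and a polynomial inequality. The difference [w - x * x] is the
    [v] of the normal form. *)
Lemma hankel_upper_bound (f : C -> C) (a A M N : nat -> C) (x y w : C) (alpha gamma B : R) :
  normalized_analytic f a -> a 2%nat = 0 ->
  (forall z, in_disk z -> f z = 0 -> z = 0) -> inverse_coeffs f A ->
  tame 1 M -> tame 1 N ->
  M 0%nat = 1 -> N 0%nat = 1 -> M 1%nat = 0 -> N 1%nat = 0 ->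
  N 2%nat = M 2%nat + 2 * x -> N 3%nat = M 3%nat + 2 * y ->
  N 4%nat = M 4%nat + 2 * x * M 2%nat + 2 * w ->
  (forall z, in_disk z -> CPS M z <> 0) ->
  (forall z, in_disk z -> z <> 0 -> (0 < Re (CPS N z / CPS M z))%R) ->
  a 3%nat * a 5%nat - 3 * (a 3%nat * a 3%nat * a 3%nat) - a 4%nat * a 4%nat
    = RtoC alpha * (x * (w - x * x)) - RtoC B * (x * x * x) - RtoC gamma * (y * y) ->
  (0 <= alpha)%R -> (0 <= gamma)%R -> (0 <= B)%R ->
  (forall X, (0 <= X <= 1)%R ->
     (alpha * X * (1 + X) + gamma * ((1 - X) * (1 + X) ^ 2) <= B * (1 + X + X ^ 2))%R) ->
  (Cmod (hankel23 A) <= B)%R.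
Proof.
  intros Hf a2 Hnz HA HM HN M0 N0 M1 N1 N2 N3 N4 HM0 Hpos HH Ha Hg HB Hineq.
  rewrite (hankel23_inverse f a A Hf a2 HA (inverse_coeffs_0 f A Hnz HA)), HH.
  destruct (caratheodory_quotient_bounds M N x y w) as [By Bv]; trivial.
  now apply hankel_estimate.
Qed.

(** * Bounds and extremal functions *)

Lemma dcoef_eq (a : nat -> C) (n : nat) (c : R) :
  INR (S n) = c -> dcoef a n = RtoC c * a (S n).
Proof. now intros <-. Qed.

Lemma tame_delta0 : tame 1 delta0.
Proof. apply tame_bounded. intros [|n]; simpl; rewrite ?Cmod_0, ?Cmod_1; lra. Qed.

Lemma CPS_delta0 (z : C) : CPS delta0 z = 1.
Proof. apply CPS_unique, delta0_series. Qed.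

Lemma normalized_dcoef (f : C -> C) (a : nat -> C) :
  normalized_analytic f a -> a 2%nat = 0 ->
  dcoef a 0 = 1 /\ dcoef a 1 = 0 /\ dcoef a 2 = 3 * a 3%nat /\
  dcoef a 3 = 4 * a 4%nat /\ dcoef a 4 = 5 * a 5%nat.
Proof.
  intros (_ & a1 & _) a2.
  rewrite (dcoef_eq a 0 1), (dcoef_eq a 1 2), (dcoef_eq a 2 3), (dcoef_eq a 3 4),
    (dcoef_eq a 4 5) by (simpl; lra).
  rewrite a1, a2. repeat split; ring.
Qed.

(** Here [p = f'], so [a_3 = 2x/3], [a_4 = y/2], [a_5 = 2w/5]. The functional is
    [(4/15) x w - (8/9) x^3 - y^2/4], and [w = v + x^2] makes the cubic coefficient
    [4/15 - 8/9 = -28/45]. *)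
Lemma bounded_turning_bound (f : C -> C) (a A : nat -> C) :
  normalized_analytic f a -> a 2%nat = 0 -> bounded_turning f -> inverse_coeffs f A ->
  (Cmod (hankel23 A) <= 28 / 45)%R.
Proof.
  intros Hf a2 Hbt HA.
  assert (Ha := normalized_tame f a Hf).
  destruct (normalized_dcoef f a Hf a2) as (d0 & d1 & d2 & d3 & d4).
  apply (hankel_upper_bound f a A delta0 (dcoef a)
    (3 / 2 * a 3%nat) (2 * a 4%nat) (5 / 2 * a 5%nat) (4 / 15) (1 / 4)); trivial.
  - intros z. now apply (bounded_turning_nonzero f a).
  - apply tame_delta0.
  - now apply tame_dcoef.
  - rewrite d2. simpl. field.
  - rewrite d3. simpl. field.
  - rewrite d4. simpl. field.
  - intros z _. rewrite CPS_delta0. intros E. apply RtoC_inj in E. lra.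
  - intros z Hz _. destruct Hbt as (f1 & Hd & Hp).
    rewrite CPS_delta0, <- (normalized_derivative f a z (f1 z)) by (trivial; now apply Hd).
    replace (f1 z / 1) with (f1 z) by field. now apply Hp.
  - rewrite !RtoC_div by lra. field.
  - lra.
  - lra.
  - lra.
  - intros X HX. nra.
Qed.

(** Coefficients of [z f'], whose derivative [f' + z f''] is the numerator of the convexity quotient
    over [f']. *)
Definition mul_index (a : nat -> C) (n : nat) : C := RtoC (INR n) * a n.

Lemma tame_mul_index (a : nat -> C) : tame 1 a -> tame 1 (mul_index a).
Proof.
  intros Ha. apply tame_le with (fun n => RtoC (INR (S n)) * a n); [|now apply tame_mul_succ].
  intros n. unfold mul_index. rewrite !Cmod_mult, !Cmod_R, !Rabs_pos_eq by apply pos_INR.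
  apply Rmult_le_compat_r; [apply Cmod_ge_0|]. rewrite S_INR. lra.
Qed.

(** Here [p = (z f')' / f'], so [a_3 = x/3], [a_4 = y/6], [a_5 = (w + x^2)/10]; the cubic
    coefficient is [1/15 - 1/9 = -2/45]. *)
Lemma convex_fn_bound (f : C -> C) (a A : nat -> C) :
  normalized_analytic f a -> a 2%nat = 0 -> convex_fn f -> inverse_coeffs f A ->
  (Cmod (hankel23 A) <= 2 / 45)%R.
Proof.
  intros Hf a2 Hcv HA.
  assert (Ha := normalized_tame f a Hf).
  assert (Hi := tame_mul_index a Ha).
  destruct (normalized_dcoef f a Hf a2) as (d0 & d1 & d2 & d3 & d4).
  assert (Hnz : forall z, in_disk z -> f z = 0 -> z = 0).
  { intros z. now apply (convex_fn_nonzero f a). }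
  destruct Hcv as (f1 & f2 & Hd1 & Hd2 & Hp).
  assert (E1 : forall w, in_disk w -> f1 w = CPS (dcoef a) w).
  { intros w Hw. now apply (normalized_derivative f a); [| |apply Hd1]. }
  assert (E2 : forall w, in_disk w -> f2 w = CPS (dcoef (dcoef a)) w).
  { now apply (normalized_second_derivative f a f1 f2). }
  assert (EN : forall n c, INR (S n) = c -> dcoef (mul_index a) n = RtoC c * dcoef a n).
  { intros n c Hc. rewrite (dcoef_eq _ n c Hc). reflexivity. }
  apply (hankel_upper_bound f a A (dcoef a) (dcoef (mul_index a))
    (3 * a 3%nat) (6 * a 4%nat) (10 * a 5%nat - 9 * (a 3%nat * a 3%nat)) (1 / 30) (1 / 36));
    trivial.
  - now apply tame_dcoef.
  - now apply tame_dcoef.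
  - rewrite (EN 0%nat 1%R) by (simpl; lra). rewrite d0. ring.
  - rewrite (EN 1%nat 2%R) by (simpl; lra). rewrite d1. ring.
  - rewrite (EN 2%nat 3%R) by (simpl; lra). rewrite d2. ring.
  - rewrite (EN 3%nat 4%R) by (simpl; lra). rewrite d3. ring.
  - rewrite (EN 4%nat 5%R) by (simpl; lra). rewrite d2, d4. ring.
  - intros z Hz. rewrite <- E1 by trivial. now apply Hp.
  - intros z Hz _. destruct (Hp z Hz) as [H0 Hpz].
    rewrite (CPS_dcoef_factor _ z Hi Hz).
    change (shift 1 (mul_index a)) with (dcoef a).
    rewrite <- E1, <- E2 by trivial.
    replace ((f1 z + z * f2 z) / f1 z) with (1 + z * f2 z / f1 z) by (field; trivial).
    exact Hpz.
  - rewrite !RtoC_div by lra. field.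
  - lra.
  - lra.
  - lra.
  - intros X HX. nra.
Qed.

(** Here [p = f' / (f/z)], so [a_3 = x], [a_4 = 2y/3], [a_5 = (w + x^2)/2]; the cubic coefficient is
    [1 - 3 = -2]. *)
Lemma starlike_fn_bound (f : C -> C) (a A : nat -> C) :
  normalized_analytic f a -> a 2%nat = 0 -> starlike_fn f -> inverse_coeffs f A ->
  (Cmod (hankel23 A) <= 2)%R.
Proof.
  intros Hf a2 Hst HA.
  assert (Ha := normalized_tame f a Hf).
  destruct (normalized_dcoef f a Hf a2) as (d0 & d1 & d2 & d3 & d4).
  assert (Hfz : forall z, in_disk z -> f z = z * CPS (shift 1 a) z).
  { intros z Hz. rewrite (normalized_eq f a), CPS_factor, (proj1 Hf) by trivial. ring. }
  assert (HM : forall z, in_disk z -> CPS (shift 1 a) z <> 0).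
  { intros z Hz E. destruct (Ceq_dec z 0) as [->|Hz0].
    - rewrite (CPS_0 1) in E by (try lra; now apply tame_shift_k).
      unfold shift in E. simpl in E. rewrite (proj1 (proj2 Hf)) in E.
      apply RtoC_inj in E. lra.
    - apply Hz0, (starlike_fn_nonzero f); trivial. rewrite Hfz, E by trivial. ring. }
  apply (hankel_upper_bound f a A (shift 1 a) (dcoef a)
    (a 3%nat) (3 / 2 * a 4%nat) (2 * a 5%nat - a 3%nat * a 3%nat) (1 / 2) (4 / 9)); trivial.
  - intros z. now apply starlike_fn_nonzero.
  - now apply tame_shift_k.
  - now apply tame_dcoef.
  - apply Hf.
  - rewrite d2. unfold shift; simpl. ring.
  - rewrite d3. unfold shift; simpl. field.
  - rewrite d4. unfold shift; simpl. ring.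
  - intros z Hz Hz0. destruct Hst as (f1 & Hd & Hp).
    destruct (Hp z Hz Hz0) as [_ Hpz].
    rewrite <- (normalized_derivative f a z (f1 z)) by (trivial; now apply Hd).
    rewrite Hfz in Hpz by trivial.
    replace (f1 z / CPS (shift 1 a) z) with (z * f1 z / (z * CPS (shift 1 a) z)); trivial.
    field. split; [now apply HM|trivial].
  - rewrite !RtoC_div by lra. field.
  - lra.
  - lra.
  - lra.
  - intros X HX. nra.
Qed.

(** The denominator is even, so [a_4] enters [p] through [f'] alone and [a_4 = y/2]; [a_3] and [a_5]
    are as in the starlike case. Only the coefficient of [y^2] changes, from [4/9] to [1/4]. *)
Lemma sym_starlike_fn_bound (f : C -> C) (a A : nat -> C) :
  normalized_analytic f a -> a 2%nat = 0 -> sym_starlike_fn f -> inverse_coeffs f A ->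
  (Cmod (hankel23 A) <= 2)%R.
Proof.
  intros Hf a2 Hst HA.
  assert (Ha := normalized_tame f a Hf).
  destruct (normalized_dcoef f a Hf a2) as (d0 & d1 & d2 & d3 & d4).
  destruct (sym_starlike_series f a Hf Hst) as (HD & Hp & _).
  apply (hankel_upper_bound f a A (shift 1 (odd_part a)) (dcoef a)
    (a 3%nat) (2 * a 4%nat) (2 * a 5%nat - a 3%nat * a 3%nat) (1 / 2) (1 / 4)); trivial.
  - intros z. now apply (sym_starlike_fn_nonzero f a).
  - now apply tame_shift_k, tame_odd_part.
  - now apply tame_dcoef.
  - apply Hf.
  - rewrite d2. unfold shift, odd_part; simpl. ring.
  - rewrite d3. unfold shift, odd_part; simpl. ring.
  - rewrite d4. unfold shift, odd_part; simpl. ring.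
  - rewrite !RtoC_div by lra. field.
  - lra.
  - lra.
  - lra.
  - intros X HX. nra.
Qed.

(** * Extremal functions *)

Lemma cayley_Re_pos (s : C) : in_disk s -> (0 < Re ((1 + s) / (1 - s)))%R.
Proof.
  unfold in_disk. intros Hs.
  assert (H2 : (Cmod s ^ 2 < 1)%R) by (generalize (Cmod_ge_0 s); nra).
  rewrite Cmod2_alt in H2. destruct s as [x y]. simpl in H2.
  assert (Hp : (0 < (1 - x) ^ 2 + y ^ 2)%R) by nra.
  replace (Re ((1 + (x, y)) / (1 - (x, y))))
    with ((1 - x ^ 2 - y ^ 2) / ((1 - x) ^ 2 + y ^ 2))%R.
  - apply Rdiv_lt_0_compat; [lra|trivial].
  - unfold Re, Cdiv, Cinv; simpl. field. nra.
Qed.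

Lemma in_disk_sqr (z : C) : in_disk z -> in_disk (z * z).
Proof. unfold in_disk. rewrite Cmod_mult. generalize (Cmod_ge_0 z). nra. Qed.

Lemma one_sub_neq_0 (s : C) : in_disk s -> 1 - s <> 0.
Proof.
  intros Hs E. unfold in_disk in Hs.
  replace s with (RtoC 1) in Hs by (transitivity (1 - s + s); [|rewrite E]; ring).
  rewrite Cmod_1 in Hs. lra.
Qed.

Definition odd_coef (c : nat -> R) (n : nat) : C := if Nat.odd n then RtoC (c n) else 0.

Lemma odd_coef_bounded (c : nat -> R) : (forall n, (Nat.odd n = true -> 0 <= c n <= 1)%R) ->
  forall n, (Cmod (odd_coef c n) <= 1)%R.
Proof.
  intros H n. unfold odd_coef. specialize (H n). destruct (Nat.odd n).
  - rewrite Cmod_R. apply Rabs_le. specialize (H eq_refl). lra.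
  - rewrite Cmod_0. lra.
Qed.

(** Oddness gives [a_2 = a_4 = 0], so [a_3 a_5 - 3 a_3^3] is all that remains of the functional. *)
Lemma odd_coef_extremal (P : (C -> C) -> Prop) (c : nat -> R) (B : R) :
  (forall n, (Nat.odd n = true -> 0 <= c n <= 1)%R) -> c 1%nat = 1%R ->
  P (CPS (odd_coef c)) ->
  (B = Rabs (c 3%nat * c 5%nat - 3 * (c 3%nat * c 3%nat * c 3%nat)))%R ->
  exists (f : C -> C) (a A : nat -> C),
      normalized_analytic f a /\ a 2%nat = 0 /\ P f /\ inverse_coeffs f A /\
      Cmod (hankel23 A) = B.
Proof.
  intros Hc c1 HP HB. set (a := odd_coef c).
  assert (Hb := odd_coef_bounded c Hc). fold a in Hb.
  assert (a1 : a 1%nat = 1) by (unfold a, odd_coef; simpl; now rewrite c1).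
  assert (Hn : normalized_analytic (CPS a) a).
  { split; [reflexivity|]. split; [exact a1|].
    intros z Hz. apply CPS_correct with 1%R; trivial. now apply tame_bounded. }
  assert (HA := inverse_coeffs_reversion a Hb eq_refl a1).
  exists (CPS a), a, (reversion a). repeat split; trivial; try apply Hn.
  rewrite (hankel23_inverse (CPS a) a _ Hn eq_refl HA (reversion_0 a)), HB.
  rewrite <- Cmod_R. f_equal. unfold a, odd_coef. simpl.
  rewrite RtoC_minus, !RtoC_mult. ring.
Qed.

(** The coefficients have period 2, so the sum satisfies [S = 1 + z^2 S]. *)
Lemma CPS_geometric_even (z : C) : in_disk z ->
  CPS (shift 1 (odd_coef (fun _ => 1%R))) z = / (1 - z * z).
Proof.
  intros Hz. set (c := fun _ : nat => 1%R).
  assert (Ht : tame 1 (odd_coef c)).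
  { apply tame_bounded, odd_coef_bounded. unfold c. intros; lra. }
  assert (E : CPS (shift 1 (odd_coef c)) z = 1 + z * z * CPS (shift 1 (odd_coef c)) z).
  { rewrite (CPS_shift_k 1 1), (CPS_shift_k 1 2) at 1 by trivial.
    replace (CPS (shift 3 (odd_coef c)) z) with (CPS (shift 1 (odd_coef c)) z).
    - unfold odd_coef at 1 2. simpl. unfold c at 1. ring.
    - apply CPS_ext. intros n. reflexivity. }
  assert (Hne := one_sub_neq_0 _ (in_disk_sqr z Hz)).
  set (S := CPS (shift 1 (odd_coef c)) z) in *.
  transitivity ((S - z * z * S) / (1 - z * z)); [field; trivial|].
  replace (S - z * z * S) with (RtoC 1) by (rewrite E at 1; ring).
  field. trivial.
Qed.

Lemma geometric_even_derive (z : C) : in_disk z ->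
  is_derive (fun w : C => / (1 - w * w)) z (2 * z / ((1 - z * z) * (1 - z * z))).
Proof.
  intros Hz. assert (Hne := one_sub_neq_0 _ (in_disk_sqr z Hz)).
  eapply is_C_derive_eq_val.
  - apply (is_C_derive_inv (fun w => 1 - w * w)); trivial.
    apply (is_C_derive_ext_ball (fun w => 1 + - (1) * (w * w)) _ z
             (0 + (0 * (z * z) + - (1) * (1 * z + z * 1))) 1 Rlt_0_1).
    + intros w _. ring.
    + apply (is_C_derive_plus (fun _ => RtoC 1)); [apply is_C_derive_const|].
      apply (is_C_derive_mult (fun _ => - (1)) (fun w => w * w)); [apply is_C_derive_const|].
      apply (is_C_derive_mult (fun w => w) (fun w => w)); apply is_C_derive_id.
  - field. trivial.
Qed.

(** On odd indices this is half of [log ((1+z)/(1-z))], whose derivative is [1/(1-z^2)]. *)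
Definition inv_coef (n : nat) : R := / INR n.

Lemma inv_coef_bounds n : Nat.odd n = true -> (0 <= inv_coef n <= 1)%R.
Proof.
  intros H. destruct n as [|n]; [discriminate|]. unfold inv_coef.
  assert (1 <= INR (S n))%R by (rewrite S_INR; generalize (pos_INR n); lra).
  split; [left; apply Rinv_0_lt_compat; lra|].
  rewrite <- Rinv_1. apply Rinv_le_contravar; lra.
Qed.

Lemma dcoef_inv_coef n : dcoef (odd_coef inv_coef) n = shift 1 (odd_coef (fun _ => 1%R)) n.
Proof.
  unfold dcoef, shift, odd_coef, inv_coef. change (1 + n)%nat with (S n).
  destruct (Nat.odd (S n)); [|ring].
  rewrite <- RtoC_mult, Rinv_r; trivial. apply not_0_INR. lia.
Qed.

(** On odd indices this is [log ((1+z)/(1-z)) - z], whose derivative is [(1+z^2)/(1-z^2)];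
    subtracting [z] changes only the coefficient at [1]. *)
Definition turning_coef (n : nat) : R := if Nat.eqb n 1 then 1 else 2 * / INR n.

Lemma turning_coef_bounds n : Nat.odd n = true -> (0 <= turning_coef n <= 1)%R.
Proof.
  intros H. destruct n as [|[|[|n]]]; try discriminate; unfold turning_coef; simpl Nat.eqb;
    cbv iota; [lra|].
  assert (3 <= INR (S (S (S n))))%R by (rewrite !S_INR; generalize (pos_INR n); lra).
  assert (0 < / INR (S (S (S n))))%R by (apply Rinv_0_lt_compat; lra).
  assert (/ INR (S (S (S n))) <= / 3)%R by (apply Rinv_le_contravar; lra).
  lra.
Qed.

Lemma CPS_dcoef_turning (z : C) : in_disk z ->
  CPS (dcoef (odd_coef turning_coef)) z = (1 + z * z) / (1 - z * z).
Proof.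
  intros Hz. assert (Hne := one_sub_neq_0 _ (in_disk_sqr z Hz)).
  assert (Ht : tame 1 (shift 1 (odd_coef (fun _ => 1%R)))).
  { apply tame_shift_k, tame_bounded, odd_coef_bounded. intros; lra. }
  rewrite (CPS_ext _ (fun n => 2 * shift 1 (odd_coef (fun _ => 1%R)) n + - (1) * delta0 n)).
  - rewrite (CPS_plus 1), !(CPS_scal 1), CPS_delta0, CPS_geometric_even;
      trivial; try apply tame_scal; trivial; try apply tame_delta0.
    field. trivial.
  - intros n. unfold dcoef, shift, odd_coef, turning_coef. change (1 + n)%nat with (S n).
    destruct n as [|n]; [simpl; ring|].
    simpl Nat.eqb. simpl delta0. destruct (Nat.odd (S (S n))); [|ring].
    transitivity (RtoC 2 * RtoC (INR (S (S n)) * / INR (S (S n)))).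
    + rewrite !RtoC_mult. ring.
    + rewrite Rinv_r by (apply not_0_INR; lia). ring.
Qed.

Lemma turning_extremal : bounded_turning (CPS (odd_coef turning_coef)).
Proof.
  exists (fun z => (1 + z * z) / (1 - z * z)). split.
  - intros z Hz. rewrite <- CPS_dcoef_turning by trivial.
    apply CPS_derive with 1%R; trivial.
    apply tame_bounded, odd_coef_bounded, turning_coef_bounds.
  - intros z Hz. now apply cayley_Re_pos, in_disk_sqr.
Qed.

Lemma convex_extremal : convex_fn (CPS (odd_coef inv_coef)).
Proof.
  exists (fun z => / (1 - z * z)), (fun z => 2 * z / ((1 - z * z) * (1 - z * z))).
  split; [|split].
  - intros z Hz. rewrite <- CPS_geometric_even by trivial.
    rewrite <- (CPS_ext _ _ z dcoef_inv_coef).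
    apply CPS_derive with 1%R; trivial.
    apply tame_bounded, odd_coef_bounded, inv_coef_bounds.
  - intros z Hz. now apply geometric_even_derive.
  - intros z Hz. assert (Hne := one_sub_neq_0 _ (in_disk_sqr z Hz)). split.
    + intros E. apply (f_equal (Cmult (1 - z * z))) in E.
      rewrite Cinv_r, Cmult_0_r in E by trivial. apply RtoC_inj in E. lra.
    + replace (1 + z * (2 * z / ((1 - z * z) * (1 - z * z))) / / (1 - z * z))
        with ((1 + z * z) / (1 - z * z)).
      * now apply cayley_Re_pos, in_disk_sqr.
      * field. trivial.
Qed.

Lemma koebe_sym_eq (z : C) : in_disk z -> CPS (odd_coef (fun _ => 1%R)) z = z * / (1 - z * z).
Proof.
  intros Hz. rewrite CPS_factor, CPS_geometric_even; trivial.
  - unfold odd_coef. simpl. ring.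
  - apply tame_bounded, odd_coef_bounded. intros; lra.
Qed.

Lemma koebe_sym_derive (z : C) : in_disk z ->
  is_derive (CPS (odd_coef (fun _ => 1%R))) z
    ((1 + z * z) / ((1 - z * z) * (1 - z * z))).
Proof.
  intros Hz. assert (Hne := one_sub_neq_0 _ (in_disk_sqr z Hz)).
  apply (is_C_derive_ext_ball (fun w => w * / (1 - w * w)) _ z _ (1 - Cmod z)%R).
  - unfold in_disk in Hz. lra.
  - intros w Hw. symmetry. apply koebe_sym_eq. now apply disk_ball with z.
  - eapply is_C_derive_eq_val.
    + apply (is_C_derive_mult (fun w => w) (fun w => / (1 - w * w)));
        [apply is_C_derive_id|now apply geometric_even_derive].
    + cbv beta. field. trivial.
Qed.

Lemma koebe_sym_neq_0 (z : C) : in_disk z -> z <> 0 -> CPS (odd_coef (fun _ => 1%R)) z <> 0.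
Proof.
  intros Hz Hz0. assert (Hne := one_sub_neq_0 _ (in_disk_sqr z Hz)).
  rewrite koebe_sym_eq by trivial. intros E. apply Hz0.
  transitivity (z * / (1 - z * z) * (1 - z * z)); [field; trivial|]. rewrite E. ring.
Qed.

Lemma starlike_extremal : starlike_fn (CPS (odd_coef (fun _ => 1%R))).
Proof.
  exists (fun z => (1 + z * z) / ((1 - z * z) * (1 - z * z))).
  split; [apply koebe_sym_derive|].
  intros z Hz Hz0. assert (Hne := one_sub_neq_0 _ (in_disk_sqr z Hz)).
  split; [now apply koebe_sym_neq_0|]. rewrite koebe_sym_eq by trivial.
  replace (z * ((1 + z * z) / ((1 - z * z) * (1 - z * z))) / (z * / (1 - z * z)))
    with ((1 + z * z) / (1 - z * z)).
  - now apply cayley_Re_pos, in_disk_sqr.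
  - field. now split.
Qed.

(** For the odd function [f = z/(1-z^2)] one has [f(z) - f(-z) = 2 f(z)], so the quotient is the
    same as in the starlike case. *)
Lemma sym_starlike_extremal : sym_starlike_fn (CPS (odd_coef (fun _ => 1%R))).
Proof.
  exists (fun z => (1 + z * z) / ((1 - z * z) * (1 - z * z))).
  split; [apply koebe_sym_derive|].
  intros z Hz Hz0. assert (Hne := one_sub_neq_0 _ (in_disk_sqr z Hz)).
  assert (E : CPS (odd_coef (fun _ => 1%R)) z - CPS (odd_coef (fun _ => 1%R)) (- z)
              = 2 * (z * / (1 - z * z))).
  { rewrite !koebe_sym_eq by (trivial; now apply in_disk_opp).
    replace (- z * - z) with (z * z) by ring. ring. }
  rewrite E. split.
  - intros E0. apply Hz0.
    transitivity (2 * (z * / (1 - z * z)) * (1 - z * z) / 2); [field; trivial|].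
    rewrite E0. field.
  - replace (2 * z * ((1 + z * z) / ((1 - z * z) * (1 - z * z))) / (2 * (z * / (1 - z * z))))
      with ((1 + z * z) / (1 - z * z)).
    + now apply cayley_Re_pos, in_disk_sqr.
    + field. now split.
Qed.

Theorem theorem1 :
  sharp_H23_bound bounded_turning (28 / 45)%R /\
  sharp_H23_bound convex_fn (2 / 45)%R /\
  sharp_H23_bound starlike_fn 2%R /\
  sharp_H23_bound sym_starlike_fn 2%R.
Proof.
  repeat split.
  - exact bounded_turning_bound.
  - apply (odd_coef_extremal _ turning_coef); [exact turning_coef_bounds|reflexivity
      |exact turning_extremal|].
    unfold turning_coef; simpl. rewrite Rabs_left; field_simplify; lra.
  - exact convex_fn_bound.
  - apply (odd_coef_extremal _ inv_coef); [exact inv_coef_bounds|apply Rinv_1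
      |exact convex_extremal|].
    unfold inv_coef; simpl. rewrite Rabs_left; field_simplify; lra.
  - exact starlike_fn_bound.
  - apply (odd_coef_extremal _ (fun _ => 1%R)); [intros; lra|reflexivity
      |exact starlike_extremal|].
    rewrite Rabs_left; lra.
  - exact sym_starlike_fn_bound.
  - apply (odd_coef_extremal _ (fun _ => 1%R)); [intros; lra|reflexivity
      |exact sym_starlike_extremal|].
    rewrite Rabs_left; lra.
Qed.
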